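(* Let $\mathcal K$ be a $0$-framed long knot, let $k=\mathbb Q(\epsilon)$, $\lambda\in k$, $\mu\in k[[h]]$, and let $m_0$ be the highest weight vector of the $\mathfrak D_{\mathfrak{sl}_2}$-module $\widetilde M_h(\lambda,\mu)$. Then $$\mathbf J_{\mathcal K}(\lambda,h)\,m_0=\phi(\mathbf Z_{\mathbb D}(\mathcal K))\,m_0,$$ where $\mathbf J_{\mathcal K}$ is the colored Jones function, $\mathbf Z_{\mathbb D}(\mathcal K)$ is the universal invariant associated with $\mathbb D$, and $\phi\colon\mathbb D\to\mathfrak D_{\mathfrak{sl}_2}$ is the isomorphism given in the context.
   Context: **Universal invariant.** A long knot is a framed oriented tangle in $I^3$ with a single open component running upwards, represented by a rotational diagram: all crossings are upwards oriented, and maxima and minima occur only in pairs forming full clockwise or counterclockwise rotations. For an algebra $A$ with $R=\sum_i\alpha_i\otimes\beta_i$, $R^{-1}=\sum_i\bar\alpha_i\otimes\bar\beta_i$ and balancing element $\kappa$, place $\alpha_i$ on the overstrand and $\beta_i$ on the understrand of positive crossings, $\bar\alpha_i$, $\bar\beta_i$ likewise on negative crossings, $\kappa$ (resp. $\kappa^{-1}$) on full clockwise (resp. counterclockwise) rotations. $Z_A(\mathcal K)\in A$ is the sum over all indices of the product of beads written from right to left along the orientation. **$U_h(\mathfrak{sl}_2)$ and the colored Jones function.** Let $q=e^h$ and $[n]_q=\frac{q^n-q^{-n}}{q-q^{-1}}$. $U_h=U_h(\mathfrak{sl}_2)$ is the topological $k[[h]]$-algebra generated by $E,F,H$ with $[H,E]=2E$,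 $[H,F]=-2F$, $[E,F]=\frac{q^H-q^{-H}}{q-q^{-1}}$, with $R=\sum_{n\ge0}\frac{(q-q^{-1})^n}{[n]_q!}q^{\frac{H\otimes H}2+\frac{n(n-1)}2}E^n\otimes F^n$ and balancing element $q^H$. The Verma module $M_h(\lambda)$ over $k[[h]]$ has basis $\{m_p\}_{p\in\mathbb N}$ and action $Hm_p=(\lambda-2p)m_p$, $Em_0=0$, $Em_{p+1}=[p+1]_qm_p$, $Fm_p=\frac{q^{\lambda-p}-q^{p-\lambda}}{q-q^{-1}}m_{p+1}$. $Z_{U_h}(\mathcal K)$ is central, and the colored Jones function $\mathbf J_{\mathcal K}(\lambda,h)\in k[[h]]$ is defined by $\mathbf J_{\mathcal K}(\lambda,h)m_0=Z_{U_h}(\mathcal K)m_0$ in $M_h(\lambda)$. **$\mathfrak D_{\mathfrak{sl}_2}$.** The topological $k[[h]]$-algebra generated by $E,F,H,\widetilde H$ with $[H,E]=2E$, $[\widetilde H,E]=-2E$, $[H,F]=-2F$, $[\widetilde H,F]=2F$, $[E,F]=\frac{q^H-q^{\widetilde H}}{q-q^{-1}}$, $[H,\widetilde H]=0$. Put $c=-\frac{H+\widetilde H}2$ (central), $H'=H+c$, $E'=E$, $F'=e^{hc}F$. The module $\widetilde M_h(\lambda,\mu)$ has basis $\{m_p\}_{p\in\mathbb N}$ and action $H'm_p=(\lambda-2p)m_p$, $cm_p=\mu m_p$, $E'm_0=0$, $E'm_{p+1}=[p+1]_qm_p$, $F'm_p=\frac{q^{\lambda-p}-q^{p-\lambda}}{q-q^{-1}}m_{p+1}$;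 $m_0$ is its highest weight vector. **$\mathbb D$ and $\phi$.** Let $q_\epsilon=e^{\epsilon h}$, $\{n\}_{q_\epsilon}=\frac{1-q_\epsilon^n}{1-q_\epsilon}$. $\mathbb D$ is the topological $\mathbb Q(\epsilon)[[h]]$-algebra $h$-adically generated by $\mathbf y,\mathbf b,\mathbf a,\mathbf x$ with $\mathbf x\mathbf y=q_\epsilon\mathbf y\mathbf x+\frac{1-\mathbf A\mathbf B}h$, $[\mathbf a,\mathbf x]=\mathbf x$, $[\mathbf b,\mathbf x]=\epsilon\mathbf x$, $[\mathbf a,\mathbf y]=-\mathbf y$, $[\mathbf b,\mathbf y]=-\epsilon\mathbf y$, $[\mathbf a,\mathbf b]=0$, where $\mathbf A=e^{-\epsilon h\mathbf a}$, $\mathbf B=e^{-h\mathbf b}$. Its universal $R$-matrix is $\mathbf R=\sum_{m,n\ge0}\frac{h^{m+n}}{\{m\}_{q_\epsilon}!\,n!}\mathbf y^m\mathbf b^n\otimes\mathbf a^n\mathbf x^m$ and its balancing element is $(\mathbf A\mathbf B)^{1/2}$; the associated universal invariant is $\mathbf Z_{\mathbb D}(\mathcal K)$. The isomorphism $\phi\colon\mathbb D\to\mathfrak D_{\mathfrak{sl}_2}$ (with $k=\mathbb Q(\epsilon)$) is given by $\mathbf b\mapsto-\epsilon H/2$, $\mathbf y\mapsto E$, $\mathbf a\mapsto\widetilde H/2$, $\mathbf x\mapsto\frac{q-q^{-1}}{2h\epsilon^{-1}}q^{-\widetilde H}F$, $h\mapsto2h\epsilon^{-1}$. *)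

(* Defs.v *)
From HB Require Import structures.
From mathcomp Require Import all_boot all_order all_algebra.
From mathcomp Require Import boolp classical_sets.
From mathcomp Require Import finmap generic_quotient ring_quotient.
From mathcomp.multinomials Require Import monalg.

Set Implicit Arguments.
Unset Strict Implicit.
Unset Printing Implicit Defensive.

Import GRing.Theory.

Local Open Scope ring_scope.
Local Open Scope quotient_scope.

(* V[[h]] for an additive group V.  For a ring S, S[[h]] is the h-adic
   completion of S[h]; for a k-module V, V[[h]] is the topologically free
   k[[h]]-module on V. *)
Record fps (V : Type) := FPS { coef : nat -> V }.

HB.instance Definition _ (V : Type) := gen_eqMixin (fps V).
HB.instance Definition _ (V : Type) := gen_choiceMixin (fps V).

Lemma fpsP (V : Type) (f g : fps V) : coef f =1 coef g -> f = g.
Proof. by case: f g => [f] [g] /= /funext ->. Qed.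

Section FpsZmod.
Variable V : zmodType.
Implicit Types f g : fps V.

Definition fps_zero : fps V := FPS (fun=> 0).
Definition fps_opp f := FPS (fun n => - coef f n).
Definition fps_add f g := FPS (fun n => coef f n + coef g n).

Fact fps_addA : associative fps_add.
Proof. by move=> f g l; apply: fpsP => n /=; rewrite addrA. Qed.
Fact fps_addC : commutative fps_add.
Proof. by move=> f g; apply: fpsP => n /=; rewrite addrC. Qed.
Fact fps_add0 : left_id fps_zero fps_add.
Proof. by move=> f; apply: fpsP => n /=; rewrite add0r. Qed.
Fact fps_addN : left_inverse fps_zero fps_opp fps_add.
Proof. by move=> f; apply: fpsP => n /=; rewrite addNr. Qed.

HB.instance Definition _ :=
  GRing.isZmodule.Build (fps V) fps_addA fps_addC fps_add0 fps_addN.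

Definition fpsC (v : V) : fps V := FPS (fun n => if n is 0 then v else 0).
End FpsZmod.

Lemma sum_triangle (V : zmodType) (F : nat -> nat -> nat -> V) n :
  \sum_(j < n.+1) \sum_(l < (n - j).+1) F j l (n - j - l)%N =
  \sum_(i < n.+1) \sum_(j < i.+1) F j (i - j)%N (n - i)%N.
Proof.
transitivity (\sum_(0 <= j < n.+1) \sum_(0 <= i < n.+1 | (j <= i)%N)
                F j (i - j)%N (n - i)%N).
  rewrite big_mkord; apply: eq_bigr => -[j /=]; rewrite ltnS => lejn _.
  rewrite [RHS](@big_cat_nat _ _ _ j) //=; last exact: leqW.
  rewrite [X in _ = X + _]big_nat_cond [X in _ = X + _]big1 ?add0r; last first.
    by move=> i /andP[/andP[_ lt] le]; rewrite leqNgt lt in le.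
  rewrite -[X in \sum_(X <= _ < _ | _) _](add0n j) big_addn big_mkord subSn //.
  apply: eq_big => [i|i _]; first by rewrite leq_addl.
  by rewrite addnK subnDA subnAC.
under eq_bigr do rewrite big_mkord.
rewrite big_mkord (exchange_big_dep xpredT) //=; apply: eq_bigr => i _.
by rewrite (big_ord_widen _ (fun j => F j (i - j)%N (n - i)%N) (ltn_ord i)).
Qed.

Section FpsRing.
Variable S : nzRingType.
Implicit Types f g : fps S.

Definition fps_one : fps S := fpsC 1.
Definition fps_mul f g : fps S :=
  FPS (fun n => \sum_(i < n.+1) coef f i * coef g (n - i)%N).

Fact fps_mulA : associative fps_mul.
Proof.
move=> f g l; apply: fpsP => n /=.
under eq_bigr do rewrite mulr_sumr.
under [RHS]eq_bigr do rewrite mulr_suml.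
rewrite (sum_triangle (fun a b c => coef f a * (coef g b * coef l c))).
by apply: eq_bigr => i _; apply: eq_bigr => j _; rewrite mulrA.
Qed.
Fact fps_mul1 : left_id fps_one fps_mul.
Proof.
move=> f; apply: fpsP => n /=; rewrite big_ord_recl /= mul1r subn0.
by rewrite big1 ?addr0 // => i _; rewrite mul0r.
Qed.
Fact fps_mulr1 : right_id fps_one fps_mul.
Proof.
move=> f; apply: fpsP => n /=; rewrite big_ord_recr /= subnn mulr1.
rewrite big1 ?add0r // => -[i /= lti] _.
by rewrite -(subnSK lti) mulr0.
Qed.
Fact fps_mulDl : left_distributive fps_mul +%R.
Proof.
move=> f g l; apply: fpsP => n /=; rewrite -big_split /=.
by apply: eq_bigr => i _; rewrite mulrDl.
Qed.
Fact fps_mulDr : right_distributive fps_mul +%R.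
Proof.
move=> f g l; apply: fpsP => n /=; rewrite -big_split /=.
by apply: eq_bigr => i _; rewrite mulrDr.
Qed.
Fact fps_one_neq0 : fps_one != 0.
Proof.
apply/eqP => /(congr1 (fun f => coef f 0)) /= /eqP.
by rewrite oner_eq0.
Qed.

HB.instance Definition _ := GRing.Zmodule_isNzRing.Build (fps S)
  fps_mulA fps_mul1 fps_mulr1 fps_mulDl fps_mulDr fps_one_neq0.

Definition hvar : fps S := FPS (fun n => (n == 1%N)%:R).
End FpsRing.

Notation "''h'" := (hvar _) : ring_scope.

Section FpsLmod.
Variables (k : nzRingType) (V : lmodType k).

Definition fps_scale (c : fps k) (v : fps V) : fps V :=
  FPS (fun n => \sum_(i < n.+1) coef c i *: coef v (n - i)%N).

Fact fps_scaleA c d v : fps_scale c (fps_scale d v) = fps_scale (c * d) v.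
Proof.
apply: fpsP => n /=.
under eq_bigr do rewrite scaler_sumr.
under [RHS]eq_bigr do rewrite scaler_suml.
rewrite (sum_triangle (fun a b e => coef c a *: (coef d b *: coef v e))).
by apply: eq_bigr => i _; apply: eq_bigr => j _; rewrite scalerA.
Qed.
Fact fps_scale1 : left_id 1 fps_scale.
Proof.
move=> v; apply: fpsP => n /=; rewrite big_ord_recl /= scale1r subn0.
by rewrite big1 ?addr0 // => i _; rewrite scale0r.
Qed.
Fact fps_scaleDr : right_distributive fps_scale +%R.
Proof.
move=> c v w; apply: fpsP => n /=; rewrite -big_split /=.
by apply: eq_bigr => i _; rewrite scalerDr.
Qed.
Fact fps_scaleDl v : {morph fps_scale^~ v : c d / c + d}.
Proof.
move=> c d; apply: fpsP => n /=; rewrite -big_split /=.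
by apply: eq_bigr => i _; rewrite scalerDl.
Qed.

HB.instance Definition _ := GRing.Zmodule_isLmodule.Build (fps k) (fps V)
  fps_scaleA fps_scale1 fps_scaleDr fps_scaleDl.
End FpsLmod.

(* h-adic limits, for an additive group on which h acts by [h]. *)
Section Adic.
Variables (V : zmodType) (h : V -> V).

Definition hcvg (u : nat -> V) (v : V) : Prop :=
  forall N, exists n0, forall n, (n0 <= n)%N -> exists w, u n - v = iter N h w.

Definition hlim (u : nat -> V) : V := xget 0 (hcvg u).

Definition hsum (u : nat -> V) : V := hlim (fun n => \sum_(i < n) u i).
End Adic.

Definition ringsum (S : nzRingType) (u : nat -> fps S) : fps S :=
  hsum ( *%R 'h) u.
Definition modsum (k : nzRingType) (V : lmodType k) (u : nat -> fps V) : fps V :=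
  hsum ( *:%R 'h) u.

(* The z with d z = x.  It is used only when it exists and is unique: d is then
   a nonzero central scalar of a torsion-free algebra. *)
Definition exdiv (A : pzRingType) (x d : A) : A := xget 0 [set z | d * z = x].

Definition rinv (A : pzRingType) (x : A) : A :=
  xget 0 [set y | x * y = 1 /\ y * x = 1].

(* e^x, for x divisible by h in an algebra over the rationals *)
Definition fexp (S : nzRingType) (x : fps S) : fps S :=
  ringsum (fun n => exdiv (x ^+ n) (n`!%:R)).

Definition Qeps : fieldType := {fraction {poly rat}}.
Definition eps : Qeps := @tofrac {poly rat} 'X.

Notation kh := (fps Qeps).

Definition qpow (x : Qeps) : kh := fexp (fpsC x * 'h).
Definition qden : kh := qpow 1 - qpow (- 1).
(* [x]_q *)
Definition qbr (x : Qeps) : kh := exdiv (qpow x - qpow (- x)) qden.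
Definition qfact (n : nat) : kh := \prod_(1 <= i < n.+1) qbr i%:R.

(* The topologically free algebra k<<X>>[[h]] is the h-adic completion of
   the free k[[h]]-algebra on X, and ftens X is its completed tensor square. *)
Notation freealg X := {malg Qeps[{fmonom X}]}.
Notation tfree X := (fps (freealg X)).

Section PairMonoid.
Variables M N : monomType.

Definition pair_one : M * N := (@mone M, @mone N).
Definition pair_mul (x y : M * N) : M * N := (mmul x.1 y.1, mmul x.2 y.2).

Fact pair_mulA : associative pair_mul.
Proof. by move=> [? ?] [? ?] [? ?]; rewrite /pair_mul /= !mulmA. Qed.
Fact pair_mul1m : left_id pair_one pair_mul.
Proof. by move=> [? ?]; rewrite /pair_mul /= !mul1m. Qed.
Fact pair_mulm1 : right_id pair_one pair_mul.
Proof. by move=> [? ?]; rewrite /pair_mul /= !mulm1. Qed.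
Fact pair_unitm x y : pair_mul x y = pair_one -> x = pair_one /\ y = pair_one.
Proof.
case: x y => [x1 x2] [y1 y2].
rewrite /pair_mul /pair_one /= => -[e1 e2].
by case: (unitm _ _ e1) => -> ->; case: (unitm _ _ e2) => -> ->.
Qed.

HB.instance Definition _ := Choice_isMonomialDef.Build (M * N)%type
  pair_mulA pair_mul1m pair_mulm1 pair_unitm.
End PairMonoid.

Notation ftens X := (fps {malg Qeps[({fmonom X} * {fmonom X})%type]}).

Definition gen (X : choiceType) (x : X) : tfree X := fpsC << fmu x >>.
(* x (x) 1 and 1 (x) x *)
Definition lft (X : choiceType) (x : X) : ftens X :=
  fpsC << (fmu x, @mone {fmonom X}) >>.
Definition rgt (X : choiceType) (x : X) : ftens X :=
  fpsC << (@mone {fmonom X}, fmu x) >>.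

Section Presented.
Variables (X : choiceType) (rels : seq (tfree X)).

Record closed_ideal (J : tfree X -> Prop) : Prop := ClosedIdeal {
  ci0 : J 0;
  ciB : forall s t, J s -> J t -> J (s - t);
  ciMl : forall s t, J t -> J (s * t);
  ciMr : forall s t, J t -> J (t * s);
  ci_closed : forall t,
    (forall N, exists2 s, J s & exists w, t = s + 'h ^+ N * w) -> J t
}.

Definition in_ideal (t : tfree X) : Prop :=
  forall J, closed_ideal J -> (forall r, r \in rels -> J r) -> J t.

Definition ideal_pred : {pred tfree X} := fun t => `[< in_ideal t >].

Lemma ideal_predP t : reflect (in_ideal t) (t \in ideal_pred).
Proof. exact: asboolP. Qed.

Fact ideal_zmod : zmod_closed ideal_pred.
Proof.
split=> [|s t /ideal_predP Is /ideal_predP It]; apply/ideal_predP => J cJ rJ.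
  exact: ci0.
by apply: ciB => //; [apply: Is | apply: It].
Qed.

HB.instance Definition _ := GRing.isZmodClosed.Build (tfree X) ideal_pred
  ideal_zmod.

Lemma idealMl s t : t \in ideal_pred -> s * t \in ideal_pred.
Proof.
by move=> /ideal_predP It; apply/ideal_predP => J cJ rJ; exact: ciMl (It _ cJ rJ).
Qed.

Lemma idealMr s t : t \in ideal_pred -> t * s \in ideal_pred.
Proof.
by move=> /ideal_predP It; apply/ideal_predP => J cJ rJ; exact: ciMr (It _ cJ rJ).
Qed.

(* The topological k[[h]]-algebra generated by X with relations rels *)
Definition presented : Type := Quotient.quot ideal_pred.

HB.instance Definition _ := Choice.on presented.
HB.instance Definition _ := GRing.Zmodule.on presented.
HB.instance Definition _ := EqQuotient.on presented.

Definition pres_pi (t : tfree X) : presented := \pi_presented t.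
Definition pres_one : presented := pres_pi 1.
Definition pres_mul (a b : presented) : presented :=
  pres_pi (repr a * repr b).

Lemma pres_piE s t : (pres_pi s = pres_pi t) <-> (s - t \in ideal_pred).
Proof.
rewrite /pres_pi; have := Quotient.idealrBE ideal_pred s t.
by move=> ->; split => [->|/eqP].
Qed.

Lemma pres_reprK a : pres_pi (repr a) = a.
Proof. exact: reprK. Qed.

Lemma pres_piM s t : pres_mul (pres_pi s) (pres_pi t) = pres_pi (s * t).
Proof.
apply/pres_piE; set s' := repr _; set t' := repr _.
have -> : s' * t' - s * t = (s' - s) * t' + s * (t' - t).
  by rewrite mulrBl mulrBr addrA subrK.
apply: rpredD; [apply: idealMr | apply: idealMl].
  by apply/pres_piE; rewrite pres_reprK.
by apply/pres_piE; rewrite pres_reprK.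
Qed.

Lemma pres_piD s t : pres_pi (s + t) = pres_pi s + pres_pi t.
Proof. exact: (@Quotient.pi_add _ ideal_pred). Qed.

Fact pres_mulA : associative pres_mul.
Proof.
move=> a b c; rewrite -(pres_reprK a) -(pres_reprK b) -(pres_reprK c).
by rewrite !pres_piM mulrA.
Qed.
Fact pres_mul1 : left_id pres_one pres_mul.
Proof. by move=> a; rewrite -(pres_reprK a) pres_piM mul1r. Qed.
Fact pres_mulr1 : right_id pres_one pres_mul.
Proof. by move=> a; rewrite -(pres_reprK a) pres_piM mulr1. Qed.
Fact pres_mulDl : left_distributive pres_mul +%R.
Proof.
move=> a b c; rewrite -(pres_reprK a) -(pres_reprK b) -(pres_reprK c).
by rewrite -pres_piD !pres_piM -pres_piD mulrDl.
Qed.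
Fact pres_mulDr : right_distributive pres_mul +%R.
Proof.
move=> a b c; rewrite -(pres_reprK a) -(pres_reprK b) -(pres_reprK c).
by rewrite -pres_piD !pres_piM -pres_piD mulrDr.
Qed.

HB.instance Definition _ := GRing.Zmodule_isPzRing.Build presented
  pres_mulA pres_mul1 pres_mulr1 pres_mulDl pres_mulDr.
End Presented.

(* Generic plane diagrams, read from bottom to top as a list of slices (i, p):
   p is one elementary piece, with i strands to its left.  Crossings have both
   strands upwards; in CrossP (positive) the strand going from bottom left to
   top right is over, in CrossN (negative) it is under.  MaxR is a maximum run
   from left to right, MinL a minimum run from right to left, etc. *)
Variant piece := CrossP | CrossN | MaxR | MaxL | MinR | MinL.

(* Orientations (true = up) of the strand ends of a piece *)
Definition lower (p : piece) : seq bool :=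
  match p with
  | CrossP | CrossN => [:: true; true]
  | MaxR => [:: true; false]
  | MaxL => [:: false; true]
  | MinR | MinL => [::]
  end.
Definition upper (p : piece) : seq bool :=
  match p with
  | CrossP | CrossN => [:: true; true]
  | MaxR | MaxL => [::]
  | MinR => [:: false; true]
  | MinL => [:: true; false]
  end.

Section Diagram.
Variable D : seq (nat * piece).

Definition next_level (w : seq bool) (s : nat * piece) : seq bool :=
  take s.1 w ++ upper s.2 ++ drop (s.1 + size (lower s.2)) w.

(* Orientations of the strands at heights 0, ..., size D *)
Definition levels : seq (seq bool) := [:: true] :: scanl next_level [:: true] D.
Definition level (t : nat) : seq bool := nth [::] levels t.
(* The default has no strand below it, so nothing is met above the diagram. *)
Definition slice (t : nat) : nat * piece := nth (0%N, MinL) D t.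

Definition composable : bool :=
  all (fun t => let: (i, p) := slice t in
       (i <= size (level t))%N && prefix (lower p) (drop i (level t)))
      (iota 0 (size D))
  && (level (size D) == [:: true]).

(* The edge (t, j) is the j-th strand at height t.  Following its orientation
   it enters slice t if it goes up, slice t - 1 if it goes down. *)
Definition edges : seq (nat * nat) :=
  flatten [seq [seq (t, j) | j <- iota 0 (size (level t))]
          | t <- iota 0 (size D).+1].
Definition goes_up (e : nat * nat) : bool := nth true (level e.1) e.2.
Definition target_slice (e : nat * nat) : nat :=
  if goes_up e then e.1 else e.1.-1.

(* The piece run through next and the end (left = 0, right = 1) by which it is
   entered, unless the edge just passes by *)
Definition meets (e : nat * nat) : option (piece * nat) :=
  let: (i, p) := slice (target_slice e) in
  if (i <= e.2 < i + size (if goes_up e then lower p else upper p))%N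
  then Some (p, e.2 - i)%N else None.

Definition follow (e : nat * nat) : nat * nat :=
  let: (t, j) := e in
  let: (i, p) := slice (target_slice e) in
  let t' := if goes_up e then t.+1 else t.-1 in
  let src := size (if goes_up e then lower p else upper p) in
  let dst := size (if goes_up e then upper p else lower p) in
  if (j < i)%N then (t', j)
  else if (j < i + src)%N then (if dst is 0 then t else t', i.*2.+1 - j)%N
  else (t', j + dst - src)%N.

(* The edges met by the strand starting at the bottom; there are size edges of
   them, so that the diagram has no other component if all edges are met. *)
Definition strand : seq (nat * nat) := traject follow (0%N, 0%N) (size edges).

Definition one_open_component : bool := all (mem strand) edges.

Definition is_crossing (p : piece) : bool :=
  match p with CrossP | CrossN => true | _ => false end.
Definition turns : seq piece :=
  [seq p <- [seq x.1 | x <- pmap meets strand] | ~~ is_crossing p].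
End Diagram.

(* MaxR followed by MinL is a full clockwise rotation, MaxL followed by MinR a
   full counterclockwise one. *)
Fixpoint full_rotations (s : seq piece) : bool :=
  match s with
  | [::] => true
  | MaxR :: MinL :: s' | MaxL :: MinR :: s' => full_rotations s'
  | _ => false
  end.

Record long_knot := LongKnot {
  diagram :> seq (nat * piece);
  knot_composable : composable diagram;
  knot_component : one_open_component diagram;
  knot_rotational : full_rotations (turns diagram)
}.

(* The framing is the blackboard framing, which is given by the writhe. *)
Definition framing (K : long_knot) : int :=
  \sum_(s <- diagram K)
    match s.2 with CrossP => 1 | CrossN => - 1 | _ => 0 end.

(* Bead positions: on the over- or understrand of the crossing of slice t, or
   on a full rotation (clockwise if true), which is recorded at its maximum *)
Variant bead := Over of nat | Under of nat | Rotation of bool.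

Definition bead_at (D : seq (nat * piece)) (e : nat * nat) : option bead :=
  let t := target_slice D e in
  match meets D e with
  | Some (CrossP, 0) | Some (CrossN, 1) => Some (Over t)
  | Some (CrossP, _) | Some (CrossN, _) => Some (Under t)
  | Some (MaxR, _) => Some (Rotation true)
  | Some (MaxL, _) => Some (Rotation false)
  | _ => None
  end.

(* In the order of the orientation *)
Definition beads (D : seq (nat * piece)) : seq bead :=
  pmap (bead_at D) (strand D).

Section UniversalInvariant.
Variables (X : choiceType) (rels : seq (tfree X)).
Local Notation A := (presented rels).
Local Notation pi := (@pres_pi X rels).

(* The pairs (alpha_i, beta_i) of an expansion of the class of R in the
   completed tensor square of A, truncated at h^N.  The index i = (d, (u, v))
   stands for the term c h^d u (x) v of R, where u and v are monomials in the
   generators and c is a scalar; the sum over i converges h-adically. *)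
Definition expansion (R : ftens X) (N : nat) : seq (A * A) :=
  flatten [seq
    [seq (pi (fpsC << (coef R d)@_w *g w.1 >> * 'h ^+ d), pi (fpsC << w.2 >>))
    | w <- msupp (coef R d)] | d <- iota 0 N].

Definition choices (T : Type) (cs : seq (seq T)) : seq (seq T) :=
  foldr (fun c acc => [seq x :: s | x <- c, s <- acc]) [:: [::]] cs.

Section Invariant.
Variables (R : ftens X) (kappa : A) (K : long_knot).

Definition slice_terms (N : nat) (s : nat * piece) : seq (A * A) :=
  match s.2 with
  | CrossP => expansion R N
  | CrossN => expansion (rinv R) N
  | _ => [:: (1, 1)]
  end.

Definition bead_value (c : seq (A * A)) (b : bead) : A :=
  match b with
  | Over t => (nth (1, 1) c t).1
  | Under t => (nth (1, 1) c t).2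
  | Rotation true => kappa
  | Rotation false => rinv kappa
  end.

(* Sum over all indices of the product of the beads, from right to left *)
Definition universal_invariant : A :=
  hlim ( *%R (pi 'h)) (fun N =>
    \sum_(c <- choices [seq slice_terms N s | s <- diagram K])
      \prod_(b <- rev (beads K)) bead_value c b).
End Invariant.
End UniversalInvariant.

(* The topologically free k[[h]]-module with basis m_p, p a natural number *)
Definition vmod : Type := fps {malg Qeps[nat]}.
HB.instance Definition _ := GRing.Lmodule.on vmod.

Definition mvec (p : nat) : vmod := fpsC << p >>.

(* The continuous k[[h]]-linear map with m_p |-> g p *)
Definition mlin (g : nat -> vmod) (m : vmod) : vmod :=
  modsum (fun n => 'h ^+ n *:
    \sum_(p <- msupp (coef m n)) fpsC (coef m n)@_p *: g p).

Section Action.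
Variables (X : choiceType) (op : X -> vmod -> vmod).

Definition act_word (w : {fmonom X}) (m : vmod) : vmod := foldr op m w.

Definition act_free (t : tfree X) (m : vmod) : vmod :=
  modsum (fun n => 'h ^+ n *:
    \sum_(w <- msupp (coef t n)) fpsC (coef t n)@_w *: act_word w m).

(* When the operators satisfy the relations, the value does not depend on the
   representative. *)
Definition act (rels : seq (tfree X)) (a : presented rels) (m : vmod) : vmod :=
  act_free (repr a) m.
End Action.

Definition bracket (S : nzRingType) (x y : S) : S := x * y - y * x.

(* H, E, F on the Verma module over U_h; H', E', F' on the module over D_sl2 *)
Section VermaOperators.
Variable lambda : Qeps.

Definition vH : vmod -> vmod :=
  mlin (fun p => fpsC (lambda - (p.*2)%:R) *: mvec p).
Definition vE : vmod -> vmod :=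
  mlin (fun p => if p is p'.+1 then qbr p'.+1%:R *: mvec p' else 0).
Definition vF : vmod -> vmod :=
  mlin (fun p => qbr (lambda - p%:R) *: mvec p.+1).
End VermaOperators.

Variant Ugen := UE | UF | UH.
HB.instance Definition _ := gen_eqMixin Ugen.
HB.instance Definition _ := gen_choiceMixin Ugen.

Section QuantumSl2.
Local Notation E := (gen UE).
Local Notation F := (gen UF).
Local Notation H := (gen UH).
Local Notation scal c := (c *: (1 : tfree Ugen)).

Definition U_rels : seq (tfree Ugen) :=
  [:: bracket H E - E *+ 2;
      bracket H F + F *+ 2;
      bracket E F - exdiv (fexp ('h * H) - fexp (- ('h * H))) (scal qden)].

Definition Uh := presented U_rels.

Definition U_R : ftens Ugen :=
  ringsum (fun n =>
    exdiv (qden ^+ n) (qfact n) *: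
      (fexp (fpsC 2^-1 *: ('h * (lft UH * rgt UH)))
       * (qpow ('C(n, 2)%:R) *: (lft UE ^+ n * rgt UF ^+ n)))).

Definition U_kappa : Uh := pres_pi U_rels (fexp ('h * H)).

Definition Z_U (K : long_knot) : Uh := universal_invariant U_R U_kappa K.
End QuantumSl2.

Definition verma_op (lambda : Qeps) (x : Ugen) : vmod -> vmod :=
  match x with UE => vE | UF => vF lambda | UH => vH lambda end.

Definition verma_act (lambda : Qeps) (u : Uh) : vmod -> vmod :=
  act (verma_op lambda) u.

Definition colored_jones (K : long_knot) (lambda : Qeps) : kh :=
  xget 0 [set J | J *: mvec 0 = verma_act lambda (Z_U K) (mvec 0)].

(* GHt stands for H tilde. *)
Variant Dsl2gen := GE | GF | GH | GHt.
HB.instance Definition _ := gen_eqMixin Dsl2gen.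
HB.instance Definition _ := gen_choiceMixin Dsl2gen.

Section DoubleSl2.
Local Notation E := (gen GE).
Local Notation F := (gen GF).
Local Notation H := (gen GH).
Local Notation Ht := (gen GHt).
Local Notation scal c := (c *: (1 : tfree Dsl2gen)).

Definition Dsl2_rels : seq (tfree Dsl2gen) :=
  [:: bracket H E - E *+ 2;
      bracket Ht E + E *+ 2;
      bracket H F + F *+ 2;
      bracket Ht F - F *+ 2;
      bracket E F - exdiv (fexp ('h * H) - fexp ('h * Ht)) (scal qden);
      bracket H Ht].

Definition Dsl2 := presented Dsl2_rels.
End DoubleSl2.

(* H' = H + c, F' = e^{hc} F and c = - (H + Ht) / 2 act by vH, vF and mu; hence
   H = H' - c, Ht = - H' - c and F = e^{-hc} F'. *)
Definition Dsl2_op (lambda : Qeps) (mu : kh) (x : Dsl2gen) (m : vmod) : vmod :=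
  match x with
  | GE => vE m
  | GF => fexp (- ('h * mu)) *: vF lambda m
  | GH => vH lambda m - mu *: m
  | GHt => - vH lambda m - mu *: m
  end.

Definition Dsl2_act (lambda : Qeps) (mu : kh) (u : Dsl2) : vmod -> vmod :=
  act (Dsl2_op lambda mu) u.

Variant Dgen := Gy | Gb | Ga | Gx.
HB.instance Definition _ := gen_eqMixin Dgen.
HB.instance Definition _ := gen_choiceMixin Dgen.

Section DoubleD.
Local Notation y := (gen Gy).
Local Notation b := (gen Gb).
Local Notation a := (gen Ga).
Local Notation x := (gen Gx).

Definition qeps : kh := fexp (fpsC eps * 'h).
(* {n} and {n}! *)
Definition ebr (n : nat) : kh := exdiv (1 - qeps ^+ n) (1 - qeps).
Definition efact (n : nat) : kh := \prod_(1 <= i < n.+1) ebr i.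

Definition D_A : tfree Dgen := fexp (- (fpsC eps *: ('h * a))).
Definition D_B : tfree Dgen := fexp (- ('h * b)).

Definition D_rels : seq (tfree Dgen) :=
  [:: x * y - (qeps *: (y * x) + exdiv (1 - D_A * D_B) 'h);
      bracket a x - x;
      bracket b x - fpsC eps *: x;
      bracket a y + y;
      bracket b y + fpsC eps *: y;
      bracket a b].

Definition Dalg := presented D_rels.

Definition D_R : ftens Dgen :=
  ringsum (fun m => ringsum (fun n =>
    exdiv ('h ^+ (m + n)) (efact m * n`!%:R) *:
      (lft Gy ^+ m * lft Gb ^+ n * (rgt Ga ^+ n * rgt Gx ^+ m)))).

(* (AB)^{1/2}, where a and b commute: A B = e^{-h (eps a + b)} *)
Definition D_kappa : Dalg :=
  pres_pi D_rels (fexp (- (fpsC 2^-1 *: ('h * (fpsC eps *: a + b))))).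

Definition Z_D (K : long_knot) : Dalg := universal_invariant D_R D_kappa K.
End DoubleD.

Section Phi.
Local Notation H := (gen GH).
Local Notation Ht := (gen GHt).

Definition phi_h : kh := fpsC (2 / eps) * 'h.

Definition phi_gen (g : Dgen) : tfree Dsl2gen :=
  match g with
  | Gb => - (fpsC (eps / 2) *: H)
  | Gy => gen GE
  | Ga => fpsC 2^-1 *: Ht
  | Gx => exdiv qden phi_h *: (fexp (- ('h * Ht)) * gen GF)
  end.

(* The continuous Q(eps)-algebra map with h |-> 2 h / eps and g |-> phi_gen g *)
Definition phi_free (t : tfree Dgen) : tfree Dsl2gen :=
  ringsum (fun n => phi_h ^+ n *:
    \sum_(w <- msupp (coef t n))
      fpsC (coef t n)@_w *: \prod_(g <- (w : {fmonom Dgen})) phi_gen g).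

(* phi_free lifts the isomorphism.  Since it maps the relations of Dalg into the
   ideal of those of Dsl2, the value does not depend on the representative. *)
Definition phi (u : Dalg) : Dsl2 := pres_pi Dsl2_rels (phi_free (repr u)).
End Phi.

(* Main.v *)
(* All modules embed in a module with basis (m_p), p in Z, on which generators act by
   weighted shifts.  Expanding the universal invariant into a sum over the weights of
   the beads, each crossing contributes a matrix entry of the R-matrix.  On
   M(lambda, mu), pulled back along phi, the R-matrix of D is e^{-h mu^2 / 2} T R T,
   where R is the R-matrix of U_h(sl_2) on the Verma module and T is the diagonal
   operator m_p (x) m_r |-> e^{h mu (r - p) / 2} m_p (x) m_r; the inverse R-matrices
   are related by the inverse scalar and the inverse of T, and both balancing elements
   act by q^{H'}.  The scalars multiply to e^{-h mu^2 (framing) / 2} = 1.  The factors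
   of T multiply to a power of e^{h mu / 2} whose exponent is the total variation,
   from bottom to top, of a potential on the horizontal levels of the diagram, which
   vanishes at both ends. *)
Require Import Defs.
From HB Require Import structures.
From mathcomp Require Import all_boot all_order all_algebra.
From mathcomp Require Import boolp classical_sets.
From mathcomp Require Import finmap.
From mathcomp Require Import ring zify.
From mathcomp.multinomials Require Import monalg.

Set Implicit Arguments.
Unset Strict Implicit.
Unset Printing Implicit Defensive.

Import GRing.Theory.

Local Open Scope ring_scope.

(** * Power series *)

(** The expansions of the two R-matrices do not correspond term by term: their Cartan parts are
    expanded in different generators, and the inverse R-matrices are known only as inverses. States
    can therefore be compared only after the terms of each crossing with the same pair of bead
    weights have been added up, when they form one matrix entry. Weights suffice as indices because
    every generator is a weighted shift, so the bead weights fix the vector m_p that enters each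
    bead. Indices in Z free the shifts from a boundary; the coefficient [0] = 0 of E keeps the span
    of the m_p with p >= 0 stable, and only the column of m_0 is read off in the end. The invariants
    are limits in quotients by closed ideals. They are lifted to the free algebra, where limits are
    coefficientwise, and sent to operators by maps whose h-adic continuity follows from
    semilinearity. The factors of T cancel only in states with opposite weights at every crossing;
    the other states vanish because R, and hence its inverse, preserves the total weight. *)

Section Shift.
Variable V : zmodType.
Implicit Types f g : fps V.

Lemma fcoefD f g n : coef (f + g) n = coef f n + coef g n.
Proof. by []. Qed.
Lemma fcoefN f n : coef (- f) n = - coef f n.
Proof. by []. Qed.
Lemma fcoefB f g n : coef (f - g) n = coef f n - coef g n.
Proof. by []. Qed.
Lemma fcoef0 n : coef (0 : fps V) n = 0.
Proof. by []. Qed.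
Lemma fcoef_sum (I : Type) (r : seq I) (P : pred I) (F : I -> fps V) n :
  coef (\sum_(i <- r | P i) F i) n = \sum_(i <- r | P i) coef (F i) n.
Proof. exact: (big_morph (fun f => coef f n) (fun f g => fcoefD f g n) (fcoef0 n)). Qed.
Lemma fcoefMn f m n : coef (f *+ m) n = coef f n *+ m.
Proof. by elim: m => [|m IH]; rewrite ?mulr0n // !mulrS fcoefD IH. Qed.

(* Multiplication by h, in any additive group *)
Definition hs f : fps V := FPS (fun n => if n is m.+1 then coef f m else 0).
Definition ftail f : fps V := FPS (fun n => coef f n.+1).

Lemma fps_split f : f = fpsC (coef f 0) + hs (ftail f).
Proof. by apply: fpsP => -[|n] /=; rewrite ?addr0 ?add0r. Qed.

Lemma fcoef_iter_hs N f n :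
  coef (iter N hs f) n = if (n < N)%N then 0 else coef f (n - N).
Proof. by elim: N n => [|N IH] [|n] //=; rewrite IH ltnS. Qed.

Lemma iter_hsP N f :
  (forall n, (n < N)%N -> coef f n = 0) <-> exists g, f = iter N hs g.
Proof.
split=> [f0|[g ->] n ltn]; last by rewrite fcoef_iter_hs ltn.
exists (FPS (fun n => coef f (n + N))); apply: fpsP => n.
by rewrite fcoef_iter_hs; case: ltnP => [/f0|le] //=; rewrite subnK.
Qed.

Lemma fpsCD (u v : V) : fpsC (u + v) = fpsC u + fpsC v.
Proof. by apply: fpsP => -[|n] //=; rewrite addr0. Qed.
Lemma fpsCN (u : V) : fpsC (- u) = - fpsC u.
Proof. by apply: fpsP => -[|n] //=; rewrite oppr0. Qed.
Lemma fpsC0 : fpsC (0 : V) = 0.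
Proof. by apply: fpsP => -[|n]. Qed.
End Shift.

(** Commuting with multiplication by h replaces continuity: peeling off constant terms one after the
    other determines the coefficient of h^n. *)
Lemma fps_ext (V W : zmodType) (p q : fps V -> fps W) :
  {morph p : f g / f + g} -> {morph q : f g / f + g} ->
  {morph p : f / hs f} -> {morph q : f / hs f} ->
  (forall v, p (fpsC v) = q (fpsC v)) -> p =1 q.
Proof.
move=> pD qD ph qh pq f; apply: fpsP => n.
elim: n f => [|n IH] f; rewrite [f]fps_split pD qD ph qh pq /= ?addr0 //.
by rewrite IH.
Qed.

Section FpsModule.
Variables (k : nzRingType) (V : lmodType k).
Implicit Types (c : fps k) (v : fps V).

Lemma fcoefCZ (a : k) v n : coef (fpsC a *: v) n = a *: coef v n.
Proof.
rewrite /= big_ord_recl /= subn0 big1 ?addr0 // => i _.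
by rewrite scale0r.
Qed.

Lemma fcoefZC c (v : V) n : coef (c *: fpsC v) n = coef c n *: v.
Proof.
rewrite /= big_ord_recr /= subnn big1 ?add0r // => i _.
by rewrite -(subnSK (ltn_ord i)) /= scaler0.
Qed.

Lemma hsZl c v : hs c *: v = hs (c *: v).
Proof.
apply: fpsP => -[|n] /=; first by rewrite big_ord1 scale0r.
by rewrite big_ord_recl /= scale0r add0r; apply: eq_bigr.
Qed.

Lemma hsZr c v : c *: hs v = hs (c *: v).
Proof.
apply: fpsP => -[|n] /=; first by rewrite big_ord1 /= scaler0.
rewrite big_ord_recr /= subnn /= scaler0 addr0; apply: eq_bigr => i _.
by rewrite subSn // -ltnS.
Qed.

Lemma hvar_fpsC : 'h = hs (fpsC 1) :> fps k.
Proof. by apply: fpsP => -[|[|n]]. Qed.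

Lemma hZ v : 'h *: v = hs v.
Proof. by rewrite hvar_fpsC hsZl; congr hs; apply: scale1r. Qed.
End FpsModule.

Section FpsRingTheory.
Variable S : nzRingType.
Implicit Types f g : fps S.

Lemma fcoefM f g n : coef (f * g) n = \sum_(i < n.+1) coef f i * coef g (n - i)%N.
Proof. by []. Qed.

Lemma fcoefM0 f g : coef (f * g) 0 = coef f 0 * coef g 0.
Proof. by rewrite fcoefM big_ord1. Qed.

Lemma fcoefCM (a : S) f n : coef (fpsC a * f) n = a * coef f n.
Proof.
rewrite /= big_ord_recl /= subn0 big1 ?addr0 // => i _.
by rewrite mul0r.
Qed.

Lemma fpsC1 : fpsC 1 = 1 :> fps S.
Proof. by []. Qed.

Lemma fpsCM (a b : S) : fpsC (a * b) = fpsC a * fpsC b.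
Proof. by apply: fpsP => n; rewrite fcoefCM; case: n => //= n; rewrite mulr0. Qed.

Lemma hsMl f g : hs f * g = hs (f * g).
Proof.
apply: fpsP => -[|n] /=; first by rewrite big_ord1 mul0r.
by rewrite big_ord_recl /= mul0r add0r; apply: eq_bigr.
Qed.

Lemma hsMr f g : f * hs g = hs (f * g).
Proof.
apply: fpsP => -[|n] /=; first by rewrite big_ord1 /= mulr0.
rewrite big_ord_recr /= subnn /= mulr0 addr0; apply: eq_bigr => i _.
by rewrite subSn // -ltnS.
Qed.

Lemma hM f : 'h * f = hs f.
Proof. by rewrite hvar_fpsC hsMl mul1r. Qed.
Lemma Mh f : f * 'h = hs f.
Proof. by rewrite hvar_fpsC hsMr mulr1. Qed.

Lemma hXM N f : 'h ^+ N * f = iter N (@hs S) f.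
Proof. by elim: N => [|N IH]; rewrite ?mul1r // exprS -mulrA hM IH. Qed.
End FpsRingTheory.

Section FpsAlgebra.
Variable k : comNzRingType.

Fact fps_mulC : commutative (@fps_mul k).
Proof.
move=> f g; apply: fpsP => n /=.
rewrite (reindex_inj rev_ord_inj) /=; apply: eq_bigr => -[i /=]; rewrite ltnS => lein _.
by rewrite subSS subKn // mulrC.
Qed.

HB.instance Definition _ := GRing.PzRing_hasCommutativeMul.Build (fps k) fps_mulC.

Variable S : lalgType k.

Fact fps_scalerAl (c : fps k) (x y : fps S) : c *: (x * y) = (c *: x) * y.
Proof.
apply: fpsP => n /=.
under eq_bigr do rewrite scaler_sumr.
under [RHS]eq_bigr do rewrite mulr_suml.
rewrite (sum_triangle (fun a b e => coef c a *: (coef x b * coef y e))).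
by apply: eq_bigr => i _; apply: eq_bigr => j _; rewrite scalerAl.
Qed.
HB.instance Definition _ := GRing.Lmodule_isLalgebra.Build (fps k) (fps S) fps_scalerAl.

Hypothesis scAr : forall (a : k) (x y : S), a *: (x * y) = x * (a *: y).

Lemma fps_scalerAr (c : fps k) (x y : fps S) : c *: (x * y) = x * (c *: y).
Proof.
apply: (fps_ext (p := fun c => c *: (x * y)) (q := fun c => x * (c *: y))) => //.
- by move=> d e; rewrite scalerDl.
- by move=> d e; rewrite scalerDl mulrDr.
- by move=> d; rewrite hsZl.
- by move=> d; rewrite hsZl hsMr.
move=> a /=; apply: fpsP => n; rewrite fcoefCZ fcoefM scaler_sumr; apply: eq_bigr => i _.
by rewrite fcoefCZ scAr.
Qed.
End FpsAlgebra.

Section MalgAlgebra.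
Variables (K : monomType) (R : comNzRingType).
Lemma malg_scalerAr (c : R) (x y : {malg R[K]}) : c *: (x * y) = x * (c *: y).
Proof.
apply/malgP => m; rewrite mcoeffZ mcoeffMl (mcoeffMlw m (fsubset_refl _) (msuppZ_le c y)).
rewrite mulr_sumr; apply: eq_bigr => u _; rewrite mulr_sumr; apply: eq_bigr => v _.
by rewrite mcoeffZ mulrnAr mulrCA.
Qed.
End MalgAlgebra.

(** * Congruences modulo h^N, limits and sums *)

Section Truncation.
Variable V : zmodType.
Implicit Types f g : fps V.

(* Congruence modulo h^N *)
Definition eqh N f g := forall n, (n < N)%N -> coef f n = coef g n.

Lemma eqh_sym N f g : eqh N f g -> eqh N g f.
Proof. by move=> e n lt; rewrite e. Qed.
Lemma eqh_trans N g f l : eqh N f g -> eqh N g l -> eqh N f l.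
Proof. by move=> e1 e2 n lt; rewrite e1 // e2. Qed.
Lemma eqhW M N f g : (M <= N)%N -> eqh N f g -> eqh M f g.
Proof. by move=> le e n lt; apply: e; apply: leq_trans lt le. Qed.
Lemma eqhD N f g f' g' : eqh N f f' -> eqh N g g' -> eqh N (f + g) (f' + g').
Proof. by move=> e1 e2 n lt; rewrite !fcoefD e1 // e2. Qed.
Lemma eqh_eq f g : (forall N, eqh N f g) -> f = g.
Proof. by move=> e; apply: fpsP => n; apply: (e n.+1). Qed.
Lemma eqh_sum N (I : eqType) (r : seq I) (F G : I -> fps V) :
  (forall i, i \in r -> eqh N (F i) (G i)) ->
  eqh N (\sum_(i <- r) F i) (\sum_(i <- r) G i).
Proof.
by move=> e n lt; rewrite !fcoef_sum; apply: eq_big_seq => i /e ->.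
Qed.
Lemma eqh0P N f g : eqh N f g <-> eqh N (f - g) 0.
Proof.
split=> e n lt; first by rewrite fcoefB e // subrr.
by move/eqP: (e n lt); rewrite fcoefB fcoef0 subr_eq0 => /eqP.
Qed.
Lemma eqh_iterP N f : eqh N f 0 <-> exists g, f = iter N (@hs V) g.
Proof. exact: iter_hsP. Qed.

Lemma hcvg_eqh (h : fps V -> fps V) (u : nat -> fps V) v :
  h =1 @hs V ->
  hcvg h u v <-> forall N, exists n0, forall n, (n0 <= n)%N -> eqh N (u n) v.
Proof.
move=> hE; split=> cv N; have [n0 Hn] := cv N; exists n0 => n /Hn.
  move=> [w e]; apply/eqh0P/eqh_iterP; exists w; rewrite e.
  exact: eq_iter.
move/eqh0P/eqh_iterP => [w e]; exists w; rewrite e.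
by apply: eq_iter => x; rewrite hE.
Qed.

(** [hlim] is a choice among limits, so uniqueness is part of the claim: two limits agree modulo
    every h^N. *)
Lemma hlim_fps (h : fps V -> fps V) (u : nat -> fps V) v :
  h =1 @hs V ->
  (forall N, exists n0, forall n, (n0 <= n)%N -> eqh N (u n) v) -> hlim h u = v.
Proof.
move=> hE cv; apply: xget_unique; first exact/hcvg_eqh.
move=> w /(hcvg_eqh _ _ hE) cw; apply: eqh_eq => N.
have [n0 Hn] := cv N; have [n1 Hn1] := cw N.
apply: (eqh_trans (eqh_sym (Hn1 _ (leq_maxr n0 n1)))).
exact: Hn (leq_maxl n0 n1).
Qed.

(** If [u n] is divisible by h^n, no term beyond the N-th reaches h^N, so the infinite sum has this
    finite description. *)
Definition fsum (u : nat -> fps V) : fps V :=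
  FPS (fun N => \sum_(i < N.+1) coef (u i) N).

Definition summable (u : nat -> fps V) := forall n, eqh n (u n) 0.

Lemma fsum_eqh (u : nat -> fps V) N M : summable u -> (N <= M)%N ->
  eqh N (\sum_(i < M) u i) (fsum u).
Proof.
move=> su leNM n ltn; rewrite fcoef_sum /=.
rewrite (big_ord_widen _ (fun i => coef (u i) n) (leq_trans ltn leNM)).
rewrite [RHS]big_mkcond; apply: eq_bigr => i _; case: ltnP => // lt.
by rewrite su.
Qed.

Lemma hsum_fps (h : fps V -> fps V) (u : nat -> fps V) :
  h =1 @hs V -> summable u -> hsum h u = fsum u.
Proof.
move=> hE su; apply: hlim_fps => // N; exists N => n len; exact: fsum_eqh.
Qed.
End Truncation.
Arguments eqh_trans {V N} g {f l}.

Lemma ringsumE (S : nzRingType) (u : nat -> fps S) :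
  summable u -> ringsum u = fsum u.
Proof. by move=> su; apply: hsum_fps su => f; apply: hM. Qed.

Lemma modsumE (k : nzRingType) (V : lmodType k) (u : nat -> fps V) :
  summable u -> modsum u = fsum u.
Proof. by move=> su; apply: hsum_fps su => f; apply: hZ. Qed.

Section TruncationRing.
Variable S : nzRingType.
Implicit Types x y : fps S.

Lemma eqhM N x y x' y' : eqh N x x' -> eqh N y y' -> eqh N (x * y) (x' * y').
Proof.
move=> e1 e2 n lt; rewrite !fcoefM; apply: eq_bigr => i _.
rewrite e1 ?e2 //; first by apply: leq_ltn_trans lt; apply: leq_subr.
by apply: leq_trans lt; apply: ltn_ord.
Qed.

Lemma eqh0M M N x y : eqh M x 0 -> eqh N y 0 -> eqh (M + N) (x * y) 0.
Proof.
move=> /eqh_iterP[a ->] /eqh_iterP[b ->]; apply/eqh_iterP; exists (a * b).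
elim: M => [|M IH] /=; last by rewrite hsMl IH.
by elim: N => [|N IH] //=; rewrite hsMr IH.
Qed.

Lemma eqh0X x n : coef x 0 = 0 -> eqh n (x ^+ n) 0.
Proof.
move=> x0; elim: n => [|n IH] //; rewrite exprS -add1n.
by apply: eqh0M => // -[].
Qed.

(** Geometric series in [1 - x], which is divisible by h. The inverse is two-sided even in a
    noncommutative ring, because x commutes with the partial sums. *)
Lemma geom_inv x : coef x 0 = 1 -> exists2 y, x * y = 1 & y * x = 1.
Proof.
move=> x1; set u := fun n => (1 - x) ^+ n.
have su : summable u by move=> n; apply: eqh0X; rewrite fcoefB x1 subrr.
have E N : eqh N (\sum_(i < N) u i) (fsum u) by apply: fsum_eqh.
have C N : x * (\sum_(i < N) u i) = 1 - u N.
  by rewrite -[x](subKr 1) -opprB mulNr -subrX1 opprB.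
have C' N : (\sum_(i < N) u i) * x = 1 - u N.
  rewrite -C; apply: commr_sym; apply: commr_sum => i _; apply: commrX.
  by apply: commrB => //; apply: commr1.
exists (fsum u); apply: eqh_eq => N.
  apply: (eqh_trans (x * (\sum_(i < N) u i))).
    by apply: eqhM => //; apply: eqh_sym.
  by rewrite C => n lt; rewrite fcoefB su // subr0.
apply: (eqh_trans ((\sum_(i < N) u i) * x)).
  by apply: eqhM => //; apply: eqh_sym.
by rewrite C' => n lt; rewrite fcoefB su // subr0.
Qed.
End TruncationRing.

Lemma rinvE (A : pzRingType) (x y : A) : x * y = 1 -> y * x = 1 -> rinv x = y.
Proof.
move=> xy yx; apply: xget_unique => // z [xz zx].
by rewrite -[z]mul1r -yx -mulrA xz mulr1.
Qed.

Lemma rinvP (S : nzRingType) (x : fps S) : coef x 0 = 1 ->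
  x * rinv x = 1 /\ rinv x * x = 1.
Proof. by move=> /geom_inv[y xy yx]; rewrite (rinvE xy yx). Qed.

Lemma exdivE (A : pzRingType) (x d z : A) : GRing.lreg d -> d * z = x -> exdiv x d = z.
Proof.
by move=> reg dz; apply: xget_unique => // w dw; apply: reg; rewrite dz.
Qed.

Section FpsField.
Variable k : fieldType.
Implicit Types c d : fps k.

Definition finvertible c := exists d, c * d = 1.

Lemma finvertibleP c : coef c 0 != 0 -> finvertible c.
Proof.
move=> c0; have : coef (fpsC (coef c 0)^-1 * c) 0 = 1 by rewrite fcoefCM mulVf.
case/geom_inv => y e _; exists (fpsC (coef c 0)^-1 * y).
by rewrite mulrCA mulrA.
Qed.

Lemma finvertibleM c d : finvertible c -> finvertible d -> finvertible (c * d).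
Proof.
by move=> [c' ec] [d' ed]; exists (c' * d'); rewrite mulrACA ec ed mulr1.
Qed.

Lemma lreg_unit c : finvertible c -> GRing.lreg c.
Proof.
by move=> [d e] x y /(congr1 ( *%R d)); rewrite !mulrA [d * c]mulrC e !mul1r.
Qed.

Lemma lreg_hs (S : nzRingType) (x : fps S) : GRing.lreg x -> GRing.lreg (hs x).
Proof.
move=> reg y z; rewrite !hsMl => e; apply: reg; apply: fpsP => n.
by move: (congr1 (fun f => coef f n.+1) e).
Qed.

Lemma lreg_scal (S : lalgType k) c : finvertible c -> GRing.lreg (c *: (1 : fps S)).
Proof.
move=> [d e] x y; rewrite -!scalerAl !mul1r => /(congr1 ( *:%R d)).
by rewrite !scalerA [d * c]mulrC e !scale1r.
Qed.
End FpsField.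

(** * The exponential of a series without constant term *)

Section Exponential.
Variables (k : fieldType) (S : lalgType k).
Hypothesis k0 : forall n, (n.+1)%:R != 0 :> k.
Implicit Types x y : fps S.

Let fact_neq0 n : (n`!)%:R != 0 :> k.
Proof. by case: n`! (fact_gt0 n). Qed.

Lemma lreg_natr n : (n.+1)%:R != 0 :> k -> GRing.lreg (n.+1%:R : fps S).
Proof.
move=> n0 x y; rewrite !mulr_natl => e; apply: fpsP => m.
have := congr1 (fun f => coef f m) e; rewrite !fcoefMn -!scaler_nat => {}e.
by rewrite -[LHS]scale1r -(mulVf n0) -scalerA e scalerA mulVf // scale1r.
Qed.

Definition expterm x n : fps S := fpsC (n`!%:R^-1) *: x ^+ n.

Lemma exdiv_fact x n : exdiv x (n`!%:R) = fpsC (n`!%:R^-1) *: x.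
Proof.
apply: exdivE; first by case: n`! (fact_gt0 n) => // m _; apply: lreg_natr.
apply: fpsP => m; rewrite mulr_natl fcoefMn fcoefCZ -scaler_nat scalerA.
by rewrite mulfV // scale1r.
Qed.

Lemma expterm_summable x : coef x 0 = 0 -> summable (expterm x).
Proof.
by move=> x0 n m lt; rewrite /expterm fcoefCZ (eqh0X (n:=n) x0 lt) fcoef0 scaler0.
Qed.

Lemma fexpE x : coef x 0 = 0 -> fexp x = fsum (expterm x).
Proof.
move=> x0; have -> : fexp x = ringsum (expterm x).
  by congr ringsum; apply/funext => n; rewrite exdiv_fact.
by rewrite ringsumE //; apply: expterm_summable.
Qed.

Lemma coef_fexp x n : coef x 0 = 0 ->
  coef (fexp x) n = \sum_(i < n.+1) i`!%:R^-1 *: coef (x ^+ i) n.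
Proof.
move=> x0; rewrite fexpE //.
transitivity (\sum_(i < n.+1) coef (expterm x i) n) => //.
by apply: eq_bigr => i _; rewrite /expterm fcoefCZ.
Qed.

Lemma coef_fexp0 x : coef x 0 = 0 -> coef (fexp x) 0 = 1.
Proof.
by move=> x0; rewrite coef_fexp // big_ord1 expr0 fact0 invr1 scale1r.
Qed.

Hypothesis scAr : forall (a : k) (x y : S), a *: (x * y) = x * (a *: y).

Lemma fexpD x y : GRing.comm x y -> coef x 0 = 0 -> coef y 0 = 0 ->
  fexp (x + y) = fexp x * fexp y.
Proof.
move=> cxy x0 y0; have xy0 : coef (x + y) 0 = 0 by rewrite fcoefD x0 y0 addr0.
apply: fpsP => N; rewrite coef_fexp //.
pose t i j := (i`!%:R^-1 * j`!%:R^-1) *: coef (x ^+ i * y ^+ j) N.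
transitivity (\sum_(n < N.+1) \sum_(i < n.+1) t i (n - i)%N).
  apply: eq_bigr => -[n /= _] _; rewrite addrC exprDn_comm; last exact: commr_sym.
  rewrite fcoef_sum scaler_sumr; apply: eq_bigr => -[i /=]; rewrite ltnS => le _.
  rewrite /t fcoefMn -scaler_nat scalerA.
  rewrite (commrX i (commr_sym (commrX (n - i) cxy))).
  congr (_ *: _); rewrite -(bin_fact le) !natrM.
  rewrite !invfM mulrAC mulVf ?mul1r //.
  apply/eqP => e; have := fact_neq0 n; rewrite -(bin_fact le) natrM e mul0r eqxx //.
pose ex z := \sum_(i < N.+1) expterm z i.
have E z : coef z 0 = 0 -> eqh N.+1 (fexp z) (ex z).
  by move=> z0; rewrite fexpE //; apply/eqh_sym/fsum_eqh => //; apply: expterm_summable.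
rewrite (eqhM (E x x0) (E y y0)) // mulr_suml fcoef_sum.
have tE i j : coef (expterm x i * expterm y j) N = t i j.
  rewrite /expterm -scalerAl -fps_scalerAr // scalerA -fpsCM fcoefCZ.
  by [].
rewrite -(sum_triangle (fun i j _ => t i j)); apply: eq_bigr => i _.
rewrite mulr_sumr fcoef_sum.
(* The triangle i + j <= N is enlarged to a square; each added term contains x^i y^j with i + j > N
   and so has no coefficient at h^N. *)
rewrite (big_ord_widen _ (fun j => t i j) (_ : (N - i).+1 <= N.+1)%N); last first.
  by rewrite ltnS leq_subr.
rewrite big_mkcond; apply: eq_bigr => j _; rewrite tE ltnS; case: leqP => // lt.
rewrite /t (eqh0M (eqh0X (n := i) x0) (eqh0X (n := j) y0)) ?scaler0 //.
by rewrite ltn_subLR // -ltnS in lt.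
Qed.
End Exponential.

Lemma Qeps_natr_neq0 n : (n.+1)%:R != 0 :> Qeps.
Proof.
rewrite -(rmorph_nat (@tofrac {poly rat})) tofrac_eq0 -polyC_natr polyC_eq0.
by rewrite Num.Theory.pnatr_eq0.
Qed.

Lemma eps_neq0 : eps != 0.
Proof. by rewrite tofrac_eq0 polyX_eq0. Qed.

Lemma hXZ (V : lmodType Qeps) n (v : fps V) : 'h ^+ n *: v = iter n (@hs V) v.
Proof. by elim: n => [|n IH]; rewrite ?scale1r // exprS -scalerA IH hZ. Qed.

(** * Semilinear morphisms of algebras of power series *)

Section Rescale.
Variables (V : lmodType Qeps).

(* The substitution h |-> a h *)
Definition resc (a : Qeps) (f : fps V) : fps V := FPS (fun n => a ^+ n *: coef f n).

Lemma rescD a : {morph resc a : f g / f + g}.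
Proof. by move=> f g; apply: fpsP => n /=; rewrite scalerDr. Qed.
Lemma resc_fpsC a v : resc a (fpsC v) = fpsC v.
Proof. by apply: fpsP => -[|n] /=; rewrite ?expr0 ?scale1r ?scaler0. Qed.
Lemma resc_resc a b f : resc a (resc b f) = resc (a * b) f.
Proof. by apply: fpsP => n /=; rewrite scalerA exprMn. Qed.
Lemma resc1 f : resc 1 f = f.
Proof. by apply: fpsP => n /=; rewrite expr1n scale1r. Qed.
Lemma resc_hs a f : resc a (hs f) = fpsC a *: hs (resc a f).
Proof.
apply: fpsP => n; rewrite fcoefCZ; case: n => [|n] /=; first by rewrite !scaler0.
by rewrite scalerA exprS.
Qed.
End Rescale.

Definition krescale (a : Qeps) (c : kh) : kh := @resc Qeps^o a c.

Lemma resc_scale (V : lmodType Qeps) a c (v : fps V) :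
  resc a (c *: v) = krescale a c *: resc a v.
Proof.
apply: fpsP => n /=; rewrite scaler_sumr; apply: eq_bigr => -[i /= lei] _.
by rewrite !scalerA mulrAC -exprD subnKC // -ltnS.
Qed.

Lemma resc_mul (S : lalgType Qeps) a (x y : fps S) :
  (forall (b : Qeps) (x y : S), b *: (x * y) = x * (b *: y)) ->
  resc a (x * y) = resc a x * resc a y.
Proof.
move=> scAr; apply: fpsP => n /=; rewrite scaler_sumr; apply: eq_bigr => -[i /= lei] _.
by rewrite -scalerAl -scAr !scalerA -exprD subnKC // -ltnS.
Qed.

(* Algebra morphisms that are semilinear for h |-> a h *)
Record cmorph (S S' : lalgType Qeps) (a : Qeps) (p : fps S -> fps S') : Prop := CMorph {
  cmD : {morph p : x y / x + y};
  cmZ : forall c x, p (c *: x) = krescale a c *: p x;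
  cmM : {morph p : x y / x * y};
  cm1 : p 1 = 1
}.

Section CMorphTheory.
Variables (S S' : lalgType Qeps) (a : Qeps) (p : fps S -> fps S').
Hypothesis cp : cmorph a p.

Lemma cm0 : p 0 = 0.
Proof. by apply: (addrI (p 0)); rewrite -(cmD cp) !addr0. Qed.
Lemma cmN x : p (- x) = - p x.
Proof. by apply: (addrI (p x)); rewrite -(cmD cp) !subrr cm0. Qed.
Lemma cmB x y : p (x - y) = p x - p y.
Proof. by rewrite (cmD cp) cmN. Qed.
Lemma cmMn x n : p (x *+ n) = p x *+ n.
Proof. by elim: n => [|n IH]; rewrite ?cm0 // !mulrS (cmD cp) IH. Qed.
Lemma cmX x n : p (x ^+ n) = p x ^+ n.
Proof. by elim: n => [|n IH]; rewrite ?(cm1 cp) // !exprS (cmM cp) IH. Qed.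
Lemma cm_sum (I : Type) (r : seq I) (P : pred I) (F : I -> fps S) :
  p (\sum_(i <- r | P i) F i) = \sum_(i <- r | P i) p (F i).
Proof. exact: (big_morph p (cmD cp) cm0). Qed.
Lemma cm_prod (I : Type) (r : seq I) (P : pred I) (F : I -> fps S) :
  p (\prod_(i <- r | P i) F i) = \prod_(i <- r | P i) p (F i).
Proof. exact: (big_morph p (cmM cp) (cm1 cp)). Qed.
Lemma cmZC b x : p (fpsC b *: x) = fpsC b *: p x.
Proof. by rewrite (cmZ cp) /krescale resc_fpsC. Qed.
Lemma krescale_h : krescale a 'h = fpsC a * 'h.
Proof. by rewrite /krescale hvar_fpsC resc_hs resc_fpsC. Qed.

Lemma cm_hs x : p (hs x) = fpsC a *: hs (p x).
Proof. by rewrite -hZ (cmZ cp) krescale_h -scalerA hZ. Qed.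

(** Continuity is automatic: semilinearity gives p(h x) = a h p(x), so multiples of h^N go to
    multiples of h^N. *)
Lemma cm_eqh0 N x : eqh N x 0 -> eqh N (p x) 0.
Proof.
move=> /eqh_iterP[y ->]; elim: N => [|N IH] //=.
rewrite cm_hs => n lt; rewrite fcoefCZ.
by case: n lt => [|n] lt /=; rewrite ?IH ?scaler0.
Qed.

Lemma cm_eqh N x y : eqh N x y -> eqh N (p x) (p y).
Proof.
by move=> /(eqh0P _ _ _).1 e; apply/(eqh0P _ _ _).2; rewrite -cmB; apply: cm_eqh0.
Qed.

Lemma cm_summable u : summable u -> summable (p \o u).
Proof. by move=> su n; apply: cm_eqh0. Qed.

Lemma cm_fsum u : summable u -> p (fsum u) = fsum (p \o u).
Proof.
move=> su; apply: eqh_eq => N.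
apply: (eqh_trans (p (\sum_(i < N) u i))); first by apply/cm_eqh/eqh_sym/fsum_eqh.
by rewrite cm_sum; apply: (fsum_eqh (cm_summable su)).
Qed.

Lemma cm_coef0 x : coef x 0 = 0 -> coef (p x) 0 = 0.
Proof. by move=> x0; apply: (@cm_eqh0 1) => // -[]. Qed.

Lemma cm_fexp x : coef x 0 = 0 -> p (fexp x) = fexp (p x).
Proof.
move=> x0; rewrite !fexpE ?cm_coef0 //; try exact: Qeps_natr_neq0.
rewrite cm_fsum; last by apply: expterm_summable => //; apply: Qeps_natr_neq0.
by congr fsum; apply/funext => n /=; rewrite /expterm cmZC cmX.
Qed.

Lemma cm_inv x y : x * y = 1 -> p x * p y = 1.
Proof. by rewrite -(cmM cp) => ->; apply: (cm1 cp). Qed.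
End CMorphTheory.

Lemma cm_comp (S S' S'' : lalgType Qeps) a b (p : fps S -> fps S') (q : fps S' -> fps S'') :
  cmorph a p -> cmorph b q -> cmorph (b * a) (q \o p).
Proof.
move=> cp cq; split=> [x y|c x|x y|] /=.
- by rewrite (cmD cp) (cmD cq).
- by rewrite (cmZ cp) (cmZ cq) /krescale resc_resc.
- by rewrite (cmM cp) (cmM cq).
- by rewrite (cm1 cp) (cm1 cq).
Qed.

Lemma cm_resc (S : lalgType Qeps) a :
  (forall (b : Qeps) (x y : S), b *: (x * y) = x * (b *: y)) ->
  cmorph a (@resc S a).
Proof.
move=> scAr; split.
- exact: rescD.
- exact: resc_scale.
- by move=> x y; apply: resc_mul.
- exact: resc_fpsC.
Qed.

(** * Continuous linear extension from a basis, and from words to algebra morphisms *)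

Section LinearExtension.
Variables (K : choiceType) (W : lmodType Qeps) (G : K -> fps W).

Definition linext (v : {malg Qeps[K]}) : fps W :=
  \sum_(m <- msupp v) fpsC v@_m *: G m.

Lemma linextEw (d : {fset K}) v : (msupp v `<=` d)%fset ->
  linext v = \sum_(m <- d) fpsC v@_m *: G m.
Proof.
move=> le; rewrite /linext (big_fset_incl _ le) //= => x _ /mcoeff_outdom ->.
by rewrite fpsC0 scale0r.
Qed.

Lemma linextD : {morph linext : v w / v + w}.
Proof.
move=> v w; pose d := (msupp v `|` msupp w)%fset.
rewrite (linextEw (d := d) (msuppD_le _ _)) (linextEw (d := d) (fsubsetUl _ _)).
rewrite (linextEw (d := d) (fsubsetUr _ _)) -big_split /=.
by apply: eq_bigr => m _; rewrite mcoeffD fpsCD scalerDl.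
Qed.

Lemma linextZ a v : linext (a *: v) = fpsC a *: linext v.
Proof.
rewrite (linextEw (msuppZ_le _ _)) /linext scaler_sumr; apply: eq_bigr => m _.
by rewrite mcoeffZ fpsCM scalerA.
Qed.

Lemma linextU m : linext << m >> = G m.
Proof. by rewrite (linextEw msuppU_le) big_seq_fset1 mcoeffUU fpsC1 scale1r. Qed.

(** The sum over n of h^n [linext (coef t n)], read off degree by degree; [ext_fsum] identifies the
    two. *)
Definition ext (t : fps {malg Qeps[K]}) : fps W :=
  FPS (fun N => \sum_(n < N.+1) coef (linext (coef t n)) (N - n)).

Lemma extD : {morph ext : t s / t + s}.
Proof.
move=> t s; apply: fpsP => N /=; rewrite -big_split /=; apply: eq_bigr => n _.
by rewrite linextD.
Qed.

Lemma linext0 : linext 0 = 0.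
Proof. by rewrite /linext msupp0 big_seq_fset0. Qed.

Lemma ext_hs : {morph ext : t / hs t}.
Proof.
move=> t; apply: fpsP => -[|N] /=; first by rewrite big_ord1 linext0.
by rewrite big_ord_recl /= linext0 add0r; apply: eq_bigr.
Qed.

Lemma extC v : ext (fpsC v) = linext v.
Proof.
apply: fpsP => N /=; rewrite big_ord_recl /= subn0 big1 ?addr0 // => i _.
by rewrite linext0.
Qed.

Lemma extU m : ext (fpsC << m >>) = G m.
Proof. by rewrite extC linextU. Qed.

Lemma extZ c t : ext (c *: t) = c *: ext t.
Proof.
apply: (fps_ext (p := fun c => ext (c *: t)) (q := fun c => c *: ext t)) => /=.
- by move=> d e; rewrite scalerDl extD.
- by move=> d e; rewrite scalerDl.
- by move=> d; rewrite hsZl ext_hs.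
- by move=> d; rewrite hsZl.
move=> a; apply: (fps_ext (p := fun t => ext (fpsC a *: t)) (q := fun t => fpsC a *: ext t)) => /=.
- by move=> d e; rewrite scalerDr extD.
- by move=> d e; rewrite extD scalerDr.
- by move=> d; rewrite hsZr ext_hs.
- by move=> d; rewrite ext_hs hsZr.
move=> v; rewrite extC -linextZ -extC; congr ext.
by apply: fpsP => n; rewrite fcoefZC; case: n => [|n] //=; rewrite scale0r.
Qed.

Lemma ext_fsum t :
  ext t = fsum (fun n => 'h ^+ n *: linext (coef t n)).
Proof.
apply: fpsP => N; apply: eq_bigr => -[n lt] _; have le : (n <= N)%N by [].
by rewrite hXZ fcoef_iter_hs /= ltnNge le.
Qed.
End LinearExtension.

Section ExtMorphism.
Variables (M : monomType) (S : lalgType Qeps) (G : M -> fps S).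
Hypothesis scAr : forall (a : Qeps) (x y : S), a *: (x * y) = x * (a *: y).
Hypothesis G1 : G (@mone M) = 1.
Hypothesis GM : forall u v, G (mmul u v) = G u * G v.

Lemma linextM : {morph linext G : v w / v * w}.
Proof.
have E c m : linext G << c *g m >> = fpsC c *: G m.
  rewrite -[c in LHS]mulr1 -(linextU G m) -linextZ; congr linext.
  by apply/malgP => l; rewrite mcoeffZ !mcoeffU mulrnAr.
have sumE (r : seq M) F : linext G (\sum_(m <- r) F m) = \sum_(m <- r) linext G (F m).
  exact: (big_morph _ (linextD G) (linext0 G)).
move=> v w; rewrite malgME sumE mulr_suml; apply: eq_bigr => u _.
rewrite sumE mulr_sumr; apply: eq_bigr => m _.
by rewrite E fpsCM GM -scalerAl -fps_scalerAr // scalerA.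
Qed.

Lemma ext_cmorph : cmorph 1 (ext G).
Proof.
split.
- exact: extD.
- by move=> c t; rewrite /krescale resc1 extZ.
- move=> s t.
  apply: (fps_ext (p := fun s => ext G (s * t)) (q := fun s => ext G s * ext G t)) => /=.
  + by move=> x y; rewrite mulrDl extD.
  + by move=> x y; rewrite extD mulrDl.
  + by move=> x; rewrite hsMl ext_hs.
  + by move=> x; rewrite ext_hs hsMl.
  move=> v; apply: (fps_ext (p := fun t => ext G (fpsC v * t))
                            (q := fun t => ext G (fpsC v) * ext G t)) => /=.
  + by move=> x y; rewrite mulrDr extD.
  + by move=> x y; rewrite extD mulrDr.
  + by move=> x; rewrite hsMr ext_hs.
  + by move=> x; rewrite ext_hs hsMr.
  by move=> w; rewrite -fpsCM !extC linextM.
- by rewrite -[RHS]G1 -(extU G).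
Qed.
End ExtMorphism.

Lemma Qeps_scalar_comm (b : Qeps) (x y : Qeps^o) : b *: (x * y) = x * (b *: y).
Proof. by rewrite scalerAr. Qed.

(** * Scalars *)

(* e^{hc} *)
HB.lock Definition Ex (c : kh) : kh := fexp ('h * c).

Lemma coef0_h (S : nzRingType) (x : fps S) : coef ('h * x) 0 = 0.
Proof. by rewrite hM. Qed.

Lemma ExD c d : Ex (c + d) = Ex c * Ex d.
Proof.
rewrite Ex.unlock mulrDr; apply: (@fexpD Qeps Qeps^o) => //; try exact: coef0_h.
- exact: Qeps_natr_neq0.
- exact: Qeps_scalar_comm.
- exact: mulrC.
Qed.

Lemma coef_Ex0 c : coef (Ex c) 0 = 1.
Proof. by rewrite Ex.unlock; exact: (@coef_fexp0 Qeps Qeps^o Qeps_natr_neq0 _ (coef0_h c)). Qed.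

Lemma coef_Ex1 c : coef (Ex c) 1 = coef c 0.
Proof.
rewrite Ex.unlock (@coef_fexp Qeps Qeps^o Qeps_natr_neq0 _ _ (coef0_h c)).
transitivity (1^-1 * coef (1 : kh) 1 + 1^-1 * coef ('h * c) 1).
  by rewrite big_ord_recr big_ord1.
by rewrite invr1 !mul1r hM add0r.
Qed.

(** [Ex 0] is idempotent by [ExD] and invertible by its constant term, hence equal to 1. *)
Lemma Ex0 : Ex 0 = 1.
Proof.
have e : Ex 0 * Ex 0 = Ex 0 by rewrite -ExD addr0.
have [d de] : finvertible (Ex 0) by apply: finvertibleP; rewrite coef_Ex0 oner_neq0.
by rewrite -[LHS]mulr1 -de mulrA e.
Qed.

Lemma ExN c : Ex c * Ex (- c) = 1.
Proof. by rewrite -ExD subrr Ex0. Qed.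

Lemma ExMn c n : Ex (c *+ n) = Ex c ^+ n.
Proof. by elim: n => [|n IH]; rewrite ?Ex0 // mulrS ExD IH exprS. Qed.

Lemma Ex_prod (I : Type) (r : seq I) (P : pred I) (F : I -> kh) :
  \prod_(i <- r | P i) Ex (F i) = Ex (\sum_(i <- r | P i) F i).
Proof. by rewrite (big_morph Ex ExD Ex0). Qed.

Lemma qpowE x : qpow x = Ex (fpsC x).
Proof. by rewrite /qpow Ex.unlock mulrC. Qed.

Lemma qepsE : qeps = Ex (fpsC eps).
Proof. by rewrite /qeps Ex.unlock mulrC. Qed.

Lemma krescale_cmorph a : @cmorph Qeps^o Qeps^o a (krescale a).
Proof. exact: (cm_resc a Qeps_scalar_comm). Qed.

Lemma krescale_Ex a c : krescale a (Ex c) = Ex (fpsC a * krescale a c).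
Proof.
rewrite Ex.unlock (cm_fexp (krescale_cmorph a)); last exact: coef0_h.
by rewrite (cmM (krescale_cmorph a)) krescale_h mulrCA mulrA.
Qed.

Lemma hs_ftail (V : zmodType) (f : fps V) : coef f 0 = 0 -> hs (ftail f) = f.
Proof. by move=> f0; rewrite [RHS]fps_split f0 fpsC0 add0r. Qed.

(** Order exactly one in h, that is, h times a unit. The denominators q - q^-1, 2h/eps and 1 - q_eps
    are of this kind, so that [exdiv] by them succeeds as soon as the numerator has no constant
    term. *)
Definition hunit (c : kh) := coef c 0 = 0 /\ coef c 1 != 0.

Lemma hunitP c : hunit c -> exists2 u, c = hs u & finvertible u.
Proof.
by move=> [c0 c1]; exists (ftail c); [rewrite hs_ftail | apply: finvertibleP].
Qed.

Lemma hunit_reg c : hunit c -> GRing.lreg c.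
Proof. by move=> /hunitP[u -> iu]; apply: lreg_hs; apply: lreg_unit. Qed.

Lemma hunit_scal_reg (S : lalgType Qeps) c : hunit c -> GRing.lreg (c *: (1 : fps S)).
Proof.
by move=> /hunitP[u -> iu]; rewrite hsZl; apply: lreg_hs; apply: lreg_scal.
Qed.

Lemma exdiv_hunit c x : hunit c -> coef x 0 = 0 -> c * exdiv x c = x.
Proof.
move=> hc x0; have reg := hunit_reg hc; case/hunitP: hc reg => u -> [d ud] reg.
suff -> : exdiv x (hs u) = d * ftail x by rewrite hsMl mulrA ud mul1r hs_ftail.
by apply: exdivE => //; rewrite hsMl mulrA ud mul1r hs_ftail.
Qed.

Lemma exdiv_hunit_scal (S : lalgType Qeps) c (x : fps S) : hunit c -> coef x 0 = 0 ->
  c *: exdiv x (c *: 1) = x.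
Proof.
move=> hc x0; have reg := @hunit_scal_reg S c hc; case/hunitP: hc reg => u -> [d ud] reg.
have e : hs u *: (d *: ftail x) = x by rewrite hsZl scalerA ud scale1r hs_ftail.
suff -> : exdiv x (hs u *: 1) = d *: ftail x by [].
by apply: exdivE => //; rewrite -scalerAl mul1r.
Qed.

Lemma qdenE : qden = Ex 1 - Ex (- 1).
Proof. by rewrite /qden (qpowE 1) (qpowE (- 1)) fpsCN. Qed.

Lemma two_neq0 : (2 : Qeps) != 0.
Proof. exact: (Qeps_natr_neq0 1). Qed.

Lemma qden_hunit : hunit qden.
Proof.
rewrite qdenE; split; first by rewrite fcoefB !coef_Ex0 subrr.
by rewrite fcoefB !coef_Ex1 fcoefN opprK -mulr2n two_neq0.
Qed.

Lemma phi_h_hunit : hunit phi_h.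
Proof.
rewrite /phi_h Mh; split; first by [].
apply: mulf_neq0; first exact: two_neq0.
by rewrite invr_eq0; exact: eps_neq0.
Qed.

Lemma fpsC_nat (S : nzRingType) n : fpsC n%:R = n%:R :> fps S.
Proof. by elim: n => [|n IH]; rewrite ?fpsC0 // !mulrS fpsCD IH. Qed.

(* Sealed, like [Ex]: unification would unfold the exponentials. *)
HB.lock Definition br (x : Qeps) : kh := qbr x.

Lemma qbr_br x : qbr x = br x.
Proof. by rewrite br.unlock. Qed.

Lemma qfactE n : qfact n = \prod_(1 <= i < n.+1) br i%:R.
Proof. by rewrite br.unlock. Qed.

Lemma brE x : qden * br x = Ex (fpsC x) - Ex (- fpsC x).
Proof.
rewrite br.unlock -fpsCN -!qpowE; apply: exdiv_hunit; first exact: qden_hunit.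
by rewrite fcoefB !qpowE !coef_Ex0 subrr.
Qed.

Lemma br0 : br 0 = 0.
Proof.
by apply: (hunit_reg qden_hunit); rewrite brE fpsC0 oppr0 subrr mulr0.
Qed.

(** This is [E, F] = [H] in disguise: take x = p and y = lambda - p. After clearing both
    denominators it is a polynomial identity between exponentials. *)
Lemma qbr_identity x y : br (x + 1) * br y - br x * br (y + 1) = br (y - x).
Proof.
apply: (hunit_reg qden_hunit); apply: (hunit_reg qden_hunit).
have L (d a b c e : kh) : d * (d * (a * b - c * e)) = (d * a) * (d * b) - (d * c) * (d * e).
  by ring.
rewrite L !brE qdenE (fpsCD x) (fpsCD y 1) (fpsCD y (- x)) fpsCN fpsC1.
rewrite (opprB (fpsC y)) (opprD (fpsC x)) (opprD (fpsC y) 1) (ExD (fpsC x) 1) (ExD (fpsC y) 1).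
rewrite (ExD (- _) (- _)) (ExD (- _) (- _)) (ExD (fpsC x)) (ExD (fpsC y)).
move: (Ex (fpsC x)) (Ex (fpsC y)) (Ex (- fpsC x)) (Ex (- fpsC y)) (Ex 1) (Ex (- 1)).
by move=> a b c d e f; ring.
Qed.

(** Classical limit of [x]_q: since q - q^-1 = 2h + ..., the value is read off the coefficient of h
    in [brE]. It makes the quantum factorials invertible. *)
Lemma coef_qbr0 x : coef (br x) 0 = x.
Proof.
have := congr1 (fun f => coef f 1) (brE x).
case: qden_hunit => d0 _; have d1 : coef qden 1 = 2.
  by rewrite qdenE fcoefB !coef_Ex1 fcoefN opprK -mulr2n.
rewrite fcoefB !coef_Ex1 fcoefN opprK -[coef (fpsC x) 0]/x.
rewrite fcoefM big_ord_recl big_ord1 d0 mul0r add0r d1 mulr_natl mulr2n => e.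
by apply: (mulfI two_neq0); rewrite !mulr_natl !mulr2n.
Qed.

Lemma qfact_unit n : finvertible (qfact n).
Proof.
rewrite qfactE; elim: n => [|n IH].
  by rewrite big_nil; exists 1; rewrite mulr1.
rewrite big_nat_recr //=; apply: finvertibleM => //.
by apply: finvertibleP; rewrite coef_qbr0 Qeps_natr_neq0.
Qed.

Lemma qeps1_hunit : hunit (1 - qeps).
Proof.
rewrite qepsE; split; first by rewrite fcoefB coef_Ex0 subrr.
by rewrite fcoefB coef_Ex1 /= sub0r oppr_eq0 eps_neq0.
Qed.

Lemma ebrE n : (1 - qeps) * ebr n = 1 - qeps ^+ n.
Proof.
apply: exdiv_hunit; first exact: qeps1_hunit.
by rewrite qepsE -ExMn fcoefB coef_Ex0 subrr.
Qed.

Lemma krescale_qeps : krescale (2 / eps) qeps = Ex 2.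
Proof.
rewrite qepsE krescale_Ex /krescale resc_fpsC -fpsCM (divfK eps_neq0).
by congr Ex; apply: fpsP => -[|n] /=; rewrite ?addr0.
Qed.

(** The substitution turns q_eps into q^2, and (1 - q^(2n+2)) / (1 - q^2) = q^n [n+1]_q; the
    equality is checked after multiplication by 1 - q^2. *)
Lemma krescale_ebr n : krescale (2 / eps) (ebr n.+1) = Ex n%:R * br n.+1%:R.
Proof.
have cr := krescale_cmorph (2 / eps).
have h2 : hunit (1 - Ex 2).
  split; first by rewrite fcoefB coef_Ex0 subrr.
  by rewrite fcoefB coef_Ex1 /= sub0r oppr_eq0; exact: two_neq0.
apply: (hunit_reg h2).
have := congr1 (krescale (2 / eps)) (ebrE n.+1).
rewrite (cmM cr) !(cmB cr) (cmX cr) (cm1 cr) krescale_qeps => ->.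
have -> : 1 - Ex 2 = - Ex 1 * qden.
  by rewrite qdenE mulNr mulrBr ExN opprB -ExD.
transitivity (- (Ex 1 * Ex n%:R) * (qden * br n.+1%:R)); last first.
  by move: (Ex 1) (Ex _) qden (br _) => x y z t; ring.
rewrite brE fpsC_nat -ExD -ExMn mulNr mulrBr -!ExD opprB.
rewrite -(natrD _ 1 n) add1n subrr Ex0; congr (_ - Ex _).
by rewrite -mulrnA -natrD mul2n -addnn.
Qed.

(** The powers q^0, ..., q^(n-1) of [krescale_ebr] accumulate to the exponent n(n-1)/2. *)
Lemma krescale_efact n : krescale (2 / eps) (efact n) = Ex 'C(n, 2)%:R * qfact n.
Proof.
have cr := krescale_cmorph (2 / eps).
elim: n => [|n IH]; rewrite /efact qfactE.
  by rewrite !big_nil (cm1 cr) Ex0 mulr1.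
rewrite big_nat_recr //= (cmM cr) -/(efact n) IH krescale_ebr.
rewrite [in RHS]big_nat_recr //= -qfactE binS bin1 natrD ExD.
by rewrite mulrACA.
Qed.

(** * Operators on the universal weight module *)

(* Linear operators on the functions on Z x Z: two commuting copies of the
   module with basis (m_p), p in Z, in which all the modules embed. *)
Local Notation J := (int * int)%type.

Record lop := LOp {
  lfun :> (J -> Qeps) -> J -> Qeps;
  lopP : forall (a : Qeps) f g,
    lfun (fun i => a * f i + g i) = fun i => a * lfun f i + lfun g i
}.

HB.instance Definition _ := gen_eqMixin lop.
HB.instance Definition _ := gen_choiceMixin lop.

Lemma lop_eq (F G : lop) : (forall f i, F f i = G f i) -> F = G.
Proof.
case: F G => [F FP] [G GP] /= e; have {}e : F = G.
  by apply/funext => f; apply/funext.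
by case: G / e GP => GP; congr LOp; apply: Prop_irrelevance.
Qed.

Program Definition lop_zero : lop := @LOp (fun _ _ => 0) _.
Next Obligation. by apply/funext => x; rewrite mulr0 addr0. Qed.
Program Definition lop_opp (F : lop) : lop := @LOp (fun f i => - F f i) _.
Next Obligation. by apply/funext => x; rewrite lopP opprD mulrN. Qed.
Program Definition lop_add (F G : lop) : lop := @LOp (fun f i => F f i + G f i) _.
Next Obligation. by apply/funext => x; rewrite !lopP mulrDr addrACA. Qed.
Program Definition lop_one : lop := @LOp (fun f i => f i) _.
Program Definition lop_mul (F G : lop) : lop := @LOp (fun f => F (G f)) _.
Next Obligation. by rewrite !lopP. Qed.
Program Definition lop_scale (c : Qeps) (F : lop) : lop := @LOp (fun f i => c * F f i) _.
Next Obligation. by apply/funext => x; rewrite lopP mulrDr mulrCA. Qed.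

Lemma lopZ (F : lop) a f : F (fun i => a * f i) = fun i => a * F f i.
Proof.
have F0 : F (fun=> 0) = fun=> 0.
  have e : (fun=> 0) = (fun i => -1 * 0 + 0) :> (J -> Qeps).
    by apply/funext => i; rewrite mulr0 addr0.
  rewrite {1}e (lopP F (-1) (fun=> 0) (fun=> 0)).
  by apply/funext => i; rewrite mulN1r addNr.
have -> : (fun i => a * f i) = (fun i => a * f i + 0).
  by apply/funext => i; rewrite addr0.
by rewrite (lopP F a f (fun=> 0)) F0; apply/funext => i; rewrite addr0.
Qed.

Fact lop_addA : associative lop_add.
Proof. by move=> F G H; apply: lop_eq => f i /=; rewrite addrA. Qed.
Fact lop_addC : commutative lop_add.
Proof. by move=> F G; apply: lop_eq => f i /=; rewrite addrC. Qed.
Fact lop_add0 : left_id lop_zero lop_add.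
Proof. by move=> F; apply: lop_eq => f i /=; rewrite add0r. Qed.
Fact lop_addN : left_inverse lop_zero lop_opp lop_add.
Proof. by move=> F; apply: lop_eq => f i /=; rewrite addNr. Qed.
HB.instance Definition _ :=
  GRing.isZmodule.Build lop lop_addA lop_addC lop_add0 lop_addN.

Fact lop_mulA : associative lop_mul.
Proof. by move=> F G H; apply: lop_eq. Qed.
Fact lop_mul1 : left_id lop_one lop_mul.
Proof. by move=> F; apply: lop_eq. Qed.
Fact lop_mulr1 : right_id lop_one lop_mul.
Proof. by move=> F; apply: lop_eq. Qed.
Fact lop_mulDl : left_distributive lop_mul +%R.
Proof. by move=> F G H; apply: lop_eq. Qed.
Fact lop_mulDr : right_distributive lop_mul +%R.
Proof.
move=> F G H; apply: lop_eq => f i /=.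
have -> : (fun i => G f i + H f i) = (fun i => 1 * G f i + H f i).
  by apply/funext => x; rewrite mul1r.
by rewrite lopP mul1r.
Qed.
Fact lop_one_neq0 : lop_one != 0.
Proof.
apply/eqP => /(congr1 (fun F : lop => F (fun=> 1) 0)) /= /eqP.
by rewrite oner_eq0.
Qed.
HB.instance Definition _ := GRing.Zmodule_isNzRing.Build lop
  lop_mulA lop_mul1 lop_mulr1 lop_mulDl lop_mulDr lop_one_neq0.

Fact lop_scaleA c d F : lop_scale c (lop_scale d F) = lop_scale (c * d) F.
Proof. by apply: lop_eq => f i /=; rewrite mulrA. Qed.
Fact lop_scale1 : left_id 1 lop_scale.
Proof. by move=> F; apply: lop_eq => f i /=; rewrite mul1r. Qed.
Fact lop_scaleDr : right_distributive lop_scale +%R.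
Proof. by move=> c F G; apply: lop_eq => f i /=; rewrite mulrDr. Qed.
Fact lop_scaleDl F : {morph lop_scale^~ F : c d / c + d}.
Proof. by move=> c d; apply: lop_eq => f i /=; rewrite mulrDl. Qed.
HB.instance Definition _ := GRing.Zmodule_isLmodule.Build Qeps lop
  lop_scaleA lop_scale1 lop_scaleDr lop_scaleDl.

Fact lop_scaleAl (c : Qeps) (F G : lop) : c *: (F * G) = (c *: F) * G.
Proof. by apply: lop_eq. Qed.
HB.instance Definition _ := GRing.Lmodule_isLalgebra.Build Qeps lop lop_scaleAl.

Lemma lop_scaleAr (c : Qeps) (F G : lop) : c *: (F * G) = F * (c *: G).
Proof. by apply: lop_eq => f i; rewrite [RHS](congr1 (@^~ i) (lopZ F c (G f))). Qed.

Lemma lop_sumE (I : Type) (r : seq I) (P : pred I) (F : I -> lop) f i :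
  (\sum_(x <- r | P x) F x) f i = \sum_(x <- r | P x) F x f i.
Proof. exact: (big_morph (fun G : lop => G f i) (fun G H => erefl) erefl). Qed.

(* m_j |-> c(j) m_(j - w) *)
Program Definition lmono (w : J) (c : J -> Qeps) : lop :=
  @LOp (fun f i => c (i + w) * f (i + w)) _.
Next Obligation. by apply/funext => x; rewrite mulrDr mulrCA. Qed.

Definition mono (w : J) (g : J -> kh) : fps lop :=
  FPS (fun n => lmono w (fun j => coef (g j) n)).

Lemma monoP (O : fps lop) w g :
  (forall n f i, coef O n f i = coef (g (i + w)) n * f (i + w)) -> O = mono w g.
Proof. by move=> e; apply: fpsP => n; apply: lop_eq => f i; rewrite e. Qed.

Lemma eq_mono w g g' : g =1 g' -> mono w g = mono w g'.
Proof. by move=> /funext ->. Qed.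

Lemma monoD w g g' : mono w g + mono w g' = mono w (fun j => g j + g' j).
Proof. by apply: monoP => n f i /=; rewrite mulrDl. Qed.

Lemma monoN w g : - mono w g = mono w (fun j => - g j).
Proof. by apply: monoP => n f i /=; rewrite mulNr. Qed.

Lemma monoZ w c g : c *: mono w g = mono w (fun j => c * g j).
Proof.
apply: monoP => n f i /=; rewrite lop_sumE mulr_suml.
by apply: eq_bigr => m _ /=; rewrite mulrA.
Qed.

Lemma monoM w g w' g' :
  mono w g * mono w' g' = mono (w + w') (fun j => g (j - w') * g' j).
Proof.
apply: monoP => n f i /=; rewrite lop_sumE mulr_suml addrA addrK.
by apply: eq_bigr => m _ /=; rewrite mulrA.
Qed.

Lemma mono1 : 1 = mono 0 (fun=> 1).
Proof.
by apply: monoP => -[|n] f i /=; rewrite addr0 ?mul1r ?mul0r.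
Qed.

Lemma diagM d d' : mono 0 d * mono 0 d' = mono 0 (fun j => d j * d' j).
Proof. by rewrite monoM addr0; apply: eq_mono => j; rewrite subr0. Qed.

Lemma diagX d n : mono 0 d ^+ n = mono 0 (fun j => d j ^+ n).
Proof.
elim: n => [|n IH]; first by rewrite expr0 mono1; apply: eq_mono.
by rewrite exprS IH diagM; apply: eq_mono => j; rewrite exprS.
Qed.

Lemma diag_fexp d : (forall j, coef (d j) 0 = 0) ->
  fexp (mono 0 d) = mono 0 (fun j => fexp (d j)).
Proof.
move=> d0; apply: monoP => n f i.
rewrite coef_fexp; first last.
- by apply: lop_eq => g x; rewrite /= d0 mul0r.
- exact: Qeps_natr_neq0.
rewrite lop_sumE (@coef_fexp Qeps Qeps^o Qeps_natr_neq0 _ _ (d0 _)) mulr_suml.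
by apply: eq_bigr => m _ /=; rewrite diagX /= mulrA.
Qed.

Lemma mono_fsum w (g : nat -> J -> kh) :
  fsum (fun n => mono w (g n)) = mono w (fun j => fsum (fun n => g n j)).
Proof. by apply: monoP => n f i /=; rewrite lop_sumE mulr_suml. Qed.

Definition delta (j i : J) : Qeps := (i == j)%:R.

(* Matrix entries: the coefficient of m_i in O m_j *)
Definition ent (O : fps lop) (i j : J) : kh := FPS (fun n => coef O n (delta j) i).

Lemma ent_mono w g i j : ent (mono w g) i j = if i + w == j then g j else 0.
Proof.
apply: fpsP => n /=; rewrite /delta; case: eqP => [->|_]; rewrite ?mulr1 //.
by rewrite mulr0.
Qed.

Lemma entD O O' i j : ent (O + O') i j = ent O i j + ent O' i j.
Proof. exact: fpsP. Qed.

Lemma ent_sum (I : Type) (r : seq I) (P : pred I) (F : I -> fps lop) i j :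
  ent (\sum_(x <- r | P x) F x) i j = \sum_(x <- r | P x) ent (F x) i j.
Proof.
by rewrite (big_morph (fun O => ent O i j) (fun O O' => entD O O' i j) (_ : _ = 0)) //; apply: fpsP.
Qed.

Lemma ent_eqh N O O' i j : eqh N O O' -> eqh N (ent O i j) (ent O' i j).
Proof. by move=> e n lt /=; rewrite e. Qed.

Lemma entZ c O i j : ent (c *: O) i j = c * ent O i j.
Proof. by apply: fpsP => n /=; rewrite lop_sumE. Qed.

Lemma ent_diagl d O i j : ent (mono 0 d * O) i j = d i * ent O i j.
Proof.
apply: fpsP => n; rewrite [LHS]lop_sumE; apply: eq_bigr => m _.
by rewrite -[LHS]/(coef (d (i + 0)) m * coef O (n - m) (delta j) (i + 0)) addr0.
Qed.

Lemma ent_diagr d O i j : ent (O * mono 0 d) i j = ent O i j * d j.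
Proof.
apply: fpsP => n; rewrite [LHS]lop_sumE; apply: eq_bigr => m _.
set x := coef (d j) (n - m); have E : coef (mono 0 d) (n - m) (delta j) = fun i => x * delta j i.
  apply/funext => l.
  rewrite -[LHS]/(coef (d (l + 0)) (n - m) * delta j (l + 0)) addr0 /x /delta.
  by case: eqP => [->|] //; rewrite !mulr0.
by rewrite -[LHS]/(coef O m (coef (mono 0 d) (n - m) (delta j)) i) E lopZ mulrC.
Qed.

(** * Representations of presented algebras by weighted shifts *)

Section Representation.
Variables (X : choiceType) (wt : X -> int) (s : X -> int -> kh) (a : Qeps).

Definition wtw (u : seq X) : int := \sum_(x <- u) wt x.

(* A generator x acts by m_p |-> s x p m_(p - wt x), hence a word u acts by
   m_p |-> cw u p m_(p - wtw u). *)
Fixpoint cw (u : seq X) (p : int) : kh :=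
  if u is x :: u' then s x (p - wtw u') * cw u' p else 1.

Lemma wtw0 : wtw [::] = 0.
Proof. exact: big_nil. Qed.

Lemma wtw_cons x u : wtw (x :: u) = wt x + wtw u.
Proof. exact: big_cons. Qed.

Lemma wtw_cat u v : wtw (u ++ v) = wtw u + wtw v.
Proof. exact: big_cat. Qed.

Lemma cw_cat u v p : cw (u ++ v) p = cw u (p - wtw v) * cw v p.
Proof.
elim: u => [|x u IH] /=; first by rewrite mul1r.
by rewrite IH wtw_cat mulrA addrAC -addrA -opprD addrC.
Qed.

Definition Gword (u : {fmonom X}) : fps lop :=
  mono (wtw u, 0) (fun j => cw u j.1).

Definition Gpair (w : {fmonom X} * {fmonom X}) : fps lop :=
  mono (wtw w.1, wtw w.2) (fun j => cw w.1 j.1 * cw w.2 j.2).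

Lemma Gpair1 : Gpair (@mone ({fmonom X} * {fmonom X})%type) = 1.
Proof.
rewrite mono1 /Gpair /= fm1 wtw0; apply: eq_mono => j.
by rewrite /= mulr1.
Qed.

Lemma GpairM u v : Gpair (mmul u v) = Gpair u * Gpair v.
Proof.
rewrite monoM /Gpair /= !fmM !wtw_cat; apply: eq_mono => -[p q] /=.
by rewrite !cw_cat mulrACA.
Qed.

Lemma Gword1 : Gword (@mone {fmonom X}) = 1.
Proof. by rewrite mono1 /Gword fm1 wtw0; apply: eq_mono. Qed.

Lemma GwordM u v : Gword (mmul u v) = Gword u * Gword v.
Proof.
rewrite monoM /Gword !fmM wtw_cat.
have -> : (wtw u + wtw v, 0) = (wtw u, 0) + (wtw v, 0) :> J by congr pair.
by apply: eq_mono => -[p q] /=; rewrite cw_cat.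
Qed.

(* rho1 t acts on the first copy; rho12 makes the two tensor factors act on the
   two copies.  Both substitute a h for h. *)
Definition rho1 (t : tfree X) : fps lop := ext Gword (resc a t).
Definition rho12 (t : ftens X) : fps lop := ext Gpair (resc a t).

Lemma rho1_cmorph : cmorph a rho1.
Proof.
rewrite -[a]mul1r; apply: (cm_comp (p := resc a) (q := ext Gword)).
  by apply: cm_resc; apply: malg_scalerAr.
by apply: ext_cmorph; [apply: lop_scaleAr | apply: Gword1 | apply: GwordM].
Qed.

Lemma rho12_cmorph : cmorph a rho12.
Proof.
rewrite -[a]mul1r; apply: (cm_comp (p := resc a) (q := ext Gpair)).
  by apply: cm_resc; apply: malg_scalerAr.
by apply: ext_cmorph; [apply: lop_scaleAr | apply: Gpair1 | apply: GpairM].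
Qed.

Lemma rho1_word (u : {fmonom X}) :
  rho1 (fpsC << u >>) = mono (wtw u, 0) (fun j => cw u j.1).
Proof. by rewrite /rho1 resc_fpsC extU. Qed.

Lemma rho12_pair w :
  rho12 (fpsC << w >>) = mono (wtw w.1, wtw w.2) (fun j => cw w.1 j.1 * cw w.2 j.2).
Proof. by rewrite /rho12 resc_fpsC extU. Qed.

Let wtwU x : wtw (fmu x) = wt x.
Proof. by rewrite fmU /wtw big_seq1. Qed.

Let cwU x p : cw (fmu x) p = s x p.
Proof. by rewrite fmU /= wtw0 subr0 mulr1. Qed.

Lemma rho1_gen x : rho1 (gen x) = mono (wt x, 0) (fun j => s x j.1).
Proof. by rewrite rho1_word wtwU; apply: eq_mono => j; rewrite cwU. Qed.

Lemma rho12_lft x : rho12 (lft x) = mono (wt x, 0) (fun j => s x j.1).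
Proof.
rewrite rho12_pair wtwU /= fm1 wtw0; apply: eq_mono => j.
by rewrite cwU mulr1.
Qed.

Lemma rho12_rgt x : rho12 (rgt x) = mono (0, wt x) (fun j => s x j.2).
Proof.
rewrite rho12_pair wtwU /= fm1 wtw0; apply: eq_mono => j.
by rewrite cwU mul1r.
Qed.

Section Quotient.
Variable rels : seq (tfree X).
Hypothesis relsP : forall r, r \in rels -> rho1 r = 0.

(** The kernel of [rho1] is a closed ideal containing the relations. It is closed because [rho1] is
    continuous and a series divisible by every h^N is 0. *)
Lemma rho1_ideal t : t \in ideal_pred rels -> rho1 t = 0.
Proof.
have cr := rho1_cmorph.
move=> /ideal_predP It; apply: (It (fun t => rho1 t = 0) _ relsP); split.
- exact: (cm0 cr).
- by move=> x y ex ey; rewrite (cmB cr) ex ey subr0.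
- by move=> x y ey; rewrite (cmM cr) ey mulr0.
- by move=> x y ey; rewrite (cmM cr) ey mul0r.
move=> x ex; apply: eqh_eq => N; have [y ey [w ->]] := ex N.
rewrite (cmD cr) ey add0r hXM; apply: (cm_eqh0 cr).
by apply/eqh_iterP; exists w.
Qed.

Lemma rho1_repr t : rho1 (repr (pres_pi rels t)) = rho1 t.
Proof.
apply/eqP; rewrite -subr_eq0 -(cmB rho1_cmorph); apply/eqP; apply: rho1_ideal.
by apply/pres_piE; rewrite pres_reprK.
Qed.
End Quotient.
End Representation.

Lemma linmodsum (K : choiceType) (W : lmodType Qeps) (G : K -> fps W) (t : fps {malg Qeps[K]}) :
  modsum (fun n => 'h ^+ n *:
    \sum_(w <- msupp (coef t n)) fpsC (coef t n)@_w *: G w) = ext G t.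
Proof.
rewrite ext_fsum modsumE // => n m lt.
by rewrite hXZ fcoef_iter_hs lt.
Qed.

Lemma mlinE g m : mlin g m = ext g m.
Proof. exact: linmodsum. Qed.

Lemma mlin_mvec g p : mlin g (mvec p) = g p.
Proof. by rewrite mlinE extU. Qed.

Lemma mlinZ g c m : mlin g (c *: m) = c *: mlin g m.
Proof. by rewrite !mlinE extZ. Qed.

(* m_p, with m_p = 0 for p < 0 *)
Definition mvecZ (p : int) : vmod := if p is Posz n then mvec n else 0.

(** * From indices in Z to the modules with basis m_p, p >= 0 *)

Section Bridge.
Variables (X : choiceType) (wt : X -> int) (s : X -> int -> kh).
Variable op : X -> vmod -> vmod.
Hypothesis opZ : forall x c m, op x (c *: m) = c *: op x m.
Hypothesis opE : forall x (p : nat), op x (mvec p) = s x p *: mvecZ (p%:Z - wt x).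
Hypothesis s0 : forall x (p n : nat), p%:Z - wt x = Negz n -> s x p = 0.

Local Notation wtw := (wtw wt).
Local Notation cw := (cw wt s).

(** A path from p >= 0 to a negative index crosses the boundary at some letter, whose coefficient
    vanishes by [s0]. *)
Let cw0 (u : seq X) (p n : nat) : p%:Z - wtw u = Negz n -> cw u p = 0.
Proof.
elim: u n => [|x u IH] n /=; first by rewrite wtw0 subr0.
rewrite wtw_cons opprD addrCA addrC.
case e : (p%:Z - wtw u) => [q|q] eq; last by rewrite (IH q) ?mulr0.
by rewrite (s0 eq) mul0r.
Qed.

Let act_wordE (u : seq X) (p : nat) :
  foldr op (mvec p) u = cw u p *: mvecZ (p%:Z - wtw u).
Proof.
elim: u => [|x u IH] /=; first by rewrite scale1r wtw0 subr0.
rewrite wtw_cons IH opZ opprD addrCA [_ + (p%:Z - _)]addrC.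
case e : (p%:Z - wtw u) => [q|q]; last first.
  by rewrite (cw0 e) mulr0 !scale0r.
by rewrite -[mvecZ (Posz q)]/(mvec q) opE scalerA; congr (_ *: _); apply: mulrC.
Qed.

Lemma act_free_ext t m : act_free op t m = ext (fun w => act_word op w m) t.
Proof. exact: linmodsum. Qed.

(** Since nothing leaves the span of the m_p with p >= 0, the action on m_0 is a column of the
    operator over Z. The second copy of Z stays at 0, as [rho1] acts on the first one only. *)
Lemma coef_act_free t n (p : nat) :
  (coef (act_free op t (mvec 0)) n)@_p =
  coef (ent (rho1 wt s 1 t) (p%:Z, 0) 0) n.
Proof.
rewrite act_free_ext /rho1 resc1.
transitivity (\sum_(i < n.+1) \sum_(w <- msupp (coef t i))
  (coef t i)@_w * (coef (cw w 0) (n - i) * (p%:Z == - wtw w)%:R)).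
  rewrite [LHS]raddf_sum; apply: eq_bigr => i _.
  rewrite /linext fcoef_sum raddf_sum; apply: eq_bigr => w _.
  rewrite fcoefCZ [LHS]mcoeffZ; congr (_ * _).
  rewrite /act_word act_wordE sub0r.
  have -> : coef (cw w 0 *: mvecZ (- wtw w)) (n - i) =
     coef (cw w 0) (n - i) *: (if - wtw w is Posz q then << q >> else 0).
    case: (- wtw w) => q; first exact: fcoefZC.
    by rewrite scaler0 scaler0.
  rewrite mcoeffZ; congr (_ * _); case: (- wtw w) => q; last by rewrite mcoeff0.
  by rewrite mcoeffU eq_sym.
rewrite [RHS]lop_sumE; apply: eq_bigr => i _.
rewrite /linext fcoef_sum lop_sumE; apply: eq_bigr => w _.
rewrite fcoefCZ; congr (_ * _).
rewrite -[RHS]/(coef (cw w (p%:Z + wtw w)) (n - i) * ((p%:Z + wtw w, 0 + 0) == 0 :> J)%:R).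
rewrite xpair_eqE addr0 eqxx andbT addr_eq0.
by case: eqP => [->|]; rewrite ?mulr0 // addNr.
Qed.
End Bridge.

Lemma mono_eq w w' g g' : w = w' -> g =1 g' -> mono w g = mono w' g'.
Proof. by move=> -> /eq_mono ->. Qed.

Lemma mono_bracket w g w' g' : bracket (mono w g) (mono w' g') =
  mono (w + w') (fun j => g (j - w') * g' j - g' (j - w) * g j).
Proof. by rewrite /bracket !monoM [w' + w]addrC monoN monoD. Qed.

Lemma mono0 w g : (forall j, g j = 0) -> mono w g = 0.
Proof. by move=> g0; apply/esym/monoP => n f i; rewrite g0 mul0r. Qed.

Lemma monoMn w g n : mono w g *+ n = mono w (fun j => g j *+ n).
Proof.
elim: n => [|n IH]; first by rewrite mulr0n; apply/esym/mono0.
by rewrite mulrS IH monoD; apply: eq_mono => j; rewrite mulrS.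
Qed.

Lemma coef_fexp_h (S : lalgType Qeps) (x : fps S) : coef (fexp ('h * x)) 0 = 1.
Proof. by rewrite coef_fexp0 ?coef0_h //; apply: Qeps_natr_neq0. Qed.

Section MorphismFormulas.
Variables (S : lalgType Qeps) (a : Qeps) (p : fps S -> fps lop).
Hypothesis cp : cmorph a p.

Lemma cm_hM x : p ('h * x) = (fpsC a * 'h) *: p x.
Proof. by rewrite hM (cm_hs cp) -scalerA hZ. Qed.

Lemma cm_fexp_diag x d : p x = mono 0 d ->
  p (fexp ('h * x)) = mono 0 (fun j => Ex (fpsC a * d j)).
Proof.
move=> px; rewrite (cm_fexp cp) ?cm_hM ?coef0_h // px monoZ diag_fexp => [|j].
  by apply: eq_mono => j; rewrite Ex.unlock mulrCA mulrA.
by rewrite -mulrA mulrCA coef0_h.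
Qed.

Lemma cm_exdiv_sinh c x y d d' : hunit c -> p x = mono 0 d -> p y = mono 0 d' ->
  krescale a c *: p (exdiv (fexp ('h * x) - fexp ('h * y)) (c *: 1)) =
  mono 0 (fun j => Ex (fpsC a * d j) - Ex (fpsC a * d' j)).
Proof.
move=> hc px py; have e0 : coef (fexp ('h * x) - fexp ('h * y)) 0 = 0.
  rewrite fcoefB; apply/eqP; rewrite subr_eq0; apply/eqP.
  exact: (etrans (coef_fexp_h x) (esym (coef_fexp_h y))).
rewrite -(cmZ cp) (exdiv_hunit_scal hc e0) (cmB cp).
apply: (etrans (congr2 (fun u v => u - v) (cm_fexp_diag px) (cm_fexp_diag py))).
by rewrite monoN monoD.
Qed.

Lemma cm_qbracket c x y z : p (x * y - (c *: (y * x) + z)) =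
  p x * p y - (krescale a c *: (p y * p x) + p z).
Proof. by rewrite (cmB cp) (cmD cp) (cmZ cp) !(cmM cp). Qed.

Lemma cm_bracket x y : p (bracket x y) = bracket (p x) (p y).
Proof. by rewrite (cmB cp) !(cmM cp). Qed.
End MorphismFormulas.

HB.lock Definition kap : kh := exdiv qden phi_h.
Lemma kapE : phi_h * kap = qden.
Proof.
by rewrite kap.unlock; apply: exdiv_hunit; [exact: phi_h_hunit | case: qden_hunit].
Qed.

Lemma scale_reg (S : lalgType Qeps) c (x y : fps S) : hunit c -> c *: x = c *: y -> x = y.
Proof.
move=> hc e; apply: (@hunit_scal_reg S c hc).
by rewrite -!scalerAl !mul1r.
Qed.

(** * The three representations *)

Section Weights.
Variable lambda : Qeps.

(* The weight lambda - 2p of m_p *)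
Definition wl (p : int) : kh := fpsC (lambda - (p * 2)%:~R).

Lemma wlS p : wl (p + 1) = wl p - 2.
Proof.
rewrite /wl -fpsC_nat -fpsCN -fpsCD; congr fpsC.
by rewrite mulrDl rmorphD opprD addrA.
Qed.

Lemma wlP p : wl (p - 1) = wl p + 2.
Proof. by rewrite -[p in RHS](subrK 1) wlS subrK. Qed.

Lemma br_wl p : qden * br (lambda - (p * 2)%:~R) = Ex (wl p) - Ex (- wl p).
Proof. exact: brE. Qed.

(** The two products are the coefficients of E F and F E on m_p. *)
Lemma br_EF p : br (p + 1)%:~R * br (lambda - p%:~R) -
  br (lambda - (p - 1)%:~R) * br p%:~R = br (lambda - (p * 2)%:~R).
Proof.
have -> : (p + 1)%:~R = p%:~R + 1 :> Qeps by rewrite rmorphD.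
have -> : lambda - (p - 1)%:~R = lambda - p%:~R + 1 by rewrite rmorphB opprB addrCA addrC.
have -> : lambda - (p * 2)%:~R = lambda - p%:~R - p%:~R.
  by rewrite -addrA -opprD -rmorphD -mulr2n mulr_natr.
by rewrite -(qbr_identity p%:~R (lambda - p%:~R)); congr (_ - _); apply: mulrC.
Qed.

Definition wtU (x : Ugen) : int := match x with UE => 1 | UF => -1 | UH => 0 end.
Definition sU (x : Ugen) (p : int) : kh :=
  match x with
  | UE => br p%:~R
  | UF => br (lambda - p%:~R)
  | UH => wl p
  end.

Local Notation rhoU := (rho1 wtU sU 1).

Lemma U_relsP r : r \in U_rels -> rhoU r = 0.
Proof.
have cr := rho1_cmorph wtU sU 1.
rewrite !inE => /or3P[] /eqP ->.
- rewrite (cmB cr) (cmMn cr) (cm_bracket cr) !rho1_gen mono_bracket monoMn monoN.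
  rewrite (mono_eq (w' := (1, 0)) (g' := (fun j => br j.1%:~R *+ 2)) _ _) //.
    by rewrite monoD mono0 // => j; rewrite subrr.
  move=> j /=; rewrite wlP subr0; move: (br _) (wl _) => x y; ring.
- rewrite (cmD cr) (cmMn cr) (cm_bracket cr) !rho1_gen mono_bracket monoMn.
  rewrite (mono_eq (w' := (-1, 0)) (g' := (fun j => br (lambda - j.1%:~R) *- 2)) _ _) //.
    by rewrite monoD mono0 // => j; rewrite addNr.
  move=> j /=; rewrite opprK wlS subr0; move: (br _) (wl _) => x y; ring.
rewrite (cmB cr) (cm_bracket cr) !rho1_gen mono_bracket.
rewrite -mulrN; set z := exdiv _ _.
have eH : rhoU (- gen UH) = mono 0 (fun j => - wl j.1) by rewrite (cmN cr) rho1_gen monoN.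
have := cm_exdiv_sinh cr qden_hunit (rho1_gen _ _ _ UH) eH.
rewrite -/z /krescale resc1 => e.
have -> : rhoU z = mono 0 (fun j => br (lambda - (j.1 * 2)%:~R)).
  (* The quotient is known only through its defining equation, so it is identified after
     multiplication by q - q^-1. *)
  apply: (scale_reg qden_hunit); rewrite e monoZ; apply: eq_mono => j.
  by rewrite br_wl !fpsC1 !mul1r.
rewrite monoN (mono_eq (w' := 0) (g' := fun j => br (lambda - (j.1 * 2)%:~R)) _ _) //.
  by rewrite monoD mono0 // => j; rewrite subrr.
by move=> j /=; rewrite opprK br_EF.
Qed.
End Weights.

Section DoubleRelations.
Variables (lambda : Qeps) (mu : kh).
Local Notation wl := (wl lambda).

Definition wtS (x : Dsl2gen) : int :=
  match x with GE => 1 | GF => -1 | GH | GHt => 0 end.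
Definition sS (x : Dsl2gen) (p : int) : kh :=
  match x with
  | GE => br p%:~R
  | GF => Ex (- mu) * br (lambda - p%:~R)
  | GH => wl p - mu
  | GHt => - wl p - mu
  end.

Local Notation rhoS := (rho1 wtS sS 1).

Lemma S_relsP r : r \in Dsl2_rels -> rhoS r = 0.
Proof.
have cr := rho1_cmorph wtS sS 1.
have Z w (g : J -> kh) : (forall j, g j = 0) -> mono w g = 0 := @mono0 w g.
rewrite !inE => /or4P[/eqP->|/eqP->|/eqP->|/or3P[/eqP->|/eqP->|/eqP->]].
- rewrite (cmB cr) (cmMn cr) (cm_bracket cr) !rho1_gen mono_bracket monoMn monoN.
  rewrite (mono_eq (w' := (1, 0)) (g' := (fun j => br j.1%:~R *+ 2)) _ _) //.
    by rewrite monoD mono0 // => j; rewrite subrr.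
  move=> j /=; rewrite wlP subr0; move: (br _) (wl _) => x y; ring.
- rewrite (cmD cr) (cmMn cr) (cm_bracket cr) !rho1_gen mono_bracket monoMn.
  rewrite (mono_eq (w' := (1, 0)) (g' := (fun j => br j.1%:~R *- 2)) _ _) //.
    by rewrite monoD mono0 // => j; rewrite addNr.
  move=> j /=; rewrite wlP subr0; move: (br _) (wl _) => x y; ring.
- rewrite (cmD cr) (cmMn cr) (cm_bracket cr) !rho1_gen mono_bracket monoMn.
  rewrite (mono_eq (w' := (-1, 0)) (g' := (fun j => sS GF j.1 *- 2)) _ _) //.
    by rewrite monoD mono0 // => j; rewrite addNr.
  move=> j /=; rewrite opprK wlS subr0; move: (Ex _) (br _) (wl _) => x y z; ring.
- rewrite (cmB cr) (cmMn cr) (cm_bracket cr) !rho1_gen mono_bracket monoMn monoN.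
  rewrite (mono_eq (w' := (-1, 0)) (g' := (fun j => sS GF j.1 *+ 2)) _ _) //.
    by rewrite monoD mono0 // => j; rewrite subrr.
  move=> j /=; rewrite opprK wlS subr0; move: (Ex _) (br _) (wl _) => x y z; ring.
- rewrite (cmB cr) (cm_bracket cr) !rho1_gen mono_bracket; set z := exdiv _ _.
  have := cm_exdiv_sinh cr qden_hunit (rho1_gen _ _ _ GH) (rho1_gen _ _ _ GHt).
  rewrite -/z /krescale resc1 => e.
  (* On this module q^H - q^Ht = e^(-h mu) (q^H' - q^(-H')), and the prefactor is the one carried by
     F = e^(-hc) F'. *)
  pose g (j : J) := Ex (- mu) * br (lambda - (j.1 * 2)%:~R).
  have -> : rhoS z = mono 0 g.
    apply: (scale_reg qden_hunit); rewrite e monoZ; apply: eq_mono => j.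
    by rewrite /g mulrCA br_wl !fpsC1 !mul1r mulrBr -!ExD /= [- mu + wl _]addrC
      [- mu - wl _]addrC.
  rewrite monoN (mono_eq (w' := 0) (g' := g) _ _) //.
    by rewrite monoD mono0 // => j; rewrite subrr.
  move=> j; rewrite /g -br_EF /= opprK.
  move: (Ex _) (br _) (br _) (br _) (br _) => x y a b c; ring.
rewrite (cm_bracket cr) !rho1_gen mono_bracket mono0 // => j /=.
rewrite !subr0; move: (wl _) => x; ring.
Qed.

(* The module over the double of D pulled back along phi: sD is the action of
   phi_gen. *)
Definition wtD (x : Dgen) : int := match x with Gy => 1 | Gx => -1 | Gb | Ga => 0 end.
Definition sD (x : Dgen) (p : int) : kh :=
  match x with
  | Gy => br p%:~R
  | Gb => - (fpsC (eps / 2) * (wl p - mu))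
  | Ga => fpsC 2^-1 * (- wl p - mu)
  | Gx => kap * (Ex (wl (p + 1)) * br (lambda - p%:~R))
  end.

Local Notation rhoD := (rho1 wtD sD (2 / eps)).

Lemma half_mul (x : kh) : fpsC 2^-1 * (x *+ 2) = x.
Proof.
by rewrite -[x *+ 2]mulr_natl mulrA -fpsC_nat -fpsCM mulVf ?two_neq0 // fpsC1 mul1r.
Qed.

Lemma eps_half_mul (x : kh) : fpsC (eps / 2) * (x *+ 2) = fpsC eps * x.
Proof. by rewrite fpsCM -mulrA half_mul. Qed.

Lemma resc_eps_half (x : kh) : fpsC (2 / eps) * (fpsC (eps / 2) * x) = x.
Proof.
rewrite mulrA -fpsCM mulrA divfK ?eps_neq0 // mulfV ?two_neq0 //.
by rewrite fpsC1 mul1r.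
Qed.
Lemma resc_eps_inv2 (x : kh) : fpsC (2 / eps) * (fpsC eps * (fpsC 2^-1 * x)) = x.
Proof. by rewrite [fpsC eps * _]mulrA -fpsCM resc_eps_half. Qed.

Lemma exdiv_h (S : nzRingType) (x : fps S) : coef x 0 = 0 -> 'h * exdiv x 'h = x.
Proof.
move=> x0; rewrite (@exdivE _ x 'h (ftail x)) ?hM ?hs_ftail //.
move=> y z; rewrite !hM => e; apply: fpsP => n.
exact: (congr1 (fun f => coef f n.+1) e).
Qed.

Lemma D_AE : D_A = fexp ('h * - (fpsC eps *: gen Ga)).
Proof.
rewrite /D_A fps_scalerAr; last exact: malg_scalerAr.
by rewrite -mulrN.
Qed.

Lemma D_BE : D_B = fexp ('h * - gen Gb).
Proof. by rewrite /D_B -mulrN. Qed.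

Lemma rhoD_A : rhoD D_A = mono 0 (fun j => Ex (wl j.1 + mu)).
Proof.
have cr := rho1_cmorph wtD sD (2 / eps).
pose d (j : J) := - (fpsC eps * sD Ga j.1).
have pa : rhoD (- (fpsC eps *: gen Ga)) = mono 0 d.
  by rewrite (cmN cr) (cmZC cr) rho1_gen monoZ monoN.
rewrite D_AE (cm_fexp_diag cr pa); apply: eq_mono => j; congr Ex.
by rewrite /d /= mulrN resc_eps_inv2 opprB opprK addrC.
Qed.

Lemma rhoD_B : rhoD D_B = mono 0 (fun j => Ex (wl j.1 - mu)).
Proof.
have cr := rho1_cmorph wtD sD (2 / eps).
pose d (j : J) := - sD Gb j.1.
have pa : rhoD (- gen Gb) = mono 0 d by rewrite (cmN cr) rho1_gen monoN.
rewrite D_BE (cm_fexp_diag cr pa); apply: eq_mono => j; congr Ex.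
by rewrite /d /= opprK resc_eps_half.
Qed.

(** Under phi, A B becomes q^(2H'), where mu has cancelled. Multiplied by 2h/eps, which turns the
    scalar of phi(x) into q - q^-1, the relation reads - q^H' (q - q^-1) [E, F'] = 1 - q^(2H'). *)
Lemma rhoD_xy : rhoD (gen Gx * gen Gy - (qeps *: (gen Gy * gen Gx) + exdiv (1 - D_A * D_B) 'h)) = 0.
Proof.
have cr := rho1_cmorph wtD sD (2 / eps).
set z := exdiv _ _.
have hz : 'h * z = 1 - D_A * D_B.
  apply: exdiv_h; rewrite fcoefB fcoefM0 D_AE D_BE.
  apply/eqP; rewrite subr_eq0 eq_sym; apply/eqP.
  by rewrite [LHS](congr2 *%R (coef_fexp_h _) (coef_fexp_h _)) mulr1.
have eAB : rhoD (D_A * D_B) = _ :=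
  etrans (cmM cr _ _) (etrans (congr2 *%R rhoD_A rhoD_B) (diagM _ _)).
move: hz => /(congr1 rhoD); rewrite (cm_hM cr) -/phi_h (cmB cr) eAB (cm1 cr).
rewrite mono1 monoN monoD => hz; clearbody z.
rewrite (cm_qbracket cr) !rho1_gen !monoM monoZ krescale_qeps.
have aux (x y t : fps lop) : t = x - y -> x - (y + t) = 0.
  by move=> ->; rewrite [y + _]addrC subrK subrr.
apply: aux; rewrite monoN.
apply: (scale_reg phi_h_hunit); rewrite hz.
rewrite [X in _ *: (X + _)](mono_eq (w' := 0) (g' := fun j => kap * (Ex (wl j.1) *
   (br (lambda - (j.1 - 1)%:~R) * br j.1%:~R))) _ _) //; last first.
  move=> j /=; rewrite subrK.
  move: kap (Ex _) (br _) (br _) => a b c d; ring.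
set m2 := (X in _ *: (_ + X)).
have -> : m2 = mono 0 (fun j => - (kap * (Ex (wl j.1) *
    (br (j.1 + 1)%:~R * br (lambda - j.1%:~R))))).
  apply: mono_eq => // j /=; rewrite opprK wlS.
  (* The factor q_eps has become q^2, which is exactly the change of q^H' from m_(p+1) to m_p. *)
  have -> : Ex (wl j.1) = Ex 2 * Ex (wl j.1 - 2) by rewrite -ExD addrC subrK.
  move: kap (Ex _) (Ex _) (br _) (br _) => a b c d e; ring.
rewrite monoD monoZ; apply: eq_mono => j.
transitivity (phi_h * kap * (Ex (wl j.1) * - (br (j.1 + 1)%:~R * br (lambda - j.1%:~R) -
    br (lambda - (j.1 - 1)%:~R) * br j.1%:~R))); last first.
  move: phi_h kap (Ex _) (br _) (br _) (br _) (br _) => a b c d e f g; ring.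
rewrite kapE br_EF.
transitivity (- (Ex (wl j.1) * (qden * br (lambda - (j.1 * 2)%:~R)))); last first.
  by move: qden (Ex _) (br _) => a b c; ring.
rewrite br_wl mulrBr ExN opprB -!ExD; congr (_ - Ex _).
by rewrite addrACA subrr addr0.
Qed.

Lemma D_relsP r : r \in D_rels -> rhoD r = 0.
Proof.
have cr := rho1_cmorph wtD sD (2 / eps).
rewrite !inE => /or4P[/eqP->|/eqP->|/eqP->|/or3P[/eqP->|/eqP->|/eqP->]].
- exact: rhoD_xy.
- rewrite (cmB cr) (cm_bracket cr) !rho1_gen mono_bracket monoN.
  rewrite (mono_eq (w' := (-1, 0)) (g' := (fun j => sD Gx j.1)) _ _) //.
    by rewrite monoD mono0 // => j; rewrite subrr.
  move=> j /=; rewrite !subr0 opprK wlS.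
  have e : fpsC 2^-1 * (- (wl j.1 - 2) - mu) = fpsC 2^-1 * (- wl j.1 - mu) + 1.
    rewrite -[X in _ = _ + X](half_mul 1) -mulrDr; congr (_ * _).
    by move: (wl _) => u; ring.
  rewrite e; move: (fpsC _ * _) (kap * _) => a b; ring.
- rewrite (cmB cr) (cm_bracket cr) (cmZC cr) !rho1_gen mono_bracket monoZ monoN.
  rewrite (mono_eq (w' := (-1, 0)) (g' := (fun j => fpsC eps * sD Gx j.1)) _ _) //.
    by rewrite monoD mono0 // => j; rewrite subrr.
  move=> j /=; rewrite !subr0 opprK wlS.
  have e : - (fpsC (eps / 2) * (wl j.1 - 2 - mu)) =
      - (fpsC (eps / 2) * (wl j.1 - mu)) + fpsC eps.
    rewrite -[fpsC eps in RHS]mulr1 -eps_half_mul.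
    by move: (wl _) (fpsC _) => u v; ring.
  rewrite e; move: (fpsC _ * _) (kap * _) (fpsC eps) => a b c; ring.
- rewrite (cmD cr) (cm_bracket cr) !rho1_gen mono_bracket.
  rewrite (mono_eq (w' := (1, 0)) (g' := (fun j => - sD Gy j.1)) _ _) //.
    by rewrite monoD mono0 // => j; rewrite addNr.
  move=> j /=; rewrite !subr0 wlP.
  have e : fpsC 2^-1 * (- (wl j.1 + 2) - mu) = fpsC 2^-1 * (- wl j.1 - mu) - 1.
    rewrite -[X in _ = _ - X](half_mul 1) -mulrBr; congr (_ * _).
    by move: (wl _) => u; ring.
  rewrite e; move: (fpsC _ * _) (br _) => a b; ring.
- rewrite (cmD cr) (cm_bracket cr) (cmZC cr) !rho1_gen mono_bracket monoZ.
  rewrite (mono_eq (w' := (1, 0)) (g' := (fun j => - (fpsC eps * sD Gy j.1))) _ _) //.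
    by rewrite monoD mono0 // => j; rewrite addNr.
  move=> j /=; rewrite !subr0 wlP.
  have e : - (fpsC (eps / 2) * (wl j.1 + 2 - mu)) =
      - (fpsC (eps / 2) * (wl j.1 - mu)) - fpsC eps.
    rewrite -[fpsC eps in RHS]mulr1 -eps_half_mul.
    by move: (wl _) (fpsC _) => u v; ring.
  rewrite e; move: (fpsC _ * _) (br _) (fpsC eps) => a b c; ring.
rewrite (cm_bracket cr) !rho1_gen mono_bracket mono0 // => j /=.
rewrite !subr0; move: (fpsC _ * _) (fpsC _ * _) => a b; ring.
Qed.
End DoubleRelations.

(** * Pullback along phi, and the actions as matrix entries *)

Section Phi.
Variables (lambda : Qeps) (mu : kh).
Local Notation wl := (wl lambda).
Local Notation sS := (sS lambda mu).
Local Notation sD := (sD lambda mu).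
Local Notation rhoS := (rho1 wtS sS 1).
Local Notation rhoD := (rho1 wtD sD (2 / eps)).

Definition phi_word (w : {fmonom Dgen}) : tfree Dsl2gen := \prod_(g <- (w : seq Dgen)) phi_gen g.

Lemma phi_freeE t : phi_free t = ext phi_word (resc (2 / eps) t).
Proof.
rewrite ext_fsum -ringsumE; last first.
  by move=> n m lt; rewrite hXZ fcoef_iter_hs lt.
rewrite /phi_free; apply: (congr1 (@ringsum _)); apply/funext => n.
have -> : phi_h ^+ n = fpsC ((2 / eps) ^+ n) * 'h ^+ n.
  rewrite /phi_h exprMn; congr (_ * _).
  by elim: n => [|m IH]; rewrite ?expr0 ?fpsC1 // !exprS IH -fpsCM.
by rewrite mulrC -scalerA -linextZ.
Qed.

Lemma rhoS_phi_gen g : rhoS (phi_gen g) = mono (wtD g, 0) (fun j => sD g j.1).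
Proof.
have cr := rho1_cmorph wtS sS 1.
case: g.
- by rewrite [LHS](rho1_gen wtS sS 1 GE).
- rewrite [LHS](cmN cr) (cmZC cr) rho1_gen monoZ monoN.
  by apply: eq_mono.
- by rewrite [LHS](cmZC cr) rho1_gen monoZ; apply: eq_mono.
rewrite [LHS](cmZ cr) /krescale resc1 -kap.unlock (cmM cr) -mulrN.
pose d (j : J) := - sS GHt j.1.
have pa : rhoS (- gen GHt) = mono 0 d by rewrite (cmN cr) rho1_gen monoN.
rewrite (cm_fexp_diag cr pa) rho1_gen monoM monoZ; apply: mono_eq => // j.
rewrite /d /= fpsC1 mul1r !opprB !opprK; congr (_ * _).
(* The e^(h mu) of q^(-Ht) cancels the e^(-h mu) of F. *)
by rewrite mulrA -ExD addrAC subrr add0r.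
Qed.

Lemma rhoS_phi_word w : rhoS (phi_word w) = Gword wtD sD w.
Proof.
have cr := rho1_cmorph wtS sS 1.
rewrite /phi_word (cm_prod cr) /Gword; elim: (w : seq _) => [|g u IH] /=.
  by rewrite big_nil mono1 wtw0.
rewrite big_cons IH rhoS_phi_gen monoM wtw_cons.
by apply: mono_eq => // j.
Qed.

(** Once h has been rescaled, both sides are additive and commute with h, so it suffices to compare
    them on words, hence on generators. The action of phi(u) can thus be computed from a
    representative of u. *)
Lemma rhoS_phi_free t : rhoS (phi_free t) = rhoD t.
Proof.
have cr := rho1_cmorph wtS sS 1.
rewrite phi_freeE /rho1; move: (resc _ t) => {}t.
apply: (fps_ext (p := fun t => rhoS (ext phi_word t)) (q := ext (Gword wtD sD))) =>
  [x y|x y|x|x|v] /=.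
- by rewrite extD (cmD cr).
- exact: extD.
- by rewrite ext_hs (cm_hs cr) fpsC1 scale1r.
- exact: ext_hs.
rewrite !extC /linext (cm_sum cr); apply: eq_bigr => w _.
by rewrite (cmZC cr) rhoS_phi_word.
Qed.

Lemma wl_nat (p : nat) : fpsC (lambda - (p.*2)%:R) = wl p.
Proof. by rewrite /wl -muln2. Qed.

Lemma vE_mvec (p : nat) : vE (mvec p) = br p%:~R *: mvecZ (p%:Z - 1).
Proof.
rewrite /vE mlin_mvec; case: p => [|p]; first by rewrite br0 scale0r.
by rewrite qbr_br -addn1 PoszD addrK.
Qed.

Lemma vF_mvec (p : nat) : vF lambda (mvec p) = br (lambda - p%:~R) *: mvecZ (p%:Z - -1).
Proof. by rewrite /vF mlin_mvec qbr_br opprK -PoszD addn1. Qed.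

Lemma vH_mvec (p : nat) : vH lambda (mvec p) = wl p *: mvec p.
Proof. by rewrite /vH mlin_mvec wl_nat. Qed.

Lemma verma_opZ x c m : verma_op lambda x (c *: m) = c *: verma_op lambda x m.
Proof. by case: x; apply: mlinZ. Qed.

Lemma verma_opE x (p : nat) :
  verma_op lambda x (mvec p) = sU lambda x p *: mvecZ (p%:Z - wtU x).
Proof.
case: x; [exact: vE_mvec | exact: vF_mvec |].
by rewrite [LHS]vH_mvec; congr (_ *: _); rewrite subr0.
Qed.

Lemma verma_s0 x (p n : nat) : p%:Z - wtU x = Negz n -> sU lambda x p = 0.
Proof.
case: x => /=.
- by case: p => [|p]; [rewrite br0 | rewrite -addn1 PoszD addrK].
- by rewrite opprK -PoszD.
- by rewrite subr0.
Qed.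

Lemma Dsl2_opZ x c m : Dsl2_op lambda mu x (c *: m) = c *: Dsl2_op lambda mu x m.
Proof.
have sC (d e : kh) (v : vmod) : d *: (e *: v) = e *: (d *: v).
  by rewrite !scalerA mulrC.
case: x => /=; first exact: mlinZ.
- by rewrite /vF mlinZ sC.
- by rewrite /vH mlinZ sC [RHS]scalerBr.
- by rewrite /vH mlinZ sC [RHS]scalerBr scalerN.
Qed.

Lemma Dsl2_opE x (p : nat) :
  Dsl2_op lambda mu x (mvec p) = sS x p *: mvecZ (p%:Z - wtS x).
Proof.
case: x; first exact: vE_mvec.
- rewrite /= vF_mvec scalerA; congr (_ *: _); congr (_ * _).
  by rewrite Ex.unlock mulrN.
- transitivity ((wl p - mu) *: mvec p); last by congr (_ *: _); rewrite subr0.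
  by rewrite /= vH_mvec [RHS]scalerBl.
- transitivity ((- wl p - mu) *: mvec p); last by congr (_ *: _); rewrite subr0.
  by rewrite /= vH_mvec [RHS]scalerBl scaleNr.
Qed.

Lemma Dsl2_s0 x (p n : nat) : p%:Z - wtS x = Negz n -> sS x p = 0.
Proof.
case: x => /=.
- by case: p => [|p]; [rewrite br0 | rewrite -addn1 PoszD addrK].
- by rewrite opprK -PoszD.
- by rewrite subr0.
- by rewrite subr0.
Qed.

Lemma verma_act_coef u n (p : nat) :
  (coef (verma_act lambda u (mvec 0)) n)@_p =
  coef (ent (rho1 wtU (sU lambda) 1 (repr u)) (p%:Z, 0) 0) n.
Proof.
apply: coef_act_free; [exact: verma_opZ | exact: verma_opE | exact: verma_s0].
Qed.

Lemma Dsl2_act_coef u n (p : nat) :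
  (coef (Dsl2_act lambda mu (phi u) (mvec 0)) n)@_p =
  coef (ent (rhoD (repr u)) (p%:Z, 0) 0) n.
Proof.
transitivity (coef (ent (rhoS (repr (phi u))) (p%:Z, 0) 0) n).
  by apply: coef_act_free; [exact: Dsl2_opZ | exact: Dsl2_opE | exact: Dsl2_s0].
rewrite /phi rho1_repr ?rhoS_phi_free //; exact: S_relsP.
Qed.
End Phi.

Lemma fsum_additive (V W : zmodType) (p : fps V -> fps W) (u : nat -> fps V) :
  {morph p : x y / x + y} -> (forall N x, eqh N x 0 -> eqh N (p x) 0) ->
  summable u -> p (fsum u) = fsum (p \o u).
Proof.
move=> pD pc su; have p0 : p 0 = 0 by apply: (addrI (p 0)); rewrite -pD !addr0.
have spu : summable (p \o u) by move=> n; apply: pc.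
have pB x y : p (x - y) = p x - p y by apply: (addIr (p y)); rewrite -pD !subrK.
apply: eqh_eq => N; apply: (eqh_trans (p (\sum_(i < N) u i))).
  apply: eqh_sym; apply/(eqh0P _ _ _).2; rewrite -pB; apply: pc; apply/(eqh0P _ _ _).1.
  exact: fsum_eqh.
by rewrite (big_morph p pD p0); apply: fsum_eqh.
Qed.

Lemma eqh0_fsum (V : zmodType) (u : nat -> fps V) N :
  (forall n, eqh N (u n) 0) -> eqh N (fsum u) 0.
Proof. by move=> u0 n lt /=; rewrite big1 // => i _; rewrite u0. Qed.

Lemma eqh0Z (V : lmodType Qeps) N (c : kh) (x : fps V) : eqh N c 0 -> eqh N (c *: x) 0.
Proof.
move=> /eqh_iterP[d ->]; apply/eqh_iterP; exists (d *: x).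
by elim: N => //= N <-; rewrite hsZl.
Qed.

Lemma eqh0Zr (V : lmodType Qeps) N (c : kh) (x : fps V) : eqh N x 0 -> eqh N (c *: x) 0.
Proof.
move=> /eqh_iterP[d ->]; apply/eqh_iterP; exists (c *: d).
by elim: N => //= N <-; rewrite hsZr.
Qed.

Lemma eqh0Mr (S : nzRingType) N (x y : fps S) : eqh N y 0 -> eqh N (x * y) 0.
Proof. exact: (@eqh0M _ 0). Qed.

Lemma eqh0Ml (S : nzRingType) N (x y : fps S) : eqh N x 0 -> eqh N (x * y) 0.
Proof. by move=> x0; have := eqh0M (N := 0) x0 (_ : eqh 0 y 0); rewrite addn0; apply. Qed.

Lemma fsumMl (S : nzRingType) (x : fps S) u : summable u -> x * fsum u = fsum (fun n => x * u n).
Proof.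
apply: (fsum_additive (p := fun y => x * y)); first exact: mulrDr.
by move=> N y; apply: eqh0Mr.
Qed.

Lemma fsumMr (S : nzRingType) (x : fps S) u : summable u -> fsum u * x = fsum (fun n => u n * x).
Proof.
apply: (fsum_additive (p := fun y => y * x)); first by move=> y z; exact: mulrDl.
by move=> N y; apply: eqh0Ml.
Qed.

Lemma fsumZ (V : lmodType Qeps) (c : kh) (u : nat -> fps V) : summable u ->
  c *: fsum u = fsum (fun n => c *: u n).
Proof.
apply: (fsum_additive (p := fun y => c *: y)); first exact: scalerDr.
by move=> N y; apply: eqh0Zr.
Qed.

Lemma monoX w g n : mono w g ^+ n =
  mono (w *+ n) (fun j => \prod_(0 <= i < n) g (j - w *+ i)).
Proof.
elim: n => [|n IH].
  by rewrite expr0 mulr0n mono1; apply: eq_mono => j; rewrite big_geq.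
rewrite exprS IH monoM; apply: mono_eq => [|j]; first by rewrite mulrS.
by rewrite big_nat_recr //= mulrC.
Qed.

Lemma coef_hX (S : nzRingType) n : eqh n ('h ^+ n : fps S) 0.
Proof. by apply: eqh0X. Qed.

Lemma exdiv_unit (c d : kh) : finvertible d -> d * exdiv c d = c.
Proof.
move=> id; have [e de] := id; have reg := lreg_unit id.
have h : d * (e * c) = c by rewrite mulrA de mul1r.
by rewrite (exdivE reg h).
Qed.

Lemma exdiv_unit_eqh N (c d : kh) : finvertible d -> eqh N c 0 -> eqh N (exdiv c d) 0.
Proof.
move=> id; have [e de] := id; have reg := lreg_unit id => c0.
have h : d * (e * c) = c by rewrite mulrA de mul1r.
by rewrite (exdivE reg h); apply: eqh0Mr.
Qed.

HB.lock Definition qcoef (n : nat) : kh := exdiv (qden ^+ n) (qfact n).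

Lemma qcoefE n : qfact n * qcoef n = qden ^+ n.
Proof. by rewrite qcoef.unlock; apply: exdiv_unit; apply: qfact_unit. Qed.

Lemma qcoef_eqh n : eqh n (qcoef n) 0.
Proof.
rewrite qcoef.unlock; apply: exdiv_unit_eqh; first exact: qfact_unit.
by apply: eqh0X; case: qden_hunit.
Qed.

Lemma efact_unit n : finvertible (efact n).
Proof.
have e0 m : coef (ebr m.+1) 0 != 0.
  have := congr1 (fun f => coef f 1) (ebrE m.+1).
  case: qeps1_hunit => c0 _; rewrite fcoefM big_ord_recl big_ord1 c0 mul0r add0r.
  rewrite !fcoefB qepsE -ExMn !coef_Ex1 fcoefMn => e; apply/eqP => z.
  have /eqP := e; rewrite z mulr0 eq_sym sub0r oppr_eq0 => /eqP e'.
  have : eps * m.+1%:R != 0 by apply: mulf_neq0; [exact: eps_neq0 | exact: Qeps_natr_neq0].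
  by rewrite mulr_natr -e' eqxx.
rewrite /efact; elim: n => [|n IH].
  by rewrite big_nil; exists 1; rewrite mulr1.
rewrite big_nat_recr //=; apply: finvertibleM => //.
exact: finvertibleP.
Qed.

HB.lock Definition ecoef (m : nat) : kh := exdiv ('h ^+ m) (efact m).

Lemma ecoefE m : efact m * ecoef m = 'h ^+ m.
Proof. by rewrite ecoef.unlock; apply: exdiv_unit; apply: efact_unit. Qed.

Lemma fact_inv n : n`!%:R * fpsC (n`!%:R^-1) = 1 :> kh.
Proof.
rewrite -fpsC_nat -fpsCM mulfV //.
by case: n`! (fact_gt0 n) => // m _; apply: Qeps_natr_neq0.
Qed.

Lemma exdiv_ecoef m n : exdiv ('h ^+ (m + n)) (efact m * n`!%:R) =
  ecoef m * ('h ^+ n * fpsC (n`!%:R^-1)).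
Proof.
apply: exdivE.
  apply: lreg_unit; apply: finvertibleM; first exact: efact_unit.
  by exists (fpsC (n`!%:R^-1)); exact: fact_inv.
by rewrite mulrACA ecoefE [n`!%:R * _]mulrCA fact_inv mulr1 exprD.
Qed.

Lemma ecoef_eqh m n : eqh (m + n) (ecoef m * ('h ^+ n * fpsC (n`!%:R^-1))) 0.
Proof.
apply: eqh0M; last by apply: eqh0Ml; apply: coef_hX.
by rewrite ecoef.unlock; apply: exdiv_unit_eqh; [exact: efact_unit | exact: coef_hX].
Qed.

(** The m letters x contribute [kap ^+ m], which converts (2h/eps)^m into (q - q^-1)^m; the exponent
    -m(m-1)/2 comes from inverting the factorial of [krescale_efact]. *)
Lemma krescale_ecoef m :
  krescale (2 / eps) (ecoef m) * kap ^+ m = Ex (- 'C(m, 2)%:R) * qcoef m.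
Proof.
have cr := krescale_cmorph (2 / eps).
apply: (lreg_unit (qfact_unit m)).
have := congr1 (krescale (2 / eps)) (ecoefE m).
rewrite (cmM cr) krescale_efact (cmX cr) krescale_h -/phi_h => e.
rewrite [RHS]mulrCA qcoefE -kapE exprMn -e.
set a := Ex (- _); set b := Ex (_%:R); have ab : a * b = 1 by rewrite mulrC ExN.
move: (krescale _ _) (qfact m) (kap ^+ m) => x y z.
rewrite -[LHS]mul1r -ab; ring.
Qed.

Lemma pair_Mn (x y : int) n : (x, y) *+ n = (x *+ n, y *+ n) :> J.
Proof. by elim: n => // n IH; rewrite !mulrS IH. Qed.

Lemma monoX_lft g n : mono (1, 0) (fun j => g j.1) ^+ n =
  mono (n%:Z, 0) (fun j => \prod_(0 <= i < n) g (j.1 - i%:Z)).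
Proof.
rewrite monoX; apply: mono_eq => [|j]; first by rewrite pair_Mn mul0rn natz.
by apply: eq_bigr => i _; rewrite pair_Mn natz.
Qed.

Lemma monoX_rgt g n : mono (0, -1) (fun j => g j.2) ^+ n =
  mono (0, - n%:Z) (fun j => \prod_(0 <= i < n) g (j.2 + i%:Z)).
Proof.
rewrite monoX; apply: mono_eq => [|j]; first by rewrite pair_Mn mul0rn mulNrn natz.
by apply: eq_bigr => i _; rewrite pair_Mn mulNrn natz /= opprK.
Qed.

(** * The R-matrices *)

Section RMatrices.
Variables (lambda : Qeps) (mu : kh).
Local Notation wl := (wl lambda).
Local Notation sU := (sU lambda).
Local Notation sD := (sD lambda mu).
Local Notation rhoU := (rho12 wtU sU 1).
Local Notation rhoD := (rho12 wtD sD (2 / eps)).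

(* The coefficient of m_(j.1 - n) (x) m_(j.2 + n) in R (m_j.1 (x) m_j.2) *)
Definition U_R_coef (n : nat) (j : J) : kh :=
  qcoef n * (Ex (fpsC 2^-1 * (wl (j.1 - n%:Z) * wl (j.2 + n%:Z))) *
    (Ex 'C(n, 2)%:R * (\prod_(0 <= i < n) br (j.1 - i%:Z)%:~R *
                       \prod_(0 <= i < n) br (lambda - (j.2 + i%:Z)%:~R)))).

Let qcoef_def n : exdiv (qden ^+ n) (qfact n) = qcoef n.
Proof. by rewrite qcoef.unlock. Qed.

Lemma U_term n : rhoU (exdiv (qden ^+ n) (qfact n) *:
      (fexp (fpsC 2^-1 *: ('h * (lft UH * rgt UH)))
       * (qpow ('C(n, 2)%:R) *: (lft UE ^+ n * rgt UF ^+ n)))) =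
  mono (n%:Z, - n%:Z) (U_R_coef n).
Proof.
have cr := rho12_cmorph wtU sU 1.
rewrite qcoef_def qpowE fpsC_nat (fps_scalerAr (@malg_scalerAr _ _) (fpsC 2^-1) 'h).
pose d (j : J) := fpsC 2^-1 * (wl j.1 * wl j.2).
have pa : rhoU (fpsC 2^-1 *: (lft UH * rgt UH)) = mono 0 d.
  rewrite (cmZC cr); have e : rhoU (lft UH * rgt UH) = _ :=
    etrans (cmM cr _ _) (congr2 *%R (rho12_lft _ _ _ UH) (rho12_rgt _ _ _ UH)).
  by rewrite e diagM monoZ.
have expand c c' x y z : rhoU (c *: (x * (c' *: (y * z)))) =
    c *: (rhoU x * (c' *: (rhoU y * rhoU z))).
  by rewrite !(cmZ cr) (cmM cr) (cmZ cr) (cmM cr) /krescale !resc1.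
have eE : rhoU (lft UE ^+ n) = _ := etrans (cmX cr _ _)
  (etrans (congr1 (fun t => t ^+ n) (rho12_lft _ _ _ UE)) (monoX_lft (sU UE) n)).
have eF : rhoU (rgt UF ^+ n) = _ := etrans (cmX cr _ _)
  (etrans (congr1 (fun t => t ^+ n) (rho12_rgt _ _ _ UF)) (monoX_rgt (sU UF) n)).
apply: (etrans (expand _ _ _ _ _)).
apply: (etrans (congr1 (fun t => qcoef n *: t) (congr2 *%R (cm_fexp_diag cr pa)
  (congr1 (fun t => Ex 'C(n, 2)%:R *: t) (congr2 *%R eE eF))))).
rewrite monoM monoZ monoM monoZ; apply: mono_eq => [|j].
  by rewrite add0r; apply: (congr2 pair); rewrite ?addr0 ?add0r.
rewrite /U_R_coef /d fpsC1 mul1r /= subr0 addr0 add0r opprK; reflexivity.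
Qed.

Lemma rhoU_R : rhoU U_R = fsum (fun n => mono (n%:Z, - n%:Z) (U_R_coef n)).
Proof.
have cr := rho12_cmorph wtU sU 1.
rewrite /U_R; set u := (X in ringsum X).
have su : summable u.
  by move=> n; apply: eqh0Z; rewrite qcoef_def; apply: qcoef_eqh.
rewrite (ringsumE su) (cm_fsum cr su).
by apply: congr1; apply/funext => n; apply: U_term.
Qed.

(** In y^m b^n (x) a^n x^m the letters b act before y^m and the letters a after x^m, so the weights
    are taken at j.1 and j.2 + m. The sum over n is an exponential with exponent h b (x) a, which
    becomes -(h/2) H (x) Ht = (h/2) (H' - c) (x) (H' + c). *)
Definition D_R_coef (m : nat) (j : J) : kh :=
  krescale (2 / eps) (ecoef m) * (\prod_(0 <= i < m) br (j.1 - i%:Z)%:~R *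
    \prod_(0 <= i < m) sD Gx (j.2 + i%:Z)) *
  Ex (fpsC 2^-1 * ((wl j.1 - mu) * (wl (j.2 + m%:Z) + mu))).

Let D_inner m n : ftens Dgen := exdiv ('h ^+ (m + n)) (efact m * n`!%:R) *:
  (lft Gy ^+ m * lft Gb ^+ n * (rgt Ga ^+ n * rgt Gx ^+ m)).

Let D_inner_eqh m n : eqh (m + n) (D_inner m n) 0.
Proof. by apply: eqh0Z; rewrite exdiv_ecoef; apply: ecoef_eqh. Qed.

Lemma D_inner_rho m n : rhoD (D_inner m n) =
  mono (m%:Z, - m%:Z) (fun j => krescale (2 / eps) (ecoef m) *
    (\prod_(0 <= i < m) br (j.1 - i%:Z)%:~R * \prod_(0 <= i < m) sD Gx (j.2 + i%:Z)) *
    (fpsC (n`!%:R^-1) * ('h * (fpsC 2^-1 * ((wl j.1 - mu) * (wl (j.2 + m%:Z) + mu)))) ^+ n)).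
Proof.
have cr := rho12_cmorph wtD sD (2 / eps).
have ck := krescale_cmorph (2 / eps).
have expand c x y z t : rhoD (c *: (x * y * (z * t))) =
    krescale (2 / eps) c *: (rhoD x * rhoD y * (rhoD z * rhoD t)).
  by rewrite (cmZ cr); apply: congr1; exact:
    (etrans (cmM cr _ _) (congr2 *%R (cmM cr _ _) (cmM cr _ _))).
have ey : rhoD (lft Gy ^+ m) = _ := etrans (cmX cr _ _)
  (etrans (congr1 (fun t => t ^+ m) (rho12_lft _ _ _ Gy)) (monoX_lft (sD Gy) m)).
have ex : rhoD (rgt Gx ^+ m) = _ := etrans (cmX cr _ _)
  (etrans (congr1 (fun t => t ^+ m) (rho12_rgt _ _ _ Gx)) (monoX_rgt (sD Gx) m)).
have eb : rhoD (lft Gb ^+ n) = _ := etrans (cmX cr _ _)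
  (etrans (congr1 (fun t => t ^+ n) (rho12_lft _ _ _ Gb)) (diagX (fun j => sD Gb j.1) n)).
have ea : rhoD (rgt Ga ^+ n) = _ := etrans (cmX cr _ _)
  (etrans (congr1 (fun t => t ^+ n) (rho12_rgt _ _ _ Ga)) (diagX (fun j => sD Ga j.2) n)).
rewrite /D_inner exdiv_ecoef.
apply: (etrans (expand _ _ _ _ _)).
apply: (etrans (congr1 (fun t => _ *: t) (congr2 *%R (congr2 *%R ey eb) (congr2 *%R ea ex)))).
rewrite !monoM monoZ; apply: mono_eq => [|j].
  by rewrite add0r addr0; apply: (congr2 pair); rewrite ?addr0 ?add0r.
have kC b : krescale (2 / eps) (fpsC b) = fpsC b by rewrite /krescale resc_fpsC.
rewrite (cmM ck) (cmM ck) (cmX ck) krescale_h -/phi_h kC.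
rewrite /= !subr0 opprK.
have -> : 'h * (fpsC 2^-1 * ((wl j.1 - mu) * (wl (j.2 + m%:Z) + mu))) =
    phi_h * (- (fpsC (eps / 2) * (wl j.1 - mu)) * (fpsC 2^-1 * (- wl (j.2 + m%:Z) - mu))).
  rewrite /phi_h [fpsC (2 / eps) * 'h]mulrC -mulrA; congr (_ * _).
  rewrite -opprD mulrN mulrNN -mulrA resc_eps_half.
  move: (fpsC _) (wl _) (wl _) => a b c; ring.
rewrite !exprMn.
move: (krescale _ _) (fpsC _) (phi_h ^+ n) (_ ^+ n) (_ ^+ n) (bigop _ _ _) (bigop _ _ _).
by move=> a b c d e f g; ring.
Qed.

Lemma D_inner_sum m : ringsum (D_inner m) = fsum (D_inner m).
Proof.
by apply: ringsumE => n; exact: (eqhW (leq_addl _ _) (@D_inner_eqh m n)).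
Qed.

Lemma rhoD_R : rhoD D_R = fsum (fun m => mono (m%:Z, - m%:Z) (D_R_coef m)).
Proof.
have cr := rho12_cmorph wtD sD (2 / eps).
have si m : summable (D_inner m).
  by move=> n; exact: (eqhW (leq_addl _ _) (@D_inner_eqh m n)).
pose u m := ringsum (D_inner m).
have su : summable u.
  move=> m; rewrite /u D_inner_sum; apply: eqh0_fsum => n.
  by exact: (eqhW (leq_addr _ _) (@D_inner_eqh m n)).
rewrite -[D_R]/(ringsum u) (ringsumE su) (cm_fsum cr su).
apply: congr1; apply/funext => m; rewrite /= /u D_inner_sum (cm_fsum cr (si m)).
under [X in fsum X]funext do rewrite /= D_inner_rho.
rewrite mono_fsum; apply: eq_mono => j; rewrite /D_R_coef Ex.unlock.
set y := _ * (_ * (_ + mu)).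
rewrite (@fexpE Qeps Qeps^o Qeps_natr_neq0 _ (coef0_h y)).
rewrite fsumMl //.
exact: (@expterm_summable Qeps Qeps^o _ (coef0_h y)).
Qed.
End RMatrices.

Lemma fpsC_int (z : int) : fpsC z%:~R = z%:~R :> kh.
Proof. by case: z => n; rewrite ?NegzE ?rmorphN /= ?fpsCN -?pmulrn fpsC_nat. Qed.

Lemma Qeps_intr_neq0 (z : int) : z != 0 -> z%:~R != 0 :> Qeps.
Proof.
case: z => [[|n]|n] // _; first exact: (Qeps_natr_neq0 n).
by rewrite NegzE rmorphN oppr_eq0; exact: (Qeps_natr_neq0 n).
Qed.

Lemma intr_mul_eq0 (z : int) (x : kh) : z != 0 -> z%:~R * x = 0 -> x = 0.
Proof.
move=> z0; rewrite -fpsC_int => e; apply: fpsP => n; apply: (mulfI (Qeps_intr_neq0 z0)).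
by rewrite -(fcoefCM (z%:~R : Qeps)) e fcoef0 mulr0.
Qed.

Lemma mono_eqh N w g : (forall j, eqh N (g j) 0) -> eqh N (mono w g) 0.
Proof. by move=> g0 n lt; apply: lop_eq => f i /=; rewrite g0 // mul0r. Qed.

(** * Conjugation of the R-matrix by the diagonal operator T *)

Section Comparison.
Variables (lambda : Qeps) (mu : kh).
Local Notation wl := (wl lambda).
Local Notation sD := (sD lambda mu).

Definition chi (z : int) : kh := Ex (fpsC 2^-1 * mu * z%:~R).
Definition sig : kh := Ex (- (fpsC 2^-1 * mu * mu)).

Lemma chiD z z' : chi (z + z') = chi z * chi z'.
Proof. by rewrite /chi -ExD -mulrDr rmorphD. Qed.

Lemma chi0 : chi 0 = 1.
Proof. by rewrite /chi mulr0 Ex0. Qed.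

Lemma chiN z : chi z * chi (- z) = 1.
Proof. by rewrite -chiD subrr chi0. Qed.

Lemma wlE p : wl p = fpsC lambda - p%:~R *+ 2.
Proof. by rewrite /wl fpsCD fpsCN fpsC_int rmorphM mulr_natr. Qed.

(** The exponent of q collected by x^m: each x contributes q^H' at the index it arrives at. The
    surplus m(m-1) turns the q^(-m(m-1)/2) of [krescale_ecoef] into the q^(m(m-1)/2) of the R-matrix
    of U_h. *)
Lemma sum_wl p m :
  \sum_(0 <= i < m) wl (p + i%:Z + 1) = m%:R * wl (p + m%:Z) + 'C(m, 2)%:R *+ 2.
Proof.
elim: m => [|m IH]; first by rewrite big_geq // mul0r bin0n mul0rn addr0.
have eS : m.+1%:Z = m%:Z + 1 by rewrite -addn1 PoszD.
rewrite big_nat_recr //= IH binS bin1 eS natrD -[m.+1%:R]natr1.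
rewrite !wlE !rmorphD /= -!pmulrn.
move: (fpsC _) (p%:~R) (m%:R) ('C(m, 2)%:R) => a b c d; ring.
Qed.

Lemma half2 : fpsC 2^-1 * 2 = 1 :> kh.
Proof. by rewrite -[RHS](half_mul 1). Qed.

(* The Cartan parts of the two R-matrices are q^{(H' - c) (x) (H' + c) / 2} and
   q^{H' (x) H' / 2}, where c acts by mu on both factors. *)
Lemma D_R_coef_U m j : D_R_coef lambda mu m j =
  sig * (chi (j.2 + m%:Z - (j.1 - m%:Z)) * (U_R_coef lambda m j * chi (j.2 - j.1))).
Proof.
pose t : kh := fpsC 2^-1; have t2 : t * 2 = 1 by exact: half2.
(* All weights are expressed through the outgoing weight b of the second factor and an index
   difference D, which makes the comparison of exponents polynomial. *)
pose b := wl (j.2 + m%:Z); pose D : kh := (j.2 + m%:Z - j.1)%:~R.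
have ea : wl j.1 = b + D *+ 2.
  rewrite /b /D !wlE rmorphB /=; move: (fpsC _) (_%:~R) (_%:~R) => x y z; ring.
have ea' : wl (j.1 - m%:Z) = b + D *+ 2 + m%:R *+ 2.
  rewrite -ea !wlE rmorphB /= -pmulrn; move: (fpsC _) (_%:~R) (_%:R) => x y z; ring.
have ex : \prod_(0 <= i < m) sD Gx (j.2 + i%:Z) = kap ^+ m *
    (Ex (m%:R * b + 'C(m, 2)%:R *+ 2) *
     \prod_(0 <= i < m) br (lambda - (j.2 + i%:Z)%:~R)).
  rewrite -sum_wl -Ex_prod; elim: m {b D ea ea'} => [|m IH].
    by rewrite !big_geq // expr0 !mulr1.
  rewrite !big_nat_recr //= IH exprS.
  move: kap (_ ^+ _) (bigop _ _ _) (bigop _ _ _) (Ex _) (br _) => x y z u v w; ring.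
rewrite /D_R_coef /U_R_coef ex /chi /sig -/t -/b ea ea'.
have -> : (j.2 + m%:Z - (j.1 - m%:Z))%:~R = D + m%:R.
  rewrite /D !rmorphB rmorphD /= -!pmulrn.
  move: (j.1%:~R) (j.2%:~R) (m%:R : kh) => x y z; ring.
have -> : (j.2 - j.1)%:~R = D - m%:R.
  rewrite /D !rmorphB rmorphD /= -!pmulrn.
  move: (j.1%:~R) (j.2%:~R) (m%:R : kh) => x y z; ring.
set P := bigop _ _ _; set Q := bigop _ _ _; set C : kh := 'C(m, 2)%:R.
transitivity (qcoef m * (P * Q) *
    Ex (- C + (m%:R * b + C *+ 2) + t * ((b + D *+ 2 - mu) * (b + mu)))).
  rewrite (ExD (- C + (m%:R * b + C *+ 2))) (ExD (- C) (m%:R * b + C *+ 2)).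
  have := krescale_ecoef m; rewrite -/C.
  move: (krescale _ _) (kap ^+ m) (Ex (- C)) (Ex (m%:R * b + C *+ 2)) (Ex (t * _)) (qcoef m).
  move=> x y z v w u e.
  by transitivity (x * y * (P * Q) * v * w); [ring | rewrite e; ring].
transitivity (qcoef m * (P * Q) * Ex (- (t * mu * mu) + (t * mu * (D + m%:R) +
    (t * ((b + D *+ 2 + m%:R *+ 2) * b) + C + t * mu * (D - m%:R))))).
  congr (_ * Ex _).
  (* With t as a variable, the exponents agree only up to a multiple of 1 - 2t, and t = 1/2. *)
  transitivity (- (t * mu * mu) + (t * mu * (D + m%:R) +
    (t * ((b + D *+ 2 + m%:R *+ 2) * b) + C + t * mu * (D - m%:R))) + m%:R * b * (1 - t * 2)).
    by move: t {t2} C b D {ea ea' ex} (m%:R : kh) => t C b D n; ring.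
  by rewrite t2 subrr mulr0 addr0.
rewrite !ExD; move: (qcoef m) (Ex _) (Ex _) (Ex _) (Ex _) (Ex _) => x y z u v w; ring.
Qed.
End Comparison.

Lemma fcoefZ0 (V : lmodType Qeps) (c : kh) (v : fps V) : coef (c *: v) 0 = coef c 0 *: coef v 0.
Proof. exact: big_ord1. Qed.

Lemma coef0_Z_one (S : lalgType Qeps) (c : kh) (x : fps S) :
  coef c 0 = 1 -> coef x 0 = 1 -> coef (c *: x) 0 = 1.
Proof. by move=> c1 x1; rewrite fcoefZ0 c1 x1 scale1r. Qed.

Lemma coef0_M_one (S : nzRingType) (x y : fps S) :
  coef x 0 = 1 -> coef y 0 = 1 -> coef (x * y) 0 = 1.
Proof. by move=> x1 y1; rewrite fcoefM0 x1 y1 mulr1. Qed.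

(** Only the term n = 0 survives at h = 0. By [rinvP], [rinv U_R] is therefore a genuine two-sided
    inverse. *)
Lemma coef_U_R0 : coef U_R 0 = 1.
Proof.
rewrite /U_R; set u := (X in ringsum X).
have su : summable u.
  by move=> n; apply: eqh0Z; have := @qcoef_eqh n; rewrite qcoef.unlock.
rewrite (ringsumE su).
apply: (etrans (big_ord1 _ _)); rewrite -[LHS]/(coef (u 0%N) 0) /u.
have q0 : coef (exdiv (qden ^+ 0) (qfact 0)) 0 = 1.
  have := congr1 (fun f => coef f 0) (qcoefE 0).
  by rewrite expr0 qcoef.unlock qfactE big_geq // mul1r.
apply: (coef0_Z_one q0); apply: coef0_M_one.
  rewrite (fps_scalerAr (@malg_scalerAr _ _)); exact: coef_fexp_h.
apply: coef0_Z_one; first by rewrite qpowE coef_Ex0.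
by apply: coef0_M_one; rewrite expr0.
Qed.

Lemma coef_D_R0 : coef D_R 0 = 1.
Proof.
pose t m n : ftens Dgen := exdiv ('h ^+ (m + n)) (efact m * n`!%:R) *:
  (lft Gy ^+ m * lft Gb ^+ n * (rgt Ga ^+ n * rgt Gx ^+ m)).
have tE m n : eqh (m + n) (t m n) 0.
  by apply: eqh0Z; rewrite exdiv_ecoef; apply: ecoef_eqh.
have si m : summable (t m) by move=> n; exact: (eqhW (leq_addl m n) (@tE m n)).
have su : summable (fun m => ringsum (t m)).
  move=> m; rewrite (ringsumE (si m)); apply: eqh0_fsum => n.
  exact: (eqhW (leq_addr n m) (@tE m n)).
rewrite -[D_R]/(ringsum (fun m => ringsum (t m))) (ringsumE su).
apply: (etrans (big_ord1 _ _)); rewrite (ringsumE (si _)).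
apply: (etrans (big_ord1 _ _)); rewrite -[LHS]/(coef (t 0%N 0%N) 0) /t.
apply: coef0_Z_one; last by apply: coef0_M_one; apply: coef0_M_one; rewrite expr0.
rewrite exdiv_ecoef expr0 mul1r fact0 invr1 fpsC1 mulr1.
by have := congr1 (fun f => coef f 0) (ecoefE 0); rewrite /efact big_geq // mul1r.
Qed.

Section Operators.
Variables (lambda : Qeps) (mu : kh).
Local Notation rhoU := (rho12 wtU (sU lambda) 1).
Local Notation rhoD := (rho12 wtD (sD lambda mu) (2 / eps)).
Local Notation chi := (chi mu).
Local Notation sig := (sig mu).

Definition Tchi : fps lop := mono 0 (fun j => chi (j.2 - j.1)).
Definition Tchi' : fps lop := mono 0 (fun j => chi (- (j.2 - j.1))).

Let sumU : summable (fun n => mono (n%:Z, - n%:Z) (U_R_coef lambda n)).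
Proof.
move=> n; apply: mono_eqh => j; rewrite /U_R_coef; apply: eqh0Ml; exact: qcoef_eqh.
Qed.

Lemma rhoD_R_conj : rhoD D_R = sig *: (Tchi * rhoU U_R * Tchi).
Proof.
rewrite rhoD_R rhoU_R fsumMl // fsumMr; last by move=> n; apply: eqh0Mr; apply: sumU.
rewrite fsumZ; last by move=> n; apply: eqh0Ml; apply: eqh0Mr; apply: sumU.
apply: congr1; apply/funext => n.
rewrite /Tchi !monoM monoZ; apply: mono_eq => [|j]; first by rewrite addr0 add0r.
by rewrite /= !subr0 D_R_coef_U opprK; congr (_ * _); apply: mulrA.
Qed.

Lemma TchiV' : Tchi' * Tchi = 1.
Proof. by rewrite diagM mono1; apply: eq_mono => j; rewrite mulrC chiN. Qed.

Definition sig' : kh := Ex (fpsC 2^-1 * mu * mu).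
Lemma sigV : sig' * sig = 1.
Proof. exact: ExN. Qed.

(** Uniqueness of inverses: the right-hand side is a left inverse of the conjugated R-matrix, and
    the left-hand side is a right inverse of it. *)
Lemma rhoD_RV_conj : rhoD (rinv D_R) = sig' *: (Tchi' * rhoU (rinv U_R) * Tchi').
Proof.
have cU := rho12_cmorph wtU (sU lambda) 1.
have cD := rho12_cmorph wtD (sD lambda mu) (2 / eps).
have [_ uU] := rinvP coef_U_R0; have [eD _] := rinvP coef_D_R0.
have {}uU := cm_inv cU uU; have {}eD := cm_inv cD eD.
move: eD uU; rewrite rhoD_R_conj.
move: (rhoU U_R) (rhoD (rinv D_R)) (rhoU (rinv U_R)) => A B C eD uU.
have uniq (W V Y : fps lop) : W * V = 1 -> V * Y = 1 -> Y = W.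
  by move=> WV VY; rewrite -[Y]mul1r -WV -mulrA VY mulr1.
apply: uniq eD.
rewrite -scalerAl -(fps_scalerAr lop_scaleAr) scalerA sigV scale1r !mulrA.
rewrite -[Tchi' * C * Tchi' * Tchi]mulrA TchiV' mulr1 -[Tchi' * C * A]mulrA uU mulr1.
exact: TchiV'.
Qed.

(* Weight conservation: both R-matrices commute with the total weight. *)
Definition Ntot : fps lop := mono 0 (fun j => (j.1 + j.2)%:~R).

Lemma rhoU_R_comm : Ntot * rhoU U_R = rhoU U_R * Ntot.
Proof.
rewrite rhoU_R fsumMl // fsumMr //; apply: congr1; apply/funext => n.
rewrite /Ntot !monoM; apply: mono_eq => [|j]; first by rewrite addr0 add0r.
rewrite /= subr0 mulrC; congr (_ * _%:~R).
by rewrite opprK addrACA addNr addr0.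
Qed.

Lemma rhoU_RV_comm : Ntot * rhoU (rinv U_R) = rhoU (rinv U_R) * Ntot.
Proof.
have cU := rho12_cmorph wtU (sU lambda) 1.
have [uU vU] := rinvP coef_U_R0; have {}uU := cm_inv cU uU; have {}vU := cm_inv cU vU.
move: rhoU_R_comm uU vU; move: (rhoU U_R) (rhoU (rinv U_R)) => A B e AB BA.
by rewrite -[LHS]mul1r -BA -mulrA [A * _]mulrA -e -mulrA AB mulr1.
Qed.

(** Computing the entry of [Ntot * O] in two ways shows that the difference of the total weights
    annihilates it, and nonzero integers are regular in characteristic 0. *)
Lemma ent_comm0 O i j : Ntot * O = O * Ntot -> i.1 + i.2 != j.1 + j.2 -> ent O i j = 0.
Proof.
move=> e ne; apply: (@intr_mul_eq0 (i.1 + i.2 - (j.1 + j.2))); first by rewrite subr_eq0.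
rewrite rmorphB mulrBl; apply/eqP; rewrite subr_eq0; apply/eqP.
by rewrite -(ent_diagl (fun j => (j.1 + j.2)%:~R)) -/Ntot e ent_diagr mulrC.
Qed.
End Operators.

(** * Weights along a diagram *)

Section Potential.
Implicit Types l : seq (bool * int).

Definition sg (b : bool) : int := if b then 1 else -1.
Definition flow l : int := \sum_(x <- l) sg x.1 * x.2.
Definition sgs l : int := \sum_(x <- l) sg x.1.
(* A level is a list of oriented strands, each carrying an integer p_j; with signs
   s_j = 1 (up) or -1 (down), its potential is sum_j p_j + 2 sum_(j < l) s_j s_l p_j.
   It is unchanged at maxima and minima, as the two strands carry the same integer
   and opposite signs, and at a crossing it changes by the exponent of chi. *)
Fixpoint pot l : int :=
  if l is x :: l' then x.2 + (sg x.1 * x.2 * sgs l') *+ 2 + pot l' else 0.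

Lemma flow_cat l1 l2 : flow (l1 ++ l2) = flow l1 + flow l2.
Proof. exact: big_cat. Qed.
Lemma sgs_cat l1 l2 : sgs (l1 ++ l2) = sgs l1 + sgs l2.
Proof. exact: big_cat. Qed.
Lemma pot_cat l1 l2 : pot (l1 ++ l2) = pot l1 + pot l2 + (flow l1 * sgs l2) *+ 2.
Proof.
elim: l1 => [|x l IH] /=; first by rewrite /flow big_nil mul0r mul0rn addr0 add0r.
rewrite IH sgs_cat /flow big_cons -/(flow l).
move: (sg x.1) x.2 (sgs l) (sgs l2) (flow l) (pot l) (pot l2) => a b c d e f g; ring.
Qed.

(** The surroundings see a block only through its [flow] and [sgs], so a slice preserving both
    changes the potential locally. *)
Lemma pot_replace l1 m m' l2 : flow m = flow m' -> sgs m = sgs m' ->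
  pot (l1 ++ m' ++ l2) - pot (l1 ++ m ++ l2) = pot m' - pot m.
Proof.
move=> ef es; rewrite !pot_cat !sgs_cat ef es.
move: (flow l1) (sgs m') (pot l1) (pot m) (pot m') (flow m') (sgs l2) (pot l2).
by move=> a b c d e f g h; ring.
Qed.

Lemma flow_replace l1 m m' l2 : flow m = flow m' ->
  flow (l1 ++ m' ++ l2) = flow (l1 ++ m ++ l2).
Proof. by move=> e; rewrite !flow_cat e. Qed.
End Potential.

(** * The strand as an enumeration of the edges, and the heights along it *)

Section Strand.
Variable D : seq (nat * piece).
Hypothesis comp : composable D.
Hypothesis conn : one_open_component D.

Local Notation level := (level D).
Local Notation slice := (slice D).
Local Notation follow := (follow D).
Local Notation edges := (edges D).
Local Notation strand := (strand D).

Lemma level0 : level 0 = [:: true].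
Proof. by []. Qed.

Lemma levelE t : (t <= size D)%N -> level t = foldl next_level [:: true] (take t D).
Proof.
rewrite /Defs.level /levels; case: t => [|t] lt; first by rewrite take0.
by rewrite /= nth_scanl.
Qed.

Lemma levelS t : (t < size D)%N -> level t.+1 = next_level (level t) (slice t).
Proof.
move=> lt; rewrite !levelE //; last exact: ltnW.
by rewrite (take_nth (0%N, MinL) lt) -cats1 foldl_cat.
Qed.

Lemma level_top : level (size D) = [:: true].
Proof. by case/andP: comp => _ /eqP. Qed.

Local Notation pos t := (slice t).1.
Local Notation kind t := (slice t).2.

Lemma level_split t : (t < size D)%N ->
  let A := take (pos t) (level t) in
  let B := drop (pos t + size (lower (kind t))) (level t) in
  [/\ size A = pos t, level t = A ++ lower (kind t) ++ B &
      level t.+1 = A ++ upper (kind t) ++ B].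
Proof.
move=> lt A B; case/andP: comp => /allP/(_ t) + _.
rewrite mem_iota /= add0n lt => /(_ isT).
rewrite levelS // /A /B; case: (slice t) => i p /= /andP[lei /prefixP[C eC]].
split; first by rewrite size_takel.
  rewrite -[LHS](cat_take_drop i) eC; congr (_ ++ _).
  by rewrite addnC -drop_drop eC drop_size_cat.
by [].
Qed.

Lemma mem_edges e : (e \in edges) = (e.1 <= size D)%N && (e.2 < size (level e.1))%N.
Proof.
apply/flattenP/andP => [[s /mapP[t]]|[le lt]].
  rewrite mem_iota /= add0n ltnS => lt -> /mapP[j]; rewrite mem_iota add0n => ltj ->.
  by split.
exists [seq (e.1, j) | j <- iota 0 (size (level e.1))].
  by apply/mapP; exists e.1; rewrite // mem_iota add0n ltnS.
by case: e le lt => t j /= _ lt; apply/mapP; exists j; rewrite // mem_iota add0n.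
Qed.

Lemma uniq_edges : uniq edges.
Proof.
rewrite /Defs.edges; have : uniq (iota 0 (size D).+1) := iota_uniq _ _.
elim: (iota _ _) => //= t s IH /andP[nt us].
rewrite cat_uniq IH // andbT map_inj_uniq ?iota_uniq /=; last by move=> i j [].
apply/hasPn => -[t' j] /flattenP[u /mapP[t2 t2s ->] /mapP[j' _ [-> _]]].
by apply/negP => /mapP[j2 _ [e _]]; rewrite -e t2s in nt.
Qed.

Lemma size_strand : size strand = size edges.
Proof. exact: size_traject. Qed.

(** Pigeonhole: [strand] has as many entries as there are edges and contains them all, so it
    contains nothing else; [uniq_strand] follows from the same count. *)
Lemma strand_edges : strand =i edges.
Proof.
have sub : {subset edges <= strand} by apply/allP; exact: conn.
have le : (size strand <= size edges)%N by rewrite size_strand.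
by have [_ e] := uniq_min_size uniq_edges sub le; move=> x; rewrite e.
Qed.

Lemma uniq_strand : uniq strand.
Proof.
apply: (leq_size_uniq uniq_edges); last by rewrite size_strand.
by move=> x; rewrite strand_edges.
Qed.

Lemma perm_strand : perm_eq strand edges.
Proof. by apply: uniq_perm; [exact: uniq_strand | exact: uniq_edges | exact: strand_edges]. Qed.

Definition top_edge := (size D, 0%N).

Lemma edges_gt0 : (0 < size edges)%N.
Proof. by rewrite -has_predT; apply/hasP; exists (0%N, 0%N); rewrite ?mem_edges. Qed.

Lemma nth_strand k : (k < size edges)%N -> nth (0%N, 0%N) strand k = iter k follow (0%N, 0%N).
Proof. by move=> lt; rewrite nth_traject. Qed.

(** Beyond the diagram [slice] returns its default [(0, MinL)], a minimum with no lower end: the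
    edge passes to its right, shifted by the two new ends. What matters is that the resulting level
    lies outside the diagram. *)
Lemma follow_top : follow top_edge = ((size D).+1, 2).
Proof.
rewrite /Defs.follow /top_edge /target_slice /goes_up /=.
rewrite level_top /= /Defs.slice nth_default //.
Qed.

(** Were the top edge not the last one, its successor would be an edge, whereas it lies above the
    diagram. *)
Lemma index_top : (index top_edge strand).+1 = size edges.
Proof.
have nt x : x \in edges -> (index x strand < size edges)%N.
  by rewrite -strand_edges -size_strand index_mem.
have te : top_edge \in edges by rewrite mem_edges level_top leqnn.
apply/eqP; rewrite eqn_leq nt //= leqNgt; apply/negP => lt.
have : nth (0%N, 0%N) strand (index top_edge strand).+1 \in edges.
  by rewrite -strand_edges mem_nth // size_strand.
rewrite nth_strand // iterS -nth_strand ?nt // nth_index ?strand_edges //.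
by rewrite follow_top mem_edges /= ltnn.
Qed.

Lemma edge_not_top e : e \in edges -> e != top_edge ->
  ((index e strand).+1 < size edges)%N.
Proof.
have nt x : x \in edges -> (index x strand < size edges)%N.
  by rewrite -strand_edges -size_strand index_mem.
have te : top_edge \in edges by rewrite mem_edges level_top leqnn.
move=> ee ne; rewrite -index_top ltnS ltn_neqAle.
have := nt _ ee; rewrite -index_top ltnS => ->; rewrite andbT.
apply: contra ne => /eqP e1; apply/eqP.
rewrite -(nth_index (0%N, 0%N) (_ : e \in strand)) ?strand_edges // e1.
by rewrite nth_index // strand_edges.
Qed.

Section Flow.
Variable dw : nat * nat -> int.

(* The index p of the vector m_p entering the edge e, if m_0 enters the strand and
   each edge x lowers the index by dw x *)
Definition height (e : nat * nat) : int :=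
  - \sum_(x <- take (index e strand) strand) dw x.

Lemma height0 : height (0%N, 0%N) = 0.
Proof.
rewrite /height /Defs.strand; case: (size _) edges_gt0 => // n _.
by rewrite /= big_nil oppr0.
Qed.

Lemma height_follow e : e \in edges -> e != top_edge ->
  height (follow e) = height e - dw e.
Proof.
move=> ee ne; have lt := edge_not_top ee ne.
have es : e \in strand by rewrite strand_edges.
have fe : follow e = nth (0%N, 0%N) strand (index e strand).+1.
  by rewrite nth_strand // iterS -nth_strand ?nth_index //; apply: ltnW.
rewrite /height {1}fe index_uniq ?size_strand ?uniq_strand //.
have ls : (index e strand < size strand)%N by rewrite index_mem.
by rewrite (take_nth (0%N, 0%N) ls) big_rcons /= nth_index // opprD addrC.
Qed.

Lemma follow_up t j : goes_up D (t, j) -> follow (t, j) =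
  if (j < pos t)%N then (t.+1, j)
  else if (j < pos t + size (lower (kind t)))%N
       then (if size (upper (kind t)) is 0 then t else t.+1, ((pos t).*2.+1 - j)%N)
  else (t.+1, (j + size (upper (kind t)) - size (lower (kind t)))%N).
Proof. by rewrite /Defs.follow /target_slice => ->; case: (slice _). Qed.

Lemma follow_down t j : goes_up D (t.+1, j) = false -> follow (t.+1, j) =
  if (j < pos t)%N then (t, j)
  else if (j < pos t + size (upper (kind t)))%N
       then (if size (lower (kind t)) is 0 then t.+1 else t, ((pos t).*2.+1 - j)%N)
  else (t, (j + size (lower (kind t)) - size (upper (kind t)))%N).
Proof. by rewrite /Defs.follow /target_slice => ->; case: (slice _). Qed.

Lemma meets_up t j : goes_up D (t, j) -> Defs.meets D (t, j) =
  if (pos t <= j < pos t + size (lower (kind t)))%N then Some (kind t, (j - pos t)%N) else None.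
Proof. by rewrite /Defs.meets /target_slice => ->; case: (slice _). Qed.

Lemma meets_down t j : goes_up D (t.+1, j) = false -> Defs.meets D (t.+1, j) =
  if (pos t <= j < pos t + size (upper (kind t)))%N then Some (kind t, (j - pos t)%N) else None.
Proof. by rewrite /Defs.meets /target_slice => ->; case: (slice _). Qed.

Hypothesis dw_crossing : forall e,
  (if bead_at D e is Some (Over _ | Under _) then false else true) -> dw e = 0.

Lemma dw_None e : Defs.meets D e = None -> dw e = 0.
Proof. by move=> me; apply: dw_crossing; rewrite /bead_at me. Qed.

Lemma not_top t j : (t < size D)%N -> (t, j) != top_edge.
Proof. by move=> lt; apply/eqP => -[e _]; rewrite e ltnn in lt. Qed.

Lemma down_not_top e : goes_up D e = false -> e != top_edge.
Proof. by move=> d; apply/eqP => e'; rewrite e' /goes_up /= level_top in d. Qed.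

(** A strand that only passes by meets no bead. A downward one runs from [t.+1] to [t], so [follow]
    is then applied at the upper end. *)
Lemma height_left t j : (t < size D)%N -> (j < pos t)%N ->
  height (t.+1, j) = height (t, j).
Proof.
move=> lt ltj; have [sA e1 e2] := level_split lt.
have sl : (j < size (level t))%N by rewrite e1 size_cat sA ltn_addr.
have sl' : (j < size (level t.+1))%N by rewrite e2 size_cat sA ltn_addr.
have same : goes_up D (t.+1, j) = goes_up D (t, j).
  by rewrite /goes_up /= e1 e2 !nth_cat sA ltj.
case up : (goes_up D (t, j)); last first.
  have dn : goes_up D (t.+1, j) = false by rewrite same.
  rewrite -[in RHS](_ : follow (t.+1, j) = (t, j)); last by rewrite follow_down // ltj.
  rewrite height_follow ?mem_edges ?sl' ?andbT ?down_not_top //.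
  by rewrite dw_None ?subr0 // meets_down // leqNgt ltj.
rewrite -(_ : follow (t, j) = (t.+1, j)); last by rewrite follow_up // ltj.
rewrite height_follow ?mem_edges ?sl ?andbT ?not_top //; last exact: ltnW.
by rewrite dw_None ?subr0 // meets_up // leqNgt ltj.
Qed.

Lemma height_right t j : (t < size D)%N ->
  (pos t + size (lower (kind t)) + j < size (level t))%N ->
  height (t.+1, (pos t + size (upper (kind t)) + j)%N) =
  height (t, (pos t + size (lower (kind t)) + j)%N).
Proof.
move=> lt sl; have [sA e1 e2] := level_split lt.
set u := size (upper _); set l := size (lower _).
have sl' : (pos t + u + j < size (level t.+1))%N.
  by move: sl; rewrite e1 e2 !size_cat sA !addnA -/u -/l -!addnA !ltn_add2l.
have same : goes_up D (t.+1, (pos t + u + j)%N) = goes_up D (t, (pos t + l + j)%N).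
  rewrite /goes_up /= e1 e2 !nth_cat sA -!addnA !ltnNge !leq_addr /= !addKn.
  by rewrite -/u -/l !leq_addr.
case up : (goes_up D (t, (pos t + l + j)%N)); last first.
  have dn : goes_up D (t.+1, (pos t + u + j)%N) = false by rewrite same.
  rewrite -[in RHS](_ : follow (t.+1, (pos t + u + j)%N) = (t, (pos t + l + j)%N)); last first.
    rewrite follow_down // !ltnNge -addnA leq_addr /= addnA leq_addr /=.
    by rewrite -/u -/l; congr pair; lia.
  rewrite height_follow ?mem_edges ?sl' ?andbT ?down_not_top //.
  by rewrite dw_None ?subr0 // meets_down // [(_ < _)%N]ltnNge leq_addr andbF.
rewrite -[in LHS](_ : follow (t, (pos t + l + j)%N) = (t.+1, (pos t + u + j)%N)); last first.
  rewrite follow_up // !ltnNge -addnA leq_addr /= addnA leq_addr /=.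
  by rewrite -/u -/l; congr pair; lia.
rewrite height_follow ?mem_edges ?sl ?andbT ?not_top //; last exact: ltnW.
by rewrite dw_None ?subr0 // meets_up // [(_ < _)%N]ltnNge leq_addr andbF.
Qed.

Definition lev (t : nat) : seq (bool * int) :=
  [seq (nth true (level t) j, height (t, j)) | j <- iota 0 (size (level t))].

Definition crossing t := is_crossing (kind t).

(* The variation of the potential [pot (lev t)] at slice t *)
Definition dpot (t : nat) : int :=
  if crossing t then (height (t.+1, pos t) - height (t, pos t)) *+ 2 else 0.

Lemma mid_lower t k : (t < size D)%N -> (k < size (lower (kind t)))%N ->
  goes_up D (t, (pos t + k)%N) = nth true (lower (kind t)) k /\ (t, (pos t + k)%N) \in edges.
Proof.
move=> lt ltk; have [sA e1 _] := level_split lt; rewrite mem_edges /= (ltnW lt).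
rewrite /goes_up /= e1 nth_cat sA ltnNge leq_addr addKn nth_cat ltk; split=> //.
by rewrite !size_cat sA ltn_add2l ltn_addr.
Qed.

Lemma mid_upper t k : (t < size D)%N -> (k < size (upper (kind t)))%N ->
  goes_up D (t.+1, (pos t + k)%N) = nth true (upper (kind t)) k /\
  (t.+1, (pos t + k)%N) \in edges.
Proof.
move=> lt ltk; have [sA _ e2] := level_split lt; rewrite mem_edges /= lt.
rewrite /goes_up /= e2 nth_cat sA ltnNge leq_addr addKn nth_cat ltk; split=> //.
by rewrite !size_cat sA ltn_add2l ltn_addr.
Qed.

Definition mid_lo t := [seq (nth true (lower (kind t)) k, height (t, (pos t + k)%N))
  | k <- iota 0 (size (lower (kind t)))].
Definition mid_up t := [seq (nth true (upper (kind t)) k, height (t.+1, (pos t + k)%N))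
  | k <- iota 0 (size (upper (kind t)))].

Lemma lev_split t : (t < size D)%N ->
  exists A B, lev t = A ++ mid_lo t ++ B /\ lev t.+1 = A ++ mid_up t ++ B.
Proof.
move=> lt; have [sA e1 e2] := level_split lt.
set i := pos t; set A := take _ _ in sA e1 e2; set B := drop _ _ in e1 e2.
set l := size (lower (kind t)); set u := size (upper (kind t)).
exists [seq (nth true A j, height (t, j)) | j <- iota 0 i].
exists [seq (nth true B j, height (t, (i + l + j)%N)) | j <- iota 0 (size B)].
split; rewrite /lev.
  rewrite {2}e1 !size_cat sA -/i -/l !iotaD !map_cat add0n; congr (_ ++ (_ ++ _)).
  - apply/eq_in_map => j; rewrite mem_iota /= add0n => ltj.
    by rewrite e1 nth_cat sA ltj.
  - rewrite /mid_lo -{1}[i]addn0 iotaDl -map_comp; apply/eq_in_map => j.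
    rewrite mem_iota /= add0n => ltj.
    by rewrite e1 nth_cat sA ltnNge leq_addr addKn nth_cat ltj.
  rewrite -{1}[(i + l)%N]addn0 iotaDl -map_comp; apply/eq_in_map => j _ /=.
  by rewrite e1 !nth_cat sA -!addnA !ltnNge !leq_addr /= !addKn -/l leq_addr.
rewrite {2}e2 !size_cat sA -/i -/u !iotaD !map_cat add0n; congr (_ ++ (_ ++ _)).
- apply/eq_in_map => j; rewrite mem_iota /= add0n => ltj.
  by rewrite e2 nth_cat sA ltj height_left.
- rewrite /mid_up -{1}[i]addn0 iotaDl -map_comp; apply/eq_in_map => j.
  rewrite mem_iota /= add0n => ltj.
  by rewrite e2 nth_cat sA ltnNge leq_addr addKn nth_cat ltj.
rewrite -{1}[(i + u)%N]addn0 iotaDl -map_comp; apply/eq_in_map => j.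
rewrite mem_iota /= add0n => ltj.
rewrite height_right //; last by rewrite e1 !size_cat sA addnA ltn_add2l.
by rewrite e2 !nth_cat sA -!addnA !ltnNge !leq_addr /= !addKn -/u leq_addr.
Qed.

Lemma crossing_ends t : crossing t -> [/\ size (lower (kind t)) = 2,
  size (upper (kind t)) = 2 & forall k, nth true (lower (kind t)) k = true].
Proof.
by rewrite /crossing; case: (kind t) => // _; split=> // -[|[|k]] //; rewrite nth_default.
Qed.

(** The index [pos t + 1 - k] exchanges the two ends of a piece. A crossing leads to the opposite
    end one level higher, a maximum to its other foot on the same level; hence the test on the upper
    ends. *)
Lemma mid_low_up t k : (t < size D)%N -> (k < size (lower (kind t)))%N ->
  nth true (lower (kind t)) k = true ->
  height (if size (upper (kind t)) is 0 then t else t.+1, (pos t + 1 - k)%N) =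
  height (t, (pos t + k)%N) - dw (t, (pos t + k)%N).
Proof.
move=> lt ltk nk; have [up me] := mid_lower lt ltk; rewrite nk in up.
rewrite -height_follow ?not_top // follow_up //.
rewrite ltnNge leq_addr /= ltn_add2l ltk; congr (height (_, _)).
by rewrite -addnn; lia.
Qed.

Lemma mid_up_down t k : (t < size D)%N -> (k < size (upper (kind t)))%N ->
  nth true (upper (kind t)) k = false -> size (lower (kind t)) = 0 ->
  height (t.+1, (pos t + 1 - k)%N) = height (t.+1, (pos t + k)%N).
Proof.
move=> lt ltk nk l0; have [up me] := mid_upper lt ltk; rewrite nk in up.
have := height_follow me (down_not_top up).
rewrite follow_down // ltnNge leq_addr /= ltn_add2l ltk l0.
have -> : ((pos t).*2.+1 - (pos t + k) = pos t + 1 - k)%N by rewrite -addnn; lia.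
move=> ->; rewrite dw_crossing ?subr0 // /bead_at meets_down // leq_addr ltn_add2l ltk.
by move: l0; case: (kind t).
Qed.

Hypothesis dw_conserved : forall t, (t < size D)%N -> crossing t ->
  dw (t, pos t) + dw (t, (pos t).+1) = 0.

Lemma dw_turn t k : (t < size D)%N -> ~~ crossing t -> (k < size (lower (kind t)))%N ->
  nth true (lower (kind t)) k = true -> dw (t, (pos t + k)%N) = 0.
Proof.
move=> lt nc ltk nk; have [up me] := mid_lower lt ltk; rewrite nk in up.
apply: dw_crossing; rewrite /bead_at meets_up // leq_addr ltn_add2l ltk.
by move: nc; rewrite /crossing; case: (kind t).
Qed.

(** Two upward strands carrying a and b have potential 3a + b; as a + b is conserved, a crossing
    changes it by twice the change on the left. Two opposite strands carrying the same a have
    potential a - 2a + a = 0, so maxima and minima contribute nothing. *)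
Lemma mid_dpot t : (t < size D)%N ->
  [/\ flow (mid_lo t) = flow (mid_up t), sgs (mid_lo t) = sgs (mid_up t) &
      pot (mid_up t) - pot (mid_lo t) = dpot t].
Proof.
move=> lt; have lo := mid_low_up lt; have up := mid_up_down lt.
have tu := dw_turn lt; have cn := dw_conserved lt.
move: lo up tu cn; rewrite /dpot /mid_lo /mid_up /crossing /flow /sgs.
have p2 : (pos t + 1 - 1 = pos t)%N by rewrite addnK.
have p1 : (pos t + 1 - 0 = (pos t).+1)%N by rewrite subn0 addn1.
case: (kind t) => /= lo up tu cn;
  rewrite ?big_cons ?big_nil /= ?addn0 ?addn1.
- have := lo 0 isT erefl; have := lo 1 isT erefl; have := cn isT.
  rewrite p1 p2 !addn0 !addn1.
  move: (dw _) (dw _) (height _) (height _) (height _) (height _) => x y a b c d e1 e2 e3.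
  by rewrite /sgs !(big_cons, big_nil) /sg /= !mulr2n; split; lia.
- have := lo 0 isT erefl; have := lo 1 isT erefl; have := cn isT.
  rewrite p1 p2 !addn0 !addn1.
  move: (dw _) (dw _) (height _) (height _) (height _) (height _) => x y a b c d e1 e2 e3.
  by rewrite /sgs !(big_cons, big_nil) /sg /= !mulr2n; split; lia.
- have := lo 0 isT erefl; have := tu 0 isT isT erefl; rewrite p1 !addn0.
  move: (dw _) (height _) (height _) => x a b e1 e2.
  by rewrite /sgs !(big_cons, big_nil) /sg /= !mulr2n; split; lia.
- have := lo 1 isT erefl; have := tu 1 isT isT erefl; rewrite p2 !addn1.
  move: (dw _) (height _) (height _) => x a b e1 e2.
  by rewrite /sgs !(big_cons, big_nil) /sg /= !mulr2n; split; lia.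
- have := up 0 isT erefl erefl; rewrite p1 !addn0.
  move: (height _) (height _) => a b e1.
  by rewrite /sgs !(big_cons, big_nil) /sg /= !mulr2n; split; lia.
- have := up 1 isT erefl erefl; rewrite p2 !addn1.
  move: (height _) (height _) => a b e1.
  by rewrite /sgs !(big_cons, big_nil) /sg /= !mulr2n; split; lia.
Qed.

Lemma lev_step t : (t < size D)%N ->
  flow (lev t.+1) = flow (lev t) /\ pot (lev t.+1) - pot (lev t) = dpot t.
Proof.
move=> lt; have [A [B [-> ->]]] := lev_split lt; have [ef es ep] := mid_dpot lt.
by split; [apply: flow_replace | rewrite (pot_replace _ _ ef es)].
Qed.

(** A Kirchhoff law: every slice conserves the signed sum of the heights, which is 0 at the bottom.
    The top level is again a single upward edge, so its height must be 0 as well. *)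
Lemma lev_flow t : (t <= size D)%N -> flow (lev t) = 0.
Proof.
elim: t => [|t IH] lt; last by rewrite (lev_step lt).1 IH // ltnW.
by rewrite /lev /= /flow big_cons big_nil height0.
Qed.

Lemma height_top : height top_edge = 0.
Proof.
have := lev_flow (leqnn _); rewrite /lev level_top /= /flow big_cons big_nil /=.
by rewrite mul1r addr0.
Qed.

Lemma dpot_sum : \sum_(t < size D) dpot t = 0.
Proof.
have h n : (n <= size D)%N -> \sum_(t < n) dpot t = pot (lev n) - pot (lev 0).
  elim: n => [|n IH] lt; first by rewrite big_ord0 subrr.
  by rewrite big_ord_recr /= (IH (ltnW lt)) -(lev_step lt).2 addrC subrKA.
rewrite h // /lev level_top /= -/top_edge height_top height0 /sgs big_nil.
by rewrite !mulr0 subrr.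
Qed.

Lemma total_dw : \sum_(e <- strand) dw e = 0.
Proof.
have te : top_edge \in strand by rewrite strand_edges mem_edges level_top leqnn.
have ls : (index top_edge strand < size strand)%N by rewrite index_mem.
have d0 : dw top_edge = 0.
  apply: dw_None; rewrite meets_up; last by rewrite /goes_up /= level_top.
  by rewrite /Defs.slice nth_default //= andbF.
have := height_top; rewrite /height => /eqP; rewrite oppr_eq0 => /eqP h0.
rewrite -[strand]take_size size_strand -index_top.
by rewrite (take_nth (0%N, 0%N) ls) big_rcons /= nth_index // d0 h0 add0r.
Qed.
End Flow.

(** * Regrouping the beads of the strand by crossings *)

Section CrossingBeads.
Variables (A B : nat -> nat * nat -> kh).

Definition bead_factor (e : nat * nat) : kh :=
  match bead_at D e with
  | Some (Over t) => A t e
  | Some (Under t) => B t e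
  | _ => 1
  end.

Definition over_edge t : nat * nat := if kind t is CrossP then (t, pos t) else (t, (pos t).+1).
Definition under_edge t : nat * nat := if kind t is CrossP then (t, (pos t).+1) else (t, pos t).

Lemma bead_crossing_up t k : (t < size D)%N -> crossing t -> (k < 2)%N ->
  bead_at D (t, (pos t + k)%N) =
  Some (match kind t, k with CrossP, 0%N | CrossN, 1%N => Over t | _, _ => Under t end).
Proof.
move=> lt cr ltk; have [sl _ nl] := crossing_ends cr.
have [up me] := @mid_lower t k lt (eq_ind_r (fun n => k < n)%N ltk sl); rewrite nl in up.
rewrite /bead_at meets_up // leq_addr ltn_add2l sl ltk addKn.
have -> : target_slice D (t, (pos t + k)%N) = t by rewrite /target_slice up.
by move: cr; rewrite /crossing; case: (kind t) => // _; case: k ltk {up me} => [|[|k]].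
Qed.

Lemma bead_at_over t : (t < size D)%N -> crossing t -> bead_at D (over_edge t) = Some (Over t).
Proof.
move=> lt cr; have b0 := bead_crossing_up lt cr (isT : 0 < 2)%N.
have b1 := bead_crossing_up lt cr (isT : 1 < 2)%N; rewrite addn0 in b0; rewrite addn1 in b1.
by move: cr b0 b1; rewrite /crossing /over_edge; case: (kind t).
Qed.

Lemma bead_at_under t : (t < size D)%N -> crossing t -> bead_at D (under_edge t) = Some (Under t).
Proof.
move=> lt cr; have b0 := bead_crossing_up lt cr (isT : 0 < 2)%N.
have b1 := bead_crossing_up lt cr (isT : 1 < 2)%N; rewrite addn0 in b0; rewrite addn1 in b1.
by move: cr b0 b1; rewrite /crossing /under_edge; case: (kind t).
Qed.

Lemma crossing_edges t : (t < size D)%N -> crossing t ->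
  over_edge t \in edges /\ under_edge t \in edges.
Proof.
move=> lt cr; have [sl _ _] := crossing_ends cr; rewrite /over_edge /under_edge.
have [_ e0] := @mid_lower t 0%N lt (eq_ind_r (fun n => 0 < n)%N (isT : 0 < 2)%N sl).
have [_ e1] := @mid_lower t 1%N lt (eq_ind_r (fun n => 1 < n)%N (isT : 1 < 2)%N sl).
by rewrite addn0 in e0; rewrite addn1 in e1; case: (kind t).
Qed.

(** The four ends of a crossing all point upwards, so the strand enters it only from its two lower
    ends; the case of a downward edge is contradictory. *)
Lemma bead_crossing_inv t j : (t, j) \in edges ->
  (if bead_at D (t, j) is Some (Over _ | Under _) then true else false) ->
  [/\ (t < size D)%N, crossing t & (pos t <= j < pos t + 2)%N].
Proof.
rewrite mem_edges /= => /andP[let' ltj].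
have cross_piece (p : piece) k t' : (match (match p with
    | CrossP => if k is 0 then Some (Over t') else Some (Under t')
    | CrossN => if k is 1%N then Some (Over t') else Some (Under t')
    | MaxR => Some (Rotation true)
    | MaxL => Some (Rotation false)
    | _ => None end) with Some (Over _ | Under _) => true | _ => false end) -> is_crossing p.
  by case: p.
case up : (goes_up D (t, j)).
  rewrite /bead_at meets_up //; case: ifP => // inr.
  have lt : (t < size D)%N.
    rewrite ltn_neqAle let' andbT; apply/eqP => e; move: inr.
    by rewrite e /Defs.slice nth_default // andbC.
  move=> h; have cr : crossing t.
    by move: h; rewrite /crossing; case: (kind t).
  by have [sl _ _] := crossing_ends cr; rewrite sl in inr.
case: t let' ltj up => [|t] lt ltj up.
  by move: up ltj; rewrite /goes_up /= level0; case: j => // j; rewrite nth_default.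
rewrite /bead_at meets_down //; case: ifP => // /andP[le1 lt1] h.
have cr : crossing t by move: h; rewrite /crossing; case: (kind t).
have [_ su _] := crossing_ends cr.
have ltk : (j - pos t < size (upper (kind t)))%N by rewrite ltn_subLR.
have [] := mid_upper lt ltk; rewrite subnKC // up => nu.
have : nth true (upper (kind t)) (j - pos t) = true.
  move: cr ltk {nu h}; rewrite /crossing; case: (kind t) => // _ /=; by case: (j - _)%N => [|[|]].
by rewrite -nu.
Qed.

(** The strand is a permutation of the edges and the factors are commuting scalars, so the product
    can be taken level by level; on each level only the two edges entering a crossing matter. *)
Lemma bead_factor_prod :
  \prod_(e <- strand) bead_factor e =
  \prod_(t < size D) (if crossing t then A t (over_edge t) * B t (under_edge t) else 1).
Proof.
rewrite (perm_big _ perm_strand) /Defs.edges big_flatten big_map.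
have -> : iota 0 (size D).+1 = index_iota 0 (size D).+1 by rewrite /index_iota subn0.
have one t j : (t, j) \in edges ->
    (~~ [&& t < size D, crossing t & pos t <= j < pos t + 2])%N -> bead_factor (t, j) = 1.
  move=> et; rewrite /bead_factor => nc; have := bead_crossing_inv et.
  by case: (bead_at D (t, j)) => // -[t'|t'|] // /(_ isT) [h1 h2 h3]; rewrite h1 h2 h3 in nc.
rewrite big_mkord big_ord_recr /= [X in _ * X]big1_seq ?mulr1; last first.
  move=> e /= /mapP[j]; rewrite mem_iota add0n => /= ltj ->.
  by apply: one; rewrite ?mem_edges ?leqnn ?ltnn.
apply: eq_bigr => -[t lt] _ /=; rewrite big_map; case: ifP => cr; last first.
  rewrite big1_seq // => j; rewrite mem_iota add0n => /= ltj.
  by apply: one; rewrite ?mem_edges /= ?(ltnW lt) // cr andbF.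
have [sA e1 _] := level_split lt; have [sl _ _] := crossing_ends cr.
have sz : size (level t) = (pos t + (2 + size (drop (pos t + 2) (level t))))%N.
  by rewrite {1}e1 !size_cat sA sl.
have eL j : (j < size (level t))%N -> (t, j) \in edges by rewrite mem_edges /= (ltnW lt).
rewrite sz iotaD big_cat iotaD big_cat /= add0n.
rewrite [X in X * _]big1_seq; last first.
  move=> j; rewrite mem_iota add0n => /= ltj.
  apply: one; first by apply: eL; rewrite sz ltn_addr.
  by rewrite [(pos t <= j)%N]leqNgt ltj !andbF.
rewrite mul1r [X in _ * X]big1_seq ?mulr1; last first.
  move=> j; rewrite mem_iota => /= /andP[le1 lt1].
  apply: one; first by apply: eL; rewrite sz addnA.
  by rewrite [(j < _)%N]ltnNge le1 !andbF.
rewrite !big_cons big_nil mulr1.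
have o := bead_at_over lt cr; have u := bead_at_under lt cr.
move: o u; rewrite /bead_factor; move: cr; rewrite /crossing /over_edge /under_edge.
by case: (kind t) => // _ -> ->; rewrite // mulrC.
Qed.
End CrossingBeads.

Section WeightFlow.
Variable om : nat -> int * int.

Definition dwo (e : nat * nat) : int :=
  match bead_at D e with
  | Some (Over t) => (om t).1
  | Some (Under t) => (om t).2
  | _ => 0
  end.

Hypothesis om0 : forall t, (t < size D)%N -> crossing t -> (om t).1 + (om t).2 = 0.

Let dwoC e : (if bead_at D e is Some (Over _ | Under _) then false else true) -> dwo e = 0.
Proof. by rewrite /dwo; case: (bead_at D e) => // -[]. Qed.

Let dwo0 t : (t < size D)%N -> crossing t -> dwo (t, pos t) + dwo (t, (pos t).+1) = 0.
Proof.
move=> lt cr; have o := bead_at_over lt cr; have u := bead_at_under lt cr.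
have := om0 lt cr; move: cr o u; rewrite /dwo /crossing /over_edge /under_edge.
by case: (kind t) => // _ -> -> //; rewrite addrC.
Qed.

Lemma total_dwo : \sum_(e <- strand) dwo e = 0.
Proof. exact: total_dw dwoC dwo0. Qed.

(* The exponent of chi contributed by conjugating R^{+-1} by Tchi^{+-1}; oh and uh
   are the indices entering the crossing. *)
Definition crossing_exponent t : int :=
  let oh := height dwo (over_edge t) in let uh := height dwo (under_edge t) in
  let x := uh - (om t).2 - (oh - (om t).1) + (uh - oh) in
  if kind t is CrossP then x else - x.

(** For balanced weights the exponent equals the variation [dpot], which sums to 0. In [CrossN] the
    overstrand enters on the right, and this reversal is compensated by the sign coming from the
    inverse of T. *)
Lemma crossing_exponent_sum :
  \sum_(t < size D) (if crossing t then crossing_exponent t else 0) = 0.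
Proof.
apply: (etrans _ (dpot_sum dwoC dwo0)); apply: eq_bigr => -[t lt] _ /=.
rewrite /dpot; case: ifP => // cr.
have := @mid_low_up dwo t 1%N lt; have o := bead_at_over lt cr; have u := bead_at_under lt cr.
have [sl su nl] := crossing_ends cr; have := om0 lt cr; rewrite sl su.
move=> e /(_ isT (nl _)); rewrite addnK addn1 => ->.
have {}o : dwo (over_edge t) = (om t).1 by rewrite /dwo o.
have {}u : dwo (under_edge t) = (om t).2 by rewrite /dwo u.
move: cr e o u; rewrite /crossing /crossing_exponent /over_edge /under_edge.
case: (kind t) => // _; move: (om t).1 (om t).2 => x y e o u; rewrite ?o ?u;
  move: (height dwo (t, pos t)) (height dwo (t, (pos t).+1)) => a b; rewrite mulr2n; lia.
Qed.
End WeightFlow.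
End Strand.

(** * State sums *)

Section Choices.
Variable T : eqType.
Implicit Types (ls : seq (seq T)) (P : pred T).

Lemma choices_cons (l : seq T) ls :
  choices (l :: ls) = [seq x :: s | x <- l, s <- choices ls].
Proof. by []. Qed.

Lemma choices_filter P ls :
  choices [seq [seq x <- l | P x] | l <- ls] = [seq c <- choices ls | all P c].
Proof.
elim: ls => [|l ls IH] //; rewrite /= -!/(choices _) IH.
elim: l => [|x l IHl] //=; rewrite filter_cat -IHl filter_map /=.
case Px: (P x) => /=.
  by congr (map _ _ ++ _); apply: eq_filter => s /=; rewrite Px.
by rewrite [filter (preim _ _) _](eq_filter (a2 := pred0)) ?filter_pred0 // => s /=; rewrite Px.
Qed.

Lemma mem_choices x0 ls c : (c \in choices ls) =
  (size c == size ls) && all (fun t => nth x0 c t \in nth [::] ls t) (iota 0 (size ls)).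
Proof.
elim: ls c => [|l ls IH] [|x c] //.
  by rewrite choices_cons; apply/negbTE/negP => /allpairsP[[y s] [_ _]].
rewrite choices_cons /= -[1%N]add1n iotaDl all_map eqSS andbCA -IH.
apply/allpairsP/andP => [[[y s] /= [yl sl [-> ->]]]|[xl cl]] //.
by exists (x, c).
Qed.

Lemma uniq_choices ls : all uniq ls -> uniq (choices ls).
Proof.
elim: ls => [|l ls IH] //= /andP[ul uls].
by rewrite -/(choices ls); apply: allpairs_uniq => //;
  [exact: IH | move=> [x s] [y s'] _ _ [-> ->]].
Qed.

Lemma big_choices_prod (x0 : T) ls (f : nat -> T -> kh) :
  \sum_(c <- choices ls) \prod_(t < size ls) f t (nth x0 c t) =
  \prod_(t < size ls) \sum_(x <- nth [::] ls t) f t x.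
Proof.
elim: ls f => [|l ls IH] f; first by rewrite big_seq1 !big_ord0.
rewrite choices_cons big_allpairs_dep big_ord_recl /= -(IH (fun t => f t.+1)) mulr_suml.
apply: eq_bigr => x _.
by rewrite mulr_sumr; apply: eq_bigr => s _; rewrite big_ord_recl.
Qed.
End Choices.

Lemma choices_map (T T' : Type) (f : T -> T') (ls : seq (seq T)) :
  choices [seq map f l | l <- ls] = [seq map f c | c <- choices ls].
Proof.
elim: ls => [|l ls IH] //; rewrite /= -!/(choices _) IH.
rewrite map_allpairs allpairs_mapl allpairs_mapr.
by [].
Qed.

(** States are grouped by their vector of keys. Once that vector is fixed, each factor depends on
    the choice in its own slice only, so the sum over the group factors over the slices. *)
Lemma big_choices_key (T K : eqType) (x0 : T) (k0 : K) (key : T -> K) (ls : seq (seq T))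
    (Ks : seq (seq K)) (Phi : seq K -> kh) (f : seq K -> nat -> T -> kh) :
  size Ks = size ls -> all uniq Ks ->
  (forall t x, (t < size ls)%N -> x \in nth [::] ls t -> key x \in nth [::] Ks t) ->
  \sum_(c <- choices ls) Phi (map key c) * \prod_(t < size ls) f (map key c) t (nth x0 c t) =
  \sum_(om <- choices Ks) Phi om *
     \prod_(t < size ls) \sum_(x <- nth [::] ls t | key x == nth k0 om t) f om t x.
Proof.
move=> sK uK keyK.
have mk c : c \in choices ls -> map key c \in choices Ks.
  rewrite !(mem_choices x0) (mem_choices k0) => /andP[/eqP sc /allP h].
  rewrite size_map sc sK eqxx; apply/allP => t; rewrite mem_iota add0n => /= lt.
  by rewrite (nth_map x0) ?sc //; apply: keyK => //; apply: h; rewrite mem_iota.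
transitivity (\sum_(c <- choices ls) \sum_(om <- choices Ks | map key c == om)
    Phi om * \prod_(t < size ls) f om t (nth x0 c t)).
  apply: eq_big_seq => c cl; rewrite -[RHS]big_filter.
  rewrite (eq_filter (a2 := pred1 (map key c))); last by move=> x; rewrite /= eq_sym.
  by rewrite filter_pred1_uniq ?mk ?uniq_choices // big_seq1.
under eq_bigr do rewrite big_mkcond.
rewrite exchange_big; apply: eq_big_seq => om omK /=.
transitivity (\sum_(c <- choices ls) Phi om *
    \prod_(t < size ls) (if key (nth x0 c t) == nth k0 om t then f om t (nth x0 c t) else 0)).
  apply: eq_big_seq => c; rewrite (mem_choices x0) => /andP[/eqP sc _].
  move: omK; rewrite (mem_choices k0) => /andP[/eqP so _].
  case: eqP => [e|ne].
    congr (_ * _); apply: eq_bigr => t _; rewrite -e (nth_map x0) ?sc ?eqxx //.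
  have /allPn[t] : ~~ all (fun t => key (nth x0 c t) == nth k0 om t) (iota 0 (size ls)).
    apply/negP => /allP h; apply: ne.
    apply: (eq_from_nth (x0 := k0)); rewrite size_map ?sc ?so ?sK // => t lt.
    rewrite (nth_map x0) ?sc //; apply/eqP/h; by rewrite mem_iota add0n.
  rewrite mem_iota add0n => /= lt nt.
  by rewrite (bigD1 (Ordinal lt)) //= (negbTE nt) mul0r mulr0.
rewrite -mulr_sumr (big_choices_prod x0 ls
  (fun t x => if key x == nth k0 om t then f om t x else 0)).
by congr (_ * _); apply: eq_bigr => t _; rewrite -big_mkcond.
Qed.

(** * Limits in a presented algebra *)

Section PresentedTheory.
Variables (X : choiceType) (rels : seq (tfree X)).
Local Notation pi := (@pres_pi X rels).

Lemma pres_pi1 : pi 1 = 1. Proof. by []. Qed.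
Lemma pres_piMm x y : pi (x * y) = pi x * pi y.
Proof. by rewrite [RHS]pres_piM. Qed.
Lemma pres_pi0 : pi 0 = 0.
Proof. by apply: (addrI (pi 0)); rewrite -pres_piD !addr0. Qed.
Lemma pres_piB x y : pi (x - y) = pi x - pi y.
Proof. by apply: (addIr (pi y)); rewrite -pres_piD !subrK. Qed.
Lemma pres_pi_sum (I : Type) (r : seq I) (F : I -> tfree X) :
  pi (\sum_(i <- r) F i) = \sum_(i <- r) pi (F i).
Proof. exact: (big_morph pi (pres_piD rels) pres_pi0). Qed.
Lemma pres_pi_prod (I : Type) (r : seq I) (F : I -> tfree X) :
  pi (\prod_(i <- r) F i) = \prod_(i <- r) pi (F i).
Proof. exact: (big_morph pi pres_piMm pres_pi1). Qed.

Lemma iter_pi_h N w : iter N ( *%R (pi 'h)) (pi w) = pi ('h ^+ N * w).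
Proof.
elim: N => [|N IH]; first by rewrite mul1r.
by rewrite iterS IH exprS -mulrA; apply: esym; apply: pres_piMm.
Qed.

(** This is where closedness of the ideal enters: the quotient is h-adically separated, which makes
    limits in it unique. *)
Lemma pres_separated t : (forall N, exists w, pi t = pi ('h ^+ N * w)) -> pi t = 0.
Proof.
move=> sep; rewrite -pres_pi0; apply/pres_piE; rewrite subr0.
apply/ideal_predP => Id cI rI; apply: (ci_closed cI) => N.
have [w e] := sep N; exists (t - 'h ^+ N * w); last by exists w; rewrite subrK.
by have /pres_piE/ideal_predP := e; apply.
Qed.

Lemma hlim_pres (u : nat -> tfree X) z :
  (forall N n, (N <= n)%N -> eqh N (u n) z) ->
  hlim ( *%R (pi 'h)) (fun n => pi (u n)) = pi z.
Proof.
move=> cv; apply: xget_unique.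
  move=> N; exists N => n le; have /eqh0P/eqh_iterP[w e] := cv N n le.
  by exists (pi w); rewrite iter_pi_h -pres_piB e hXM.
move=> v cv'; apply/eqP; rewrite eq_sym -subr_eq0 -[v]pres_reprK -pres_piB; apply/eqP.
apply: pres_separated => N; have [n0 Hn] := cv' N.
set n := maxn n0 N; have [w e] := Hn n (leq_maxl _ _).
have /eqh0P/eqh_iterP[w' e'] := cv N n (leq_maxr _ _).
have e1 : pi ('h ^+ N * repr w) = pi (u n) - v by rewrite -iter_pi_h pres_reprK -e.
have e2 : pi ('h ^+ N * w') = pi (u n) - pi z by rewrite hXM -e' pres_piB.
exists (repr w - w'); rewrite mulrBr.
apply: (etrans _ (etrans (congr2 (fun x y => x - y) (esym e1) (esym e2)) (esym (pres_piB _ _)))).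
by rewrite pres_piB pres_reprK opprB [RHS]addrC addrA subrK.
Qed.
End PresentedTheory.

Lemma coef_hXC (V : lmodType Qeps) d (v : V) n :
  coef ('h ^+ d *: fpsC v) n = if n == d then v else 0.
Proof.
rewrite hXZ fcoef_iter_hs; case: ltngtP => [//|lt|->]; last by rewrite subnn.
by rewrite -(subnSK lt).
Qed.

Lemma fpsC_Z (V : lmodType Qeps) (c : Qeps) (v : V) : fpsC (c *: v) = fpsC c *: fpsC v.
Proof.
by apply: fpsP => n; rewrite fcoefCZ; case: n => [|n]; [|rewrite /= scaler0].
Qed.

Lemma fpsC_malg (I : choiceType) (c : Qeps) (u : I) :
  fpsC << c *g u >> = fpsC c *: fpsC << u >> :> fps {malg Qeps[I]}.
Proof.
have e : << c *g u >> = c *: << u >> :> {malg Qeps[I]}.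
  by apply/malgP => l; rewrite mcoeffZ !mcoeffU mulr_natr.
by rewrite e fpsC_Z.
Qed.

Lemma eqh_prod N (I : Type) (r : seq I) (F G : I -> kh) :
  (forall i, true -> eqh N (F i) (G i)) -> eqh N (\prod_(i <- r) F i) (\prod_(i <- r) G i).
Proof.
move=> e; elim: r => [|i r IH]; first by rewrite !big_nil.
by rewrite !big_cons; apply: eqhM => //; apply: e.
Qed.

Lemma eqh0_sum (V : zmodType) N (I : eqType) (r : seq I) (P : pred I) (F : I -> fps V) :
  (forall i, i \in r -> P i -> eqh N (F i) 0) -> eqh N (\sum_(i <- r | P i) F i) 0.
Proof.
by move=> F0 n lt; rewrite fcoef_sum big1_seq // => i /andP[Pi ir]; rewrite F0.
Qed.

Lemma prod_rev_pmap (S : pzRingType) (T U : Type) (s : seq T) (f : T -> option U) (F : U -> S) :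
  \prod_(b <- rev (pmap f s)) F b =
  \prod_(e <- rev s) (if f e is Some b then F b else 1).
Proof.
elim: s => [|e s IH]; first by rewrite !big_nil.
rewrite /= rev_cons -cats1 big_cat big_seq1 /= -IH.
by case: (f e) => [b|] /=; rewrite ?mulr1 // rev_cons -cats1 big_cat big_seq1.
Qed.

Lemma eqh0_prod (S : nzRingType) (T : eqType) (s : seq T) (F : T -> fps S) x N :
  x \in s -> eqh N (F x) 0 -> eqh N (\prod_(y <- s) F y) 0.
Proof.
move=> xs Fx; elim: s xs => // y s IH; rewrite inE big_cons => /orP[/eqP <-|/IH h].
  exact: eqh0Ml.
exact: eqh0Mr.
Qed.

(** Written from right to left, the factor of e acts after all factors preceding e in s, so its
    scalar is taken at the index already lowered by their weights. For a strand starting at m_0 this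
    index is the [height] of e. *)
Lemma prod_rev_mono (T : eqType) (s : seq T) (w : T -> int) (g : T -> int -> kh) : uniq s ->
  \prod_(e <- rev s) mono (w e, 0) (fun j => g e j.1) =
  mono (\sum_(e <- s) w e, 0) (fun j =>
    \prod_(e <- s) g e (j.1 - \sum_(x <- take (index e s) s) w x)).
Proof.
elim: s => [|e s IH] /=.
  by move=> _; rewrite !big_nil mono1; apply: eq_mono => j; rewrite big_nil.
move=> /andP[es us]; rewrite rev_cons -cats1 big_cat big_seq1 /= IH // monoM.
apply: mono_eq => [|j]; first by rewrite big_cons addrC.
rewrite big_cons eqxx take0 big_nil subr0 mulrC; congr (_ * _).
apply: eq_big_seq => x xs; congr (g x _).
have -> : (e == x) = false by apply/eqP => ex; rewrite ex xs in es.
by rewrite /= big_cons opprD addrA.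
Qed.

(** * The universal invariant as a sum over bead weights *)

Section StateSum.
Variables (X : choiceType) (wt : X -> int) (s : X -> int -> kh) (a : Qeps).
Variables (rels : seq (tfree X)) (R : ftens X) (K : long_knot).
Variables (kl kl' : tfree X) (kr kr' : int -> kh).
Local Notation rho1 := (rho1 wt s a).
Local Notation rho12 := (rho12 wt s a).
Local Notation cw := (cw wt s).
Local Notation wtw := (wtw wt).
Local Notation pi := (@pres_pi X rels).
Hypothesis relsP : forall r, r \in rels -> rho1 r = 0.
Hypothesis klK : kl * kl' = 1.
Hypothesis kl'K : kl' * kl = 1.
Hypothesis rho_kl : rho1 kl = mono 0 (fun j => kr j.1).
Hypothesis rho_kl' : rho1 kl' = mono 0 (fun j => kr' j.1).

Let D := diagram K.
Let comp := knot_composable K.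
Let conn := knot_component K.

Local Notation term := (Qeps * nat * ({fmonom X} * {fmonom X}))%type.

(** The term 1 (x) 1, used both as the only choice at a slice without crossing and as the default of
    [nth]. *)
Definition term0 : term := (1, 0%N, (@mone {fmonom X}, @mone {fmonom X})).

(* A term (c, d, (u, v)) stands for c h^d u (x) v. *)
Definition rawexp (Q : ftens X) N : seq term :=
  flatten [seq [seq ((coef Q d)@_w, d, w) | w <- msupp (coef Q d)] | d <- iota 0 N].

Definition rmat (p : piece) : ftens X := if p is CrossP then R else rinv R.

Definition rawslice N (sl : nat * piece) : seq term :=
  if is_crossing sl.2 then rawexp (rmat sl.2) N else [:: term0].

(* The weights of the two beads of a crossing; states are grouped by their keys. *)
Definition key (x : term) : int * int := (wtw x.2.1, wtw x.2.2).

Definition over_lift (x : term) : tfree X := fpsC << x.1.1 *g x.2.1 >> * 'h ^+ x.1.2.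
Definition under_lift (x : term) : tfree X := fpsC << x.2.2 >>.

Lemma expansion_raw Q N : expansion rels Q N =
  [seq (pi (over_lift x), pi (under_lift x)) | x <- rawexp Q N].
Proof.
rewrite /expansion /rawexp map_flatten -map_comp; congr flatten.
by apply: eq_map => d /=; rewrite -map_comp.
Qed.

Lemma slice_terms_raw N sl : slice_terms rels R N sl =
  [seq (pi (over_lift x), pi (under_lift x)) | x <- rawslice N sl].
Proof.
case: sl => i []; rewrite /slice_terms /rawslice /= ?expansion_raw //.
all: by rewrite /over_lift /under_lift /= mulr1.
Qed.

Definition bead_lift (c : seq term) (b : bead) : tfree X :=
  match b with
  | Over t => over_lift (nth term0 c t)
  | Under t => under_lift (nth term0 c t)
  | Rotation true => kl
  | Rotation false => kl'
  end.

Definition edge_lift c e : tfree X := if bead_at D e is Some b then bead_lift c b else 1.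

(** The truncated state sum, lifted to the free algebra so that its limit can be taken
    coefficientwise before passing to the quotient. *)
Definition lift_at N : tfree X :=
  \sum_(c <- choices [seq rawslice N sl | sl <- D]) \prod_(e <- rev (strand D)) edge_lift c e.

Lemma over_lift0 : pi (over_lift term0) = 1.
Proof. by rewrite /over_lift /= mulr1. Qed.

Lemma rinv_kl : rinv (pi kl) = pi kl'.
Proof. by apply: rinvE; rewrite -pres_piMm ?klK ?kl'K. Qed.

Lemma invariant_liftE : universal_invariant R (pi kl) K =
  hlim ( *%R (pi 'h)) (fun N => pi (lift_at N)).
Proof.
rewrite /universal_invariant; congr (hlim _ _); apply/funext => N.
have -> : [seq slice_terms rels R N sl | sl <- K] =
    [seq [seq (pi (over_lift x), pi (under_lift x)) | x <- l] | l <- [seq rawslice N sl | sl <- D]].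
  by rewrite -map_comp; apply: eq_map => sl /=; rewrite slice_terms_raw.
rewrite choices_map big_map pres_pi_sum; apply: eq_bigr => c _.
rewrite pres_pi_prod /beads prod_rev_pmap; apply: eq_bigr => e _.
rewrite /edge_lift; case: (bead_at D e) => [b|] //=.
have nthE t : nth (1, 1) [seq (pi (over_lift x), pi (under_lift x)) | x <- c] t =
    (pi (over_lift (nth term0 c t)), pi (under_lift (nth term0 c t))).
  case: (ltnP t (size c)) => lt; first by rewrite (nth_map term0).
  rewrite !nth_default ?size_map // over_lift0.
  by [].
by case: b => [t|t|[]] /=; rewrite ?nthE ?rinv_kl.
Qed.

Lemma rawexp_filter Q M N : (M <= N)%N -> rawexp Q M = [seq x <- rawexp Q N | (x.1.2 < M)%N].
Proof.
move=> le; rewrite /rawexp filter_flatten -map_comp -(subnKC le) iotaD map_cat flatten_cat.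
have keep d : (d < M)%N ->
      [seq x <- [seq ((coef Q d)@_w, d, w) | w <- msupp (coef Q d)] | (x.1.2 < M)%N]
    = [seq ((coef Q d)@_w, d, w) | w <- msupp (coef Q d)].
  by move=> lt; apply/all_filterP; rewrite all_map; apply/allP.
have drop d : (M <= d)%N ->
      [seq x <- [seq ((coef Q d)@_w, d, w) | w <- msupp (coef Q d)] | (x.1.2 < M)%N]
    = [::].
  move=> lt; rewrite filter_map (eq_filter (a2 := pred0)) ?filter_pred0 // => x /=.
  by rewrite ltnNge lt.
rewrite [X in _ = _ ++ X](_ : _ = [::]) ?cats0.
  by congr flatten; apply/eq_in_map => d; rewrite mem_iota add0n => /= /keep.
have : all (leq M) (iota (0 + M) (N - M)).
  by apply/allP => d; rewrite mem_iota add0n => /andP[].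
by elim: (iota _ _) => //= d ds IH /andP[/drop -> /IH ->].
Qed.

(** The bound 0 < M keeps [term0], which has degree 0 in h. *)
Lemma rawslice_filter M N sl : (0 < M <= N)%N ->
  rawslice M sl = [seq x <- rawslice N sl | (x.1.2 < M)%N].
Proof.
case/andP=> M0 le; rewrite /rawslice; case: ifP => _; first exact: rawexp_filter.
by rewrite /= M0.
Qed.

Lemma over_lift_eqh (x : term) N : (N <= x.1.2)%N -> eqh N (over_lift x) 0.
Proof.
move=> le; apply: (eqhW le); rewrite -[x.1.2]add0n /over_lift.
by apply: (@eqh0M _ 0) => //; apply: coef_hX.
Qed.

(** A state that uses a term of degree at least M at some crossing has a factor h^M on the
    overstrand bead; the remaining states are those of the truncation at M. *)
Lemma lift_eqh M N : (M <= N)%N -> eqh M (lift_at N) (lift_at M).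
Proof.
case: M => [|M] // le; rewrite /lift_at (bigID (all (fun x : term => (x.1.2 < M.+1)%N))) /=.
rewrite -big_filter -choices_filter -map_comp.
have -> : [seq rawslice M.+1 sl | sl <- D] =
    [seq ((fun l : seq term => [seq x <- l | (x.1.2 < M.+1)%N]) \o rawslice N) sl | sl <- D].
  by apply: eq_map => sl; apply: rawslice_filter.
rewrite -[X in eqh _ _ X]addr0; apply: eqhD => //.
apply: eqh0_sum => c; rewrite (mem_choices term0) => /andP[/eqP sc /allP inc] nall.
have [t lt big] : exists2 t, (t < size D)%N & (M.+1 <= (nth term0 c t).1.2)%N.
  move: nall => /(all_nthP term0) h; apply: contrapT => h'; apply: h => t.
  rewrite sc size_map => lt; rewrite ltnNge; apply/negP => le'; apply: h'.
  by exists t.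
(* Elsewhere the only choice is [term0], of degree 0. *)
have cr : crossing D t.
  have := inc t; rewrite mem_iota add0n size_map => /(_ lt).
  rewrite (nth_map (0%N, MinL)) // /rawslice /crossing.
  by case: (is_crossing _) => //; rewrite inE => /eqP e; rewrite e in big.
have o : over_edge D t \in rev (strand D).
  by rewrite mem_rev (strand_edges conn); have [] := crossing_edges comp lt cr.
apply: (eqh0_prod o); rewrite /edge_lift (bead_at_over comp lt cr).
exact: over_lift_eqh.
Qed.

Definition lift_lim : tfree X := FPS (fun n => coef (lift_at n.+1) n).

Lemma lift_limP N n : (N <= n)%N -> eqh N (lift_at n) lift_lim.
Proof. by move=> le m lt; apply: (lift_eqh (leq_trans lt le)). Qed.

Lemma rho1_invariant N :
  eqh N (rho1 (repr (universal_invariant R (pi kl) K))) (rho1 (lift_at N)).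
Proof.
rewrite invariant_liftE (hlim_pres rels lift_limP) (rho1_repr relsP).
by apply: (cm_eqh (rho1_cmorph wt s a)); apply: eqh_sym; apply: lift_limP.
Qed.

Definition term_coef (x : term) : kh := (fpsC a * 'h) ^+ x.1.2 * fpsC x.1.1.

Lemma rho1_over_lift x : rho1 (over_lift x) =
  mono ((key x).1, 0) (fun j => term_coef x * cw x.2.1 j.1).
Proof.
have cr := rho1_cmorph wt s a; case: x => [[c d] [u v]]; rewrite /over_lift /=.
have -> : fpsC << c *g u >> * 'h ^+ d = 'h ^+ d *: (fpsC c *: fpsC << u >>) :> tfree X.
  rewrite hXZ; have -> : 'h ^+ d = iter d (@hs _) 1 :> tfree X by rewrite -hXM mulr1.
  by rewrite fpsC_malg; elim: d => [|d IH] /=; rewrite ?mulr1 // hsMr IH.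
rewrite (cmZ cr) (cmZC cr) rho1_word (cmX (krescale_cmorph a)) krescale_h !monoZ.
by apply: eq_mono => j; rewrite /term_coef mulrA.
Qed.

Lemma rho1_under_lift x : rho1 (under_lift x) =
  mono ((key x).2, 0) (fun j => cw x.2.2 j.1).
Proof. exact: rho1_word. Qed.

Definition rot_factor (e : nat * nat) (p : int) : kh :=
  match bead_at D e with
  | Some (Rotation b) => if b then kr p else kr' p
  | _ => 1
  end.

Definition omk (om : seq (int * int)) (t : nat) : int * int := nth (0, 0) om t.

Lemma key0 : key term0 = (0, 0).
Proof. by rewrite /key /= fm1 wtw0. Qed.

Definition edge_scalar (c : seq term) (e : nat * nat) (p : int) : kh :=
  match bead_at D e with
  | Some (Over t) => let x := nth term0 c t in term_coef x * cw x.2.1 p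
  | Some (Under t) => cw (nth term0 c t).2.2 p
  | Some (Rotation b) => if b then kr p else kr' p
  | None => 1
  end.

Lemma rho1_edge_lift c e : rho1 (edge_lift c e) =
  mono (dwo D (omk (map key c)) e, 0) (fun j => edge_scalar c e j.1).
Proof.
have nk t : omk (map key c) t = key (nth term0 c t).
  case: (ltnP t (size c)) => lt; first by rewrite /omk (nth_map term0).
  by rewrite /omk !nth_default ?size_map // key0.
rewrite /edge_lift /dwo /edge_scalar; case: (bead_at D e) => [[t|t|[]]|] /=.
- by rewrite rho1_over_lift nk.
- by rewrite rho1_under_lift nk.
- exact: rho_kl.
- exact: rho_kl'.
by rewrite (cm1 (rho1_cmorph wt s a)) mono1.
Qed.

(** The part of a state outside the crossings: the rotation beads, evaluated at the heights, and the
    condition that the total weight leads from m_0 to m_i. *)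
Definition state_prefactor (om : seq (int * int)) (i : J) : kh :=
  let dw := dwo D (omk om) in
  if i + (\sum_(e <- strand D) dw e, 0) == 0
  then \prod_(e <- strand D) rot_factor e (height D dw e) else 0.

Definition slice_scalar (om : seq (int * int)) (t : nat) (x : term) : kh :=
  let dw := dwo D (omk om) in
  if crossing D t then term_coef x * (cw x.2.1 (height D dw (over_edge D t)) *
     cw x.2.2 (height D dw (under_edge D t))) else 1.

(** Every bead is a weighted shift, so a state acts by a single one; its scalar, collected along the
    strand at the heights, is then rearranged by crossings. *)
Lemma ent_lift N i : ent (rho1 (lift_at N)) i 0 =
  \sum_(c <- choices [seq rawslice N sl | sl <- D])
    state_prefactor (map key c) i *
    \prod_(t < size D) slice_scalar (map key c) t (nth term0 c t).
Proof.
have cr := rho1_cmorph wt s a.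
rewrite /lift_at (cm_sum cr) ent_sum; apply: eq_bigr => c _.
rewrite (cm_prod cr); under eq_bigr do rewrite rho1_edge_lift.
rewrite (prod_rev_mono _ _ (uniq_strand conn)) ent_mono /state_prefactor.
case: ifP => _; last by rewrite mul0r.
set dw := dwo D _.
pose A t e : kh := term_coef (nth term0 c t) * cw (nth term0 c t).2.1 (height D dw e).
pose B t e : kh := cw (nth term0 c t).2.2 (height D dw e).
transitivity ((\prod_(e <- strand D) rot_factor e (height D dw e)) *
    \prod_(e <- strand D) bead_factor D A B e).
  rewrite -big_split; apply: eq_bigr => e _ /=.
  rewrite sub0r -/(height D dw e) /edge_scalar /rot_factor /bead_factor.
  by case: (bead_at D e) => [[t|t|b]|]; rewrite ?mul1r ?mulr1.
congr (_ * _); rewrite (bead_factor_prod comp conn); apply: eq_bigr => t _.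
by rewrite /slice_scalar; case: ifP => // _; rewrite /A /B mulrA.
Qed.

(** A term u (x) v shifts the indices by its two weights, so exactly the terms with key (w1, w2)
    feed this entry; those of degree N or more vanish modulo h^N. *)
Lemma rawexp_ent Q N (w1 w2 p q : int) :
  eqh N (\sum_(x <- rawexp Q N | key x == (w1, w2)) term_coef x * (cw x.2.1 p * cw x.2.2 q))
    (ent (rho12 Q) (p - w1, q - w2) (p, q)).
Proof.
have cr := rho12_cmorph wt s a.
pose QN : ftens X := \sum_(d < N) 'h ^+ d *: fpsC (coef Q d).
have eQ : eqh N QN Q.
  move=> n lt; rewrite fcoef_sum.
  rewrite (eq_bigr (fun d : 'I_N => if d == Ordinal lt then coef Q d else 0)).
    by rewrite -big_mkcond big_pred1_eq.
  by move=> d _; rewrite coef_hXC eq_sym.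
apply: (eqh_trans (ent (rho12 QN) (p - w1, q - w2) (p, q))); last first.
  by apply: ent_eqh; apply: (cm_eqh cr).
suff -> : ent (rho12 QN) (p - w1, q - w2) (p, q) =
    \sum_(x <- rawexp Q N | key x == (w1, w2)) term_coef x * (cw x.2.1 p * cw x.2.2 q) by [].
rewrite /QN (cm_sum cr) ent_sum /rawexp big_flatten big_map /=.
have -> : iota 0 N = index_iota 0 N by rewrite /index_iota subn0.
rewrite big_mkord; apply: eq_bigr => d _; rewrite big_map.
have eC : fpsC (coef Q d) =
      \sum_(w <- msupp (coef Q d)) fpsC (coef Q d)@_w *: fpsC << w >> :> ftens X.
  rewrite {1}[coef Q d]monalgE (big_morph (@fpsC _) (@fpsCD _) (fpsC0 _)).
  by apply: eq_bigr => w _; apply: fpsC_malg.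
rewrite eC (cmZ cr) (cm_sum cr) (cmX (krescale_cmorph a)) krescale_h entZ ent_sum.
rewrite mulr_sumr [RHS]big_mkcond; apply: eq_bigr => w _ /=.
rewrite (cmZC cr) rho12_pair monoZ ent_mono /key /= xpair_eqE.
have sh (x y z : int) : (x - y + z == x) = (z == y) by apply/eqP/eqP; lia.
rewrite [in RHS]xpair_eqE !sh; case: ifP; rewrite ?mulr0 // => _.
exact: mulrA.
Qed.

(* The sum over the terms of a crossing with prescribed bead weights is a matrix
   entry of R or R^-1. *)
Definition slice_weight (om : seq (int * int)) (t : nat) : kh :=
  let dw := dwo D (omk om) in
  let j : J := (height D dw (over_edge D t), height D dw (under_edge D t)) in
  if crossing D t then ent (rho12 (rmat (slice D t).2)) (j.1 - (omk om t).1, j.2 - (omk om t).2) j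
  else (omk om t == 0)%:R.

(** [Ks] may be any duplicate-free lists containing the keys that occur. This freedom lets the
    invariants of both algebras be summed over the same index set. *)
Lemma state_sum N i (Ks : seq (seq (int * int))) :
  size Ks = size D -> all uniq Ks ->
  (forall t x, (t < size D)%N -> x \in rawslice N (slice D t) -> key x \in nth [::] Ks t) ->
  eqh N (ent (rho1 (repr (universal_invariant R (pi kl) K))) i 0)
    (\sum_(om <- choices Ks) state_prefactor om i * \prod_(t < size D) slice_weight om t).
Proof.
move=> sK uK keyK.
apply: (eqh_trans _ (ent_eqh i 0 (@rho1_invariant N))).
rewrite ent_lift -(size_map (rawslice N) D).
rewrite (big_choices_key term0 (0, 0) (state_prefactor^~ i) slice_scalar (Ks := Ks)) //; first last.
- by move=> t x; rewrite size_map => lt; rewrite (nth_map (0%N, MinL)) //; apply: keyK.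
- by rewrite size_map.
apply: eqh_sum => om _; apply: eqhM => //; apply: eqh_prod => -[t /= lt] _.
rewrite size_map in lt; rewrite (nth_map (0%N, MinL))//.
rewrite /rawslice -/(crossing D t) /slice_weight /slice_scalar.
case: ifP => cr; last first.
  by rewrite big_mkcond big_seq1 key0 eq_sym /omk; case: eqP.
by have [w1 w2] := omk om t; apply: rawexp_ent.
Qed.
End StateSum.

(** * Comparison of the invariants *)

Lemma fexp_h_rep (X : choiceType) (wt : X -> int) (s : X -> int -> kh) (a : Qeps)
    (x : tfree X) (d : int -> kh) :
  rho1 wt s a x = mono 0 (fun j => d j.1) ->
  exists kl', [/\ fexp ('h * x) * kl' = 1, kl' * fexp ('h * x) = 1,
    rho1 wt s a (fexp ('h * x)) = mono 0 (fun j => Ex (fpsC a * d j.1)) &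
    rho1 wt s a kl' = mono 0 (fun j => Ex (- (fpsC a * d j.1)))].
Proof.
move=> rx; have cr := rho1_cmorph wt s a.
have rk := cm_fexp_diag cr rx; have [y ky yk] := geom_inv (coef_fexp_h x).
exists y; split; [exact: ky | exact: yk | exact: rk |].
have e := cm_inv cr yk; rewrite rk in e.
move: (rho1 wt s a y) e => Y e; pose d' (j : J) := Ex (- (fpsC a * d j.1)).
have e' : mono 0 (fun j => Ex (fpsC a * d j.1)) * mono 0 d' = 1.
  by rewrite diagM mono1; apply: eq_mono => j; apply: ExN.
by rewrite -[Y]mulr1 -e' mulrA e mul1r.
Qed.

(** * The balancing elements *)

Section Kappa.
Variables (lambda : Qeps) (mu : kh).
Local Notation wl := (wl lambda).
Local Notation sU := (sU lambda).
Local Notation sD := (sD lambda mu).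

Lemma kappa_U_rep : exists kl kl', [/\ kl * kl' = 1, kl' * kl = 1,
  rho1 wtU sU 1 kl = mono 0 (fun j => Ex (wl j.1)),
  rho1 wtU sU 1 kl' = mono 0 (fun j => Ex (- wl j.1)) & U_kappa = pres_pi U_rels kl].
Proof.
have rH : rho1 wtU sU 1 (gen UH) = mono 0 (fun j => wl j.1) by exact: rho1_gen.
have [kl' [e1 e2 e3 e4]] := fexp_h_rep rH.
exists (fexp ('h * gen UH)), kl'; split; [exact: e1 | exact: e2 | | | exact: erefl].
  by apply: (etrans e3); apply: eq_mono => j; rewrite fpsC1 mul1r.
by apply: (etrans e4); apply: eq_mono => j; rewrite fpsC1 mul1r.
Qed.

(** The central parameter cancels: eps a + b becomes eps (Ht - H) / 2 = - eps H', so h (eps a + b) /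
    2 turns into - h H' and the balancing element into q^H'. *)
Lemma kappa_D_rep : exists kl kl', [/\ kl * kl' = 1, kl' * kl = 1,
  rho1 wtD sD (2 / eps) kl = mono 0 (fun j => Ex (wl j.1)),
  rho1 wtD sD (2 / eps) kl' = mono 0 (fun j => Ex (- wl j.1)) & D_kappa = pres_pi D_rels kl].
Proof.
have cr := rho1_cmorph wtD sD (2 / eps).
pose x : tfree Dgen := - (fpsC 2^-1 *: (fpsC eps *: gen Ga + gen Gb)).
pose d p := fpsC (eps / 2) * wl p.
have rx : rho1 wtD sD (2 / eps) x = mono 0 (fun j => d j.1).
  rewrite (cmN cr) (cmZC cr) (cmD cr) (cmZC cr) !rho1_gen !monoZ monoD monoZ monoN.
  apply: eq_mono => j; rewrite /d /= [fpsC eps * _]mulrA -fpsCM.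
  transitivity (fpsC 2^-1 * 2 * (fpsC (eps / 2) * wl j.1)); last by rewrite half2 mul1r.
  move: (fpsC 2^-1) (fpsC (eps / 2)) (wl j.1) => t e w; ring.
have [kl' [e1 e2 e3 e4]] := fexp_h_rep rx.
exists (fexp ('h * x)), kl'; split; [exact: e1 | exact: e2 | | |].
- by apply: (etrans e3); apply: eq_mono => j; rewrite resc_eps_half.
- by apply: (etrans e4); apply: eq_mono => j; rewrite resc_eps_half.
apply: (congr1 (fun z => pres_pi D_rels (fexp z))); rewrite /x mulrN; apply: (congr1 -%R).
exact: (fps_scalerAr (@malg_scalerAr _ _)).
Qed.
End Kappa.

Section Compare.
Variables (K : long_knot) (lambda : Qeps) (mu : kh).
Let D := diagram K.
Let comp := knot_composable K.
Let conn := knot_component K.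
Local Notation weightU := (slice_weight wtU (sU lambda) 1 U_R K).
Local Notation weightD := (slice_weight wtD (sD lambda mu) (2 / eps) D_R K).

Definition crossing_sign (t : nat) : int :=
  match (slice D t).2 with CrossP => 1 | CrossN => -1 | _ => 0 end.

Lemma framing_sum : framing K = \sum_(t < size D) crossing_sign t.
Proof. by rewrite /framing (big_nth (0%N, MinL)) big_mkord. Qed.

Lemma ent_sandwich d (O : fps lop) i j : ent (mono 0 d * O * mono 0 d) i j = d i * d j * ent O i j.
Proof. by rewrite ent_diagr ent_diagl mulrAC. Qed.

(** A diagonal operator multiplies an entry by its values at the outgoing and incoming indices; for
    T these two values combine into [crossing_exponent]. *)
Lemma slice_weight_conj om t : weightD om t =
  Ex (- (fpsC 2^-1 * mu * mu * (crossing_sign t)%:~R)) *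
  chi mu (if crossing D t then crossing_exponent D (omk om) t else 0) * weightU om t.
Proof.
rewrite /slice_weight /crossing_sign /crossing_exponent -/D.
set oh := height _ _ _; set uh := height _ _ _.
move: (omk om t) oh uh => [x y] oh uh; rewrite /crossing.
case: (slice D t) => i [] /=; try by rewrite mulr0 oppr0 Ex0 chi0 !mul1r.
  rewrite rhoD_R_conj entZ ent_sandwich -chiD mulr1 /=; exact: mulrA.
rewrite rhoD_RV_conj entZ ent_sandwich -chiD mulrN1 opprK -opprD /=; exact: mulrA.
Qed.

Lemma rmat_comm p : Ntot * rho12 wtU (sU lambda) 1 (rmat U_R p) =
  rho12 wtU (sU lambda) 1 (rmat U_R p) * Ntot.
Proof. by case: p; [exact: rhoU_R_comm | exact: rhoU_RV_comm ..]. Qed.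

Lemma slice_weight_unbalanced om t : crossing D t ->
  (omk om t).1 + (omk om t).2 != 0 -> weightU om t = 0.
Proof.
rewrite /slice_weight -/D => ->; set oh := height _ _ _; set uh := height _ _ _.
move: (omk om t) oh uh => [x y] oh uh /= ne.
have b : (oh - x, uh - y).1 + (oh - x, uh - y).2 != (oh, uh).1 + (oh, uh).2.
  by apply: contra ne => /eqP /= e; apply/eqP; lia.
exact: (ent_comm0 (rmat_comm _) b).
Qed.

Let kr p := Ex (wl lambda p).
Let kr' p := Ex (- wl lambda p).
Local Notation prefactor := (state_prefactor K kr kr').
Local Notation rhoU := (rho1 wtU (sU lambda) 1).
Local Notation rhoD := (rho1 wtD (sD lambda mu) (2 / eps)).

Hypothesis framing0 : framing K = 0.

(* By weight conservation only states whose bead weights are opposite at each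
   crossing contribute; for these the powers of chi cancel along the diagram. *)
Lemma balanced_or_not om :
  (exists2 t : 'I_(size D), crossing D t & (omk om t).1 + (omk om t).2 != 0) \/
  (forall t, (t < size D)%N -> crossing D t -> (omk om t).1 + (omk om t).2 = 0).
Proof.
case: (pselect (exists2 t : 'I_(size D), crossing D t & (omk om t).1 + (omk om t).2 != 0)).
  by left.
move=> h; right => t lt cr; apply: contrapT => /eqP ne.
by apply: h; exists (Ordinal lt).
Qed.

Lemma state_terms om : \prod_(t < size D) weightD om t = \prod_(t < size D) weightU om t.
Proof.
under eq_bigr do rewrite slice_weight_conj.
case: (balanced_or_not om) => [[t cr ne]|om0].
  rewrite (bigD1 t isT) [RHS](bigD1 t isT) /=.
  by rewrite (slice_weight_unbalanced cr ne) mulr0 !mul0r.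
rewrite !big_split /= Ex_prod sumrN -mulr_sumr -rmorph_sum /= -framing_sum framing0.
rewrite mulr0 oppr0 Ex0 mul1r -(big_morph (chi mu) (chiD mu) (chi0 mu)).
by rewrite (crossing_exponent_sum comp conn om0) chi0 mul1r.
Qed.

Lemma state_terms0 om (i : int * int) : i != 0 ->
  prefactor om i * \prod_(t < size D) weightU om t = 0.
Proof.
move=> i0; case: (balanced_or_not om) => [[t cr ne]|om0].
  by rewrite (bigD1 t isT) /= (slice_weight_unbalanced cr ne) mul0r mulr0.
rewrite /state_prefactor (total_dwo comp conn om0).
have -> : i + (0, 0) = i by case: i {i0} => x y; congr pair; rewrite addr0.
by rewrite (negbTE i0) mul0r.
Qed.

Lemma state_sums N i : exists Ks,
  let S w := \sum_(om <- choices Ks) prefactor om i * \prod_(t < size D) w om t in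
  eqh N (ent (rhoU (repr (Z_U K))) i 0) (S weightU) /\
  eqh N (ent (rhoD (repr (Z_D K))) i 0) (S weightD).
Proof.
have [kU [kU' [U1 U2 U3 U4 U5]]] := kappa_U_rep lambda.
have [kD [kD' [D1 D2 D3 D4 D5]]] := kappa_D_rep lambda mu.
(* The union of the keys of both expansions, so that both state sums run over the same choices. *)
pose Ks := [seq undup (map (key wtU) (rawslice U_R N sl) ++
                       map (key wtD) (rawslice D_R N sl)) | sl <- D].
have sK : size Ks = size D by rewrite size_map.
have uK : all uniq Ks 
  by apply/(all_nthP [::]) => t; rewrite size_map => lt; rewrite (nth_map (0%N, MinL)) ?undup_uniq.
exists Ks; rewrite /Z_U /Z_D U5 D5; split.
- apply: (state_sum (@U_relsP lambda) U1 U2 U3 U4 i sK uK) => t x lt xr.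
  by rewrite (nth_map (0%N, MinL)) // mem_undup mem_cat map_f.
- apply: (state_sum (@D_relsP lambda mu) D1 D2 D3 D4 i sK uK) => t x lt xr.
by rewrite (nth_map (0%N, MinL)) // mem_undup mem_cat orbC map_f.
Qed.

Lemma invariants_ent i : ent (rhoU (repr (Z_U K))) i 0 = ent (rhoD (repr (Z_D K))) i 0.
Proof.
apply: eqh_eq => N; have [Ks [eU eD]] := state_sums N i.
apply: (eqh_trans _ eU); apply: eqh_sym; apply: (eqh_trans _ eD).
by under eq_bigr do rewrite state_terms.
Qed.

Lemma invariant_U_ent0 i : i != 0 -> ent (rhoU (repr (Z_U K))) i 0 = 0.
Proof.
move=> i0; apply: eqh_eq => N; have [Ks [eU _]] := state_sums N i.
apply: (eqh_trans _ eU).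
by under eq_bigr do rewrite (state_terms0 _ i0); rewrite big1.
Qed.
End Compare.

Theorem corollary3p22 (K : long_knot) (lambda : Qeps) (mu : fps Qeps) :
  framing K = 0 ->
  colored_jones K lambda *: mvec 0 = Dsl2_act lambda mu (phi (Z_D K)) (mvec 0).
Proof.
move=> f0.
pose J := ent (rho1 wtU (sU lambda) 1 (repr (Z_U K))) 0 0.
(* The highest weight vector is an eigenvector: all other entries of its column vanish, because the
   beads of a contributing state have total weight 0. *)
have scalar : J *: mvec 0 = verma_act lambda (Z_U K) (mvec 0).
  apply: fpsP => n; apply/malgP => p; rewrite verma_act_coef fcoefZC mcoeffZ mcoeffU.
  have [->|p0] := eqVneq p 0%N; first by rewrite mulr1.
  have i0 : (p%:Z, 0) != 0 :> (int * int)%type by rewrite xpair_eqE eqz_nat negb_and p0.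
  by rewrite (@invariant_U_ent0 K lambda mu _ i0) mulr0.
have -> : colored_jones K lambda *: mvec 0 = verma_act lambda (Z_U K) (mvec 0).
  (* The witness J shows that the set from which [colored_jones] is chosen is inhabited, so the
     chosen scalar satisfies the same equation. *)
  pose A := [set x | x *: mvec 0 = verma_act lambda (Z_U K) (mvec 0)]%classic.
  exact: (@xgetPex _ 0 A (ex_intro _ J scalar)).
apply: fpsP => n; apply/malgP => p.
apply: (etrans (verma_act_coef lambda (Z_U K) n p)); apply: esym.
apply: (etrans (Dsl2_act_coef lambda mu (Z_D K) n p)).
by rewrite (@invariants_ent K lambda mu f0).
Qed.
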